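(* Let $d\geq 1$ and let $n$ be a natural number. Assume that $f:\mathbb{R}^d\to\mathbb{C}$ is a continuous function such that $$\det\left[\begin{array}{cccc} f(x) & f(x+h) & \cdots & f(x+nh)\\ f(x+h) & f(x+2h) & \cdots & f(x+(n+1)h)\\ \vdots & \vdots & \ddots & \vdots\\ f(x+nh) & f(x+(n+1)h) & \cdots & f(x+2nh) \end{array}\right]=0\quad\text{for all } x,h\in\mathbb{R}^d.$$ Then $f$ is an exponential polynomial.
   Context: The matrix is the $(n+1)\times(n+1)$ matrix with entries $f(x+(i+j)h)$, $0\leq i,j\leq n$. An exponential polynomial on $\mathbb{R}^d$ is a finite sum $x\mapsto\sum_{k}P_k(x)e^{\langle\lambda_k,x\rangle}$, where each $P_k$ is a polynomial in $d$ variables with complex coefficients, $\lambda_k\in\mathbb{C}^d$, and $\langle\lambda,x\rangle=\sum_{j=1}^d\lambda_jx_j$ (the zero function is included). *)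

(* Defs.v *)
From HB Require Import structures.
From mathcomp Require Import all_boot all_order all_algebra.
From mathcomp Require Import complex.
From mathcomp Require mpoly.
From mathcomp Require Import all_classical all_reals all_analysis.

Set Implicit Arguments.
Unset Strict Implicit.
Unset Printing Implicit Defensive.

Import Order.TTheory GRing.Theory Num.Theory.
Import numFieldNormedType.Exports.
Local Open Scope ring_scope.
Local Open Scope complex_scope.

Definition cexp (R : realType) (z : R[i]) : R[i] :=
  (expR (complex.Re z))%:C *
  (cos (complex.Im z) +i* sin (complex.Im z)).

(* The bilinear pairing <lam, x> = \sum_j lam_j x_j (no conjugation). *)
Definition pairing (R : realType) (d : nat)
    (lam : 'rV[R[i]]_d) (x : 'rV[R]_d) : R[i] :=
  \sum_(j < d) lam 0 j * (x 0 j)%:C.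

(* [mpoly] is not imported, since its notations clash with those of
   MathComp-Analysis: [mpoly.mpoly d R[i]] is the ring of polynomials in d
   variables over R[i], and [mpoly.meval v p] is the value of p at v. *)
Definition exponential_polynomial (R : realType) (d : nat)
    (f : 'rV[R]_d -> R[i]) : Prop :=
  exists (m : nat) (P : 'I_m -> mpoly.mpoly d R[i])
         (lam : 'I_m -> 'rV[R[i]]_d),
    forall x : 'rV[R]_d,
      f x = \sum_(k < m)
              mpoly.meval (fun j : 'I_d => (x 0 j)%:C) (P k)
              * cexp (pairing (lam k) x).

(* Main.v *)
Require Import Defs.
From mathcomp Require Import all_boot all_order all_algebra.
From mathcomp Require Import complex qpoly.
From mathcomp Require mpoly.
Import -(notations) mpoly.
From mathcomp Require Import all_classical all_reals all_analysis.
From mathcomp Require Import ring lra zify.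

(** Call the rank of f the largest r for which some Hankel-type determinant
    det f(x + (p_i + q_j) h) of size r, with arbitrary real nodes p_i and q_j,
    is nonzero.  The point is that such a nonzero determinant in a direction h
    gives an identity f(y + t h) = sum_j b_j(t) f(y + q_j h) valid for all y
    and t, where the b_j are exponential polynomials (finite_shift_rank,
    shift_coef_jordan).  Being nonzero is an open condition, so h may be
    replaced by h + e e_j for a small e and all basis vectors e_j.  Every x is
    a combination of these d + 1 directions with coefficients linear in x, and
    expanding f(x) along them one after the other writes f as a sum of products
    of exponential polynomials (exp_poly_of_directions).

    From equispaced to arbitrary nodes.  For a two-sided sequence, vanishing
    Hankel determinants of size N force all minors of size N to vanish
    (minors_of_hankel): at the critical size, kernel vectors of adjacent Hankel
    matrices coincide, which gives one recurrence valid on the whole of Z.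
    Real nodes are then limits of nodes in hZ as h tends to 0
    (minors_of_equispaced).

    One line.  If all minors of size r + 1 vanish and one of size r does not,
    a Schur complement gives phi(x + y) = sum_j c_j(x) phi(p_j + y)
    (schur_kernel).  The vector F of the functions phi(p_j + t) thus satisfies
    F(t + s) = B(s) F(t) with B continuous; integrating in s shows that F' = L F
    for a matrix L whose size is controlled by how fast B leaves the identity
    (group_generator).  So phi is an exponential generating function
    sum_k u_k t^k / k! whose coefficients satisfy a recurrence of order r
    (Cayley-Hamilton) and a geometric bound, and the bound is uniform for
    neighbouring lines (uniform_expansion).

    One plane.  The orders and roots of these recurrences might a priori depend
    on the line.  In the plane through x0 spanned by a direction u of maximal
    rank and a second direction, uniform expansions along the rays of a cone
    and along a strip of parallel lines show that f is a double exponential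
    generating function: the k-th coefficient along the ray of slope m is a
    polynomial of degree at most k in m, with geometrically bounded coefficients
    (cone_expansion), and the expansion propagates to the whole plane along
    lines through an interior point of the cone (plane_extension).

    Parallel lines.  In such a plane the restriction of f to the line of slope m
    through any point has a recurrence whose coefficients are, by Cramer's
    rule, rational functions of m.  All roots of the recurrence are bounded by
    the growth rate A (1 + |m|) of the Taylor coefficients, also for complex m
    (root_growth), so these rational functions have no poles: they are
    polynomials in m of bounded degree, and Lipschitz at 0 with a constant that
    does not depend on the base point (coef_poly_lipschitz).  Two parallel lines
    of slope 0 are joined by a line of slope m tending to 0, along which the
    recurrence is constant; hence their recurrences agree (same_annihilator).
    So all lines of direction u share one recurrence
    (common_direction_annihilator); its solutions form a space of dimension r,
    spanned by r translates of one restriction of f, and this is the identity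
    displayed above. *)

Set Implicit Arguments.
Unset Strict Implicit.
Unset Printing Implicit Defensive.
Import Order.TTheory GRing.Theory Num.Theory.
Import numFieldNormedType.Exports.
Local Open Scope classical_set_scope.
Local Open Scope ring_scope.
Local Open Scope complex_scope.

(** * Two-sided sequences with vanishing Hankel determinants *)

Section TwoSided.
Variables (F : fieldType) (a : int -> F).

Definition hankel_det (N : nat) (m : int) : F :=
  \det (\matrix_(i < N, j < N) a (m + (i + j)%:Z)).

(** Kernel vectors are sequences, so that they can be shifted and padded without
    changing their type. *)
Definition nonsingular_hankel (r : nat) (m : int) : Prop :=
  forall w : nat -> F,
    (forall i, (i < r)%N -> \sum_(j < r) w j * a (m + (i + j)%:Z) = 0) ->
    forall j, (j < r)%N -> w j = 0.

Lemma hankel_det_nonsingular r m : hankel_det r m != 0 -> nonsingular_hankel r m.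
Proof.
move=> Hd w Hw j jr.
have Hm : (\row_(j < r) w j) *m (\matrix_(i < r, j < r) a (m + (i + j)%:Z)) = 0.
  apply/rowP => i; rewrite !mxE -[RHS](Hw i (ltn_ord i)).
  by apply: eq_bigr => k _; rewrite !mxE addnC.
have U : (\matrix_(i < r, j < r) a (m + (i + j)%:Z)) \in unitmx.
  by rewrite unitmxE unitfE.
have /rowP/(_ (Ordinal jr)) : \row_(j < r) w j = 0.
  by rewrite -(mulmxK U (\row_(j < r) w j)) Hm mul0mx.
by rewrite !mxE.
Qed.

Lemma hankel_det_kernel r m : hankel_det r.+1 m = 0 ->
  exists v : nat -> F, (exists2 j, (j <= r)%N & v j != 0) /\
    (forall i, (i <= r)%N -> \sum_(j < r.+1) v j * a (m + (i + j)%:Z) = 0).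
Proof.
move/eqP/det0P => [v v0 Hv].
exists (fun k => v 0 (inord k)); split.
  have /rV0Pn[j Hj] := v0.
  by exists j; [rewrite -ltnS | rewrite inord_val].
move=> i ir; have /rowP/(_ (Ordinal (ir : (i < r.+1)%N))) := Hv.
rewrite !mxE => E; rewrite -[RHS]E; apply: eq_bigr => k _.
by rewrite !mxE inord_val addnC.
Qed.

(** If an end entry of v vanished, the rest of v would be a nonzero kernel vector
    of the nonsingular block of size r, which sits in two corners of the larger
    matrix. *)
Lemma kernel_ends r m (v : nat -> F) : nonsingular_hankel r m ->
  (exists2 j, (j <= r)%N & v j != 0) ->
  (forall i, (i <= r)%N -> \sum_(j < r.+1) v j * a (m - 1 + (i + j)%:Z) = 0) ->
  v 0%N != 0 /\ v r != 0.
Proof.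
move=> ns [j0 j0r vj0] Hv; split; apply/eqP => v0; move/eqP: vj0; apply.
- case: j0 j0r => [//|j0 j0r]; apply: (ns (fun k => v k.+1)) => // i ir.
  rewrite -[RHS](Hv i (ltnW ir)) big_ord_recl v0 mul0r add0r.
  by apply: eq_bigr => k _; congr (_ * a _); rewrite /= /bump leq0n; lia.
- have [->//|nj] := eqVneq j0 r.
  apply: ns; last by rewrite ltn_neqAle nj.
  move=> i ir; rewrite -[RHS](Hv i.+1 ir) big_ord_recr /= v0 mul0r addr0.
  by apply: eq_bigr => k _; congr (_ * a _); lia.
Qed.

(** A kernel vector w of a neighbouring block, padded with a zero and corrected by
    a multiple of a kernel vector v of the singular matrix, lies in the kernel of
    the nonsingular block.  So w is proportional to v after padding, and the
    nonzero end entries of v then force w = 0. *)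
Lemma nonsingular_step r m : (forall m, hankel_det r.+1 m = 0) -> nonsingular_hankel r m ->
  nonsingular_hankel r (m + 1) /\ nonsingular_hankel r (m - 1).
Proof.
move=> H0 ns.
have [v [Hnz Hv]] := hankel_det_kernel (H0 (m - 1)).
have [v0 vr] := kernel_ends ns Hnz Hv.
split=> w Hw.
- case: r H0 ns Hnz Hv vr Hw => [//|r] H0 ns Hnz Hv vr Hw.
  pose x j := v r.+1 * (if j is j'.+1 then w j' else 0) - w r * v j.
  have Hx : forall j, (j < r.+1)%N -> x j = 0.
    apply: ns => i ir.
    have E1 : \sum_(j < r.+2) (if j : nat is j'.+1 then w j' else 0) * a (m + (i + j)%:Z) = 0.
      rewrite big_ord_recl mul0r add0r -[RHS](Hw i ir).
      by apply: eq_bigr => k _; congr (_ * a _); rewrite /= /bump leq0n; lia.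
    have E2 : \sum_(j < r.+2) v j * a (m + (i + j)%:Z) = 0.
      rewrite -[RHS](Hv i.+1 ir).
      by apply: eq_bigr => k _; congr (_ * a _); lia.
    have : \sum_(j < r.+2) x j * a (m + (i + j)%:Z) = 0.
      under eq_bigr do rewrite /x mulrBl -!mulrA.
      by rewrite sumrB -!mulr_sumr E1 E2 !mulr0 subrr.
    by rewrite big_ord_recr /= {2}/x mulrC [w r * _]mulrC subrr mulr0 addr0.
  (* x vanishes at 0, where the padded w is 0 and v is not *)
  have wr : w r = 0.
    have := Hx 0%N isT; rewrite /x mulr0 sub0r => /eqP.
    by rewrite oppr_eq0 mulf_eq0 (negPf v0) orbF => /eqP.
  move=> j; rewrite ltnS leq_eqVlt => /orP[/eqP->//|jr].
  have := Hx j.+1 jr; rewrite /x wr mul0r subr0 => /eqP.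
  by rewrite mulf_eq0 (negPf vr) /= => /eqP.
- pose x j := v 0%N * (if (j < r)%N then w j else 0) - w 0%N * v j.
  have [r0|r0] := posnP r; first by move=> j; rewrite r0.
  have Hx : forall j, (j < r)%N -> x j.+1 = 0.
    apply: (ns (fun j => x j.+1)) => i ir.
    have E1 : \sum_(j < r.+1) (if (j < r)%N then w j else 0) * a (m - 1 + (i + j)%:Z) = 0.
      rewrite big_ord_recr /= ltnn mul0r addr0 -[RHS](Hw i ir).
      by apply: eq_bigr => k _; rewrite ltn_ord.
    have E2 : \sum_(j < r.+1) v j * a (m - 1 + (i + j)%:Z) = 0 := Hv i (ltnW ir).
    have : \sum_(j < r.+1) x j * a (m - 1 + (i + j)%:Z) = 0.
      under eq_bigr do rewrite /x mulrBl -!mulrA.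
      by rewrite sumrB -!mulr_sumr E1 E2 !mulr0 subrr.
    rewrite big_ord_recl /= {1}/x r0 mulrC [w 0%N * _]mulrC subrr mulr0 add0r => E.
    rewrite -[RHS]E.
    by apply: eq_bigr => k _; congr (_ * a _); rewrite /= /bump leq0n; lia.
  (* x vanishes at r, where the padded w is 0 and v is not *)
  have w0 : w 0%N = 0.
    have := Hx r.-1; rewrite prednK // => /(_ (leqnn _)).
    rewrite /x ltnn mulr0 sub0r => /eqP.
    by rewrite oppr_eq0 mulf_eq0 (negPf vr) orbF => /eqP.
  move=> [//|j] jr.
  have := Hx j (ltnW jr); rewrite /x jr w0 mul0r subr0 => /eqP.
  by rewrite mulf_eq0 (negPf v0) /= => /eqP.
Qed.

Lemma nonsingular_everywhere r m0 : (forall m, hankel_det r.+1 m = 0) -> nonsingular_hankel r m0 ->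
  forall m, nonsingular_hankel r m.
Proof.
move=> H0 ns m; have -> : m = m0 + (m - m0) by lia.
elim/int_rect: (m - m0) => [|n IH|n IH]; first by rewrite addr0.
- by have [+ _] := nonsingular_step H0 IH; rewrite -addrA [_ + 1]addrC -intS.
- have [_ +] := nonsingular_step H0 IH.
  by rewrite (_ : m0 - n%:Z - 1 = m0 - n.+1%:Z) //; lia.
Qed.

(** Kernel vectors of consecutive singular matrices of size r + 1, normalised by
    v r = 1, satisfy r common equations whose block is nonsingular, so they
    coincide. *)
Lemma recurrence_of_hankel r m0 : (forall m, hankel_det r.+1 m = 0) ->
  nonsingular_hankel r m0 ->
  exists v : nat -> F, [/\ v 0%N != 0, v r = 1 &
    forall k, \sum_(j < r.+1) v j * a (k + j%:Z) = 0].
Proof.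
move=> H0 ns0; have ns := nonsingular_everywhere H0 ns0.
have H m : exists v : nat -> F, [/\ v 0%N != 0, v r = 1 &
  forall i, (i <= r)%N -> \sum_(j < r.+1) v j * a (m + (i + j)%:Z) = 0].
  have [v [Hnz Hv]] := hankel_det_kernel (H0 m).
  have [|v0 vr] := @kernel_ends r (m + 1) v (ns _) Hnz.
    by rewrite addrK.
  exists (fun j => v j / v r); split; first by rewrite mulf_neq0 ?invr_eq0.
    by rewrite divff.
  move=> i ir; under eq_bigr do rewrite mulrAC.
  by rewrite -mulr_suml Hv // mul0r.
have [v [v0 vr Hv]] := H 0.
exists v; split=> // k.
suff {}K : forall i, (i <= r)%N -> \sum_(j < r.+1) v j * a (k + (i + j)%:Z) = 0.
  by rewrite -[RHS](K 0%N isT).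
have St m w : v r = w r ->
  (forall i, (i < r)%N -> \sum_(j < r.+1) v j * a (m + (i + j)%:Z) = 0) ->
  (forall i, (i < r)%N -> \sum_(j < r.+1) w j * a (m + (i + j)%:Z) = 0) ->
  forall j, (j <= r)%N -> w j = v j.
  move=> vw Hv' Hw j; rewrite leq_eqVlt => /orP[/eqP->//|jr].
  apply/eqP; rewrite -subr_eq0; apply/eqP; move: j jr.
  apply: (ns m (fun j => w j - v j)) => i ir.
  have := Hw i ir; rewrite -[X in _ = X -> _](Hv' i ir) => /eqP.
  rewrite !big_ord_recr /= vw (inj_eq (addIr _)) => /eqP E.
  by under eq_bigr do rewrite mulrBl; rewrite sumrB E subrr.
elim/int_rect: k => [//|n IH|n IH].
- have [w [w0 wr Hw]] := H (n.+1%:Z).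
  have E : forall j, (j <= r)%N -> w j = v j.
    apply: (St n.+1%:Z); [by rewrite vr wr| |by move=> i /ltnW; exact: Hw].
    move=> i ir; rewrite -[RHS](IH i.+1 ir).
    by apply: eq_bigr => k _; congr (_ * a _); lia.
  move=> i ir; rewrite -[RHS](Hw i ir); apply: eq_bigr => j _.
  by rewrite -E // -ltnS.
- have [w [w0 wr Hw]] := H (- n.+1%:Z).
  have E : forall j, (j <= r)%N -> w j = v j.
    apply: (St (- n%:Z)); [by rewrite vr wr|by move=> i /ltnW; exact: IH|].
    move=> i ir; rewrite -[RHS](Hw i.+1 ir).
    by apply: eq_bigr => k _; congr (_ * a _); lia.
  move=> i ir; rewrite -[RHS](Hw i ir); apply: eq_bigr => j _.
  by rewrite -E // -ltnS.
Qed.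

(** Both end coefficients of the recurrence are invertible, so it can be run in
    both directions. *)
Lemma finite_rank_of_recurrence r (v : nat -> F) : v 0%N != 0 -> v r = 1 ->
  (forall k, \sum_(j < r.+1) v j * a (k + j%:Z) = 0) ->
  forall p : int, exists X : nat -> F,
    forall q, a (p + q) = \sum_(j < r) X j * a (q + j%:Z).
Proof.
move=> v0 vr Hv.
have [r0 p|r0] := posnP r.
  exists (fun=> 0) => q; rewrite big1 => [|? _]; last by rewrite mul0r.
  have := Hv (p + q); rewrite r0 in vr *; rewrite big_ord1 vr mul1r addr0 //.
case: r r0 vr Hv => // r _ vr Hv.
have up q : a (q + r.+1%:Z) = - \sum_(j < r.+1) v j * a (q + j%:Z).
  by apply/eqP; rewrite -addr_eq0 addrC; have := Hv q; rewrite big_ord_recr /= vr mul1r => ->.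
elim/int_rect => [|n [X IH]|n [X IH]].
- exists (fun j => (j == 0)%:R) => q; rewrite big_ord_recl mul1r addr0 add0r.
  by rewrite big1 ?addr0 // => i _; rewrite mul0r.
- exists (fun j => (if j is j'.+1 then X j' else 0) - X r * v j) => q.
  rewrite (_ : n.+1%:Z + q = n%:Z + (q + 1)); last by lia.
  rewrite IH big_ord_recr /= (_ : q + 1 + r%:Z = q + r.+1%:Z); last by lia.
  under [RHS]eq_bigr do rewrite mulrBl -mulrA.
  rewrite sumrB -mulr_sumr up mulrN [X in _ = X - _]big_ord_recl mul0r add0r; congr (_ - _).
  by apply: eq_bigr => i _; congr (_ * a _); rewrite /= /bump leq0n; lia.
- pose c := X 0%N / v 0%N.
  exists (fun j => (if (j < r)%N then X j.+1 else 0) - c * v j.+1) => q.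
  rewrite (_ : - n.+1%:Z + q = - n%:Z + (q - 1)); last by lia.
  rewrite IH big_ord_recl /=.
  have down : X 0%N * a (q - 1 + 0) = - (c * \sum_(j < r.+1) v j.+1 * a (q + j%:Z)).
    have /eqP := Hv (q - 1); rewrite big_ord_recl /= addr_eq0 => /eqP E.
    rewrite -[X 0%N](divfK v0) -/c -mulrA E mulrN; congr (- (_ * _)).
    by apply: eq_bigr => i _; congr (_ * a _); rewrite /= /bump leq0n; lia.
  rewrite down addrC.
  under [RHS]eq_bigr do rewrite mulrBl -mulrA.
  rewrite sumrB -mulr_sumr [X in _ = X - _]big_ord_recr /= ltnn mul0r addr0; congr (_ - _).
  apply: eq_bigr => i _; rewrite ltn_ord.
  by congr (_ * a _); rewrite /= /bump leq0n; lia.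
Qed.

(** Either the determinants of size N - 1 vanish too, and expansion along a row
    applies, or the recurrence makes the matrix factor through F^(N-1). *)
Lemma minors_of_hankel (N : nat) : (forall m, hankel_det N m = 0) ->
  forall P Q : 'I_N -> int, \det (\matrix_(i < N, j < N) a (P i + Q j)) = 0.
Proof.
elim: N => [|N IH] H0 P Q.
  by have /eqP := H0 0; rewrite /hankel_det det_mx00 oner_eq0.
have [HN|/existsNP[m /eqP Hm]] := pselect (forall m, hankel_det N m = 0).
  rewrite (expand_det_row _ ord0) big1 // => j _.
  suff -> : cofactor (\matrix_(i, j) a (P i + Q j)) ord0 j = 0 by rewrite mulr0.
  rewrite /cofactor (_ : \det _ = 0) ?mulr0 //.
  rewrite -[RHS](IH HN (fun i => P (lift ord0 i)) (fun k => Q (lift j k))).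
  by congr (\det _); apply/matrixP => i k; rewrite !mxE.
have [v [v0 vr Hv]] := recurrence_of_hankel H0 (hankel_det_nonsingular Hm).
have rank := finite_rank_of_recurrence v0 vr Hv.
have [X HX] := choice rank.
have -> : (\matrix_(i < N.+1, j < N.+1) a (P i + Q j)) =
  (\matrix_(i < N.+1, k < N) X (P i) k) *m (\matrix_(k < N, j < N.+1) a (Q j + k%:Z)).
  by apply/matrixP => i j; rewrite !mxE HX; apply: eq_bigr => k _; rewrite !mxE.
apply/eqP; rewrite -[_ == 0]negbK -unitfE -unitmxE -row_full_unit.
apply/negP => /eqP E.
by have := mulmx_max_rank (\matrix_(i < N.+1, k < N) X (P i) k)
  (\matrix_(k < N, j < N.+1) a (Q j + k%:Z)); rewrite E ltnn.
Qed.

End TwoSided.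

(** * One-sided recurrent sequences *)

Section Recurrences.
Variable F : fieldType.
Implicit Types (p q : {poly F}) (u : nat -> F).

(** The action of F[X] on sequences in which X is the shift. *)
Definition shift_act p u (k : nat) : F := \sum_(j < size p) p`_j * u (k + j)%N.

Lemma shift_actE n p u k : (size p <= n)%N ->
  shift_act p u k = \sum_(j < n) p`_j * u (k + j)%N.
Proof.
move=> pn; rewrite /shift_act -!(big_mkord xpredT (fun j => p`_j * u (k + j)%N)).
rewrite (big_cat_nat _ pn) //= [X in _ + X]big1_seq ?addr0 // => j.
by rewrite mem_index_iota => /andP[_ /andP[pj _]]; rewrite nth_default ?mul0r.
Qed.

Lemma shift_actD p q u k : shift_act (p + q) u k = shift_act p u k + shift_act q u k.
Proof.
pose n := maxn (size p) (size q).
rewrite !(@shift_actE n) ?leq_maxl ?leq_maxr ?size_polyD // -big_split /=.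
by apply: eq_bigr => j _; rewrite coefD mulrDl.
Qed.

Lemma shift_actZ c p u k : shift_act (c *: p) u k = c * shift_act p u k.
Proof.
rewrite !(@shift_actE (size p)) ?size_scale_leq // mulr_sumr.
by apply: eq_bigr => j _; rewrite coefZ mulrA.
Qed.

Lemma shift_act_mulX p u k : shift_act (p * 'X) u k = shift_act p u k.+1.
Proof.
rewrite (@shift_actE (size p).+1) ?(leq_trans (size_polyMleq _ _)) //; last first.
  by rewrite size_polyX addn2.
rewrite big_ord_recl coefMX mul0r add0r /shift_act; apply: eq_bigr => j _.
by rewrite coefMX /= /bump leq0n add1n addSnnS.
Qed.

Lemma shift_actC c u k : shift_act c%:P u k = c * u k.
Proof. by rewrite (@shift_actE 1) ?size_polyC_leq1 // big_ord1 coefC addn0. Qed.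

Lemma shift_act_mul p q u k : shift_act (p * q) u k = shift_act p (shift_act q u) k.
Proof.
elim/poly_ind: p k => [|p c IH] k.
  by rewrite mul0r -[0 in LHS]polyC0 -[0 in RHS]polyC0 !shift_actC !mul0r.
rewrite mulrDl !shift_actD mul_polyC shift_actZ shift_actC; congr (_ + _).
by rewrite mulrAC !shift_act_mulX IH.
Qed.

Lemma eq_shift_act p u v k : u =1 v -> shift_act p u k = shift_act p v k.
Proof. by move=> E; apply: eq_bigr => j _; rewrite E. Qed.

Lemma shift_act_eq0 p u k : (forall k, u k = 0) -> shift_act p u k = 0.
Proof. by move=> E; apply: big1 => j _; rewrite E mulr0. Qed.

Lemma shift_act_sum I (s : seq I) (P : pred I) p (c : I -> F) (U : I -> nat -> F) k :
  shift_act p (fun k => \sum_(i <- s | P i) c i * U i k) k =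
  \sum_(i <- s | P i) c i * shift_act p (U i) k.
Proof.
rewrite /shift_act; under eq_bigr do rewrite mulr_sumr.
rewrite exchange_big; apply: eq_bigr => i _; rewrite mulr_sumr.
by apply: eq_bigr => j _; rewrite mulrCA.
Qed.

Definition annihilates p u := forall k, shift_act p u k = 0.

Lemma annihilates_mull p q u : annihilates q u -> annihilates (p * q) u.
Proof. by move=> H k; rewrite shift_act_mul shift_act_eq0. Qed.

Lemma annihilated_eq0 p u : p != 0 -> annihilates p u ->
  (forall k, (k.+1 < size p)%N -> u k = 0) -> forall k, u k = 0.
Proof.
move=> p0 H u0 k; have [m] := ubnP k; elim: m k => // m IH k.
rewrite ltnS => km; have [kp|pk] := ltnP k.+1 (size p); first exact: u0.
have sp : (0 < size p)%N by rewrite size_poly_gt0.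
have pk' : ((size p).-1 <= k)%N by rewrite -ltnS prednK.
have := H (k - (size p).-1)%N; rewrite (@shift_actE (size p).-1.+1) ?leqSpred //.
rewrite big_ord_recr /= -lead_coefE big1 => [|j _]; last first.
  rewrite IH ?mulr0 //; apply: leq_trans km.
  by rewrite -[X in (_ < X)%N](subnK pk') ltn_add2l ltn_ord.
rewrite add0r subnK //.
by move/eqP; rewrite mulf_eq0 lead_coef_eq0 (negPf p0) => /eqP.
Qed.

Definition hankel_mx r u : 'M[F]_r := \matrix_(i < r, j < r) u (i + j)%N.

Lemma size_rVpoly_le r (v : 'rV[F]_r) : (size (rVpoly v) <= r)%N.
Proof. exact: size_poly. Qed.

(** A kernel vector of the Hankel matrix is a polynomial q with q u starting with
    r zeros; since p annihilates q u as well, q u vanishes. *)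
Lemma hankel0_annihilator r p u : size p = r.+1 -> annihilates p u ->
  \det (hankel_mx r u) = 0 ->
  exists q, [/\ q != 0, (size q <= r)%N & annihilates q u].
Proof.
move=> sp Hp /eqP/det0P[v v0 Hv]; exists (rVpoly v); split.
- by apply: contraNneq v0 => E; rewrite -(rVpolyK v) E linear0.
- exact: size_rVpoly_le.
have p0 : p != 0 by rewrite -size_poly_gt0 sp.
apply: (annihilated_eq0 p0) => [k|k].
  by rewrite -shift_act_mul mulrC; apply: annihilates_mull.
rewrite sp ltnS => kr; rewrite (@shift_actE r) ?size_rVpoly_le //.
have /rowP/(_ (Ordinal kr)) := Hv; rewrite !mxE => E.
rewrite -[RHS]E; apply: eq_bigr => j _.
by rewrite !mxE coef_rVpoly_ord addnC.
Qed.

Lemma annihilator_hankel0 r q u : q != 0 -> (size q <= r)%N ->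
  annihilates q u -> \det (hankel_mx r u) = 0.
Proof.
move=> q0 sq Hq; apply/eqP/det0P; exists (poly_rV q).
  by apply: contraNneq q0 => E; rewrite -(poly_rV_K sq) E linear0.
apply/rowP => i; rewrite !mxE -[RHS](Hq i) (shift_actE _ _ sq).
by apply: eq_bigr => j _; rewrite !mxE addnC.
Qed.

(** A sequence killed by q is determined by its first size q - 1 < r terms. *)
Lemma annihilated_dependent r q (U : 'I_r -> nat -> F) :
  q != 0 -> (size q <= r)%N -> (forall i, annihilates q (U i)) ->
  exists2 a : 'rV[F]_r, a != 0 & forall k, \sum_(i < r) a 0 i * U i k = 0.
Proof.
move=> q0 sq HU; have sq0 : (0 < size q)%N by rewrite size_poly_gt0.
pose A := \matrix_(i < r, k < (size q).-1) U i k.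
have /rowV0Pn[a /sub_kermxP aA a0] : kermx A != 0.
  rewrite kermx_eq0 /row_free neq_ltn (leq_ltn_trans (rank_leq_col A)) //.
  by rewrite -ltnS prednK // ltnS.
exists a => //; apply: (@annihilated_eq0 q) => // [k|k kq].
  by rewrite shift_act_sum big1 // => i _; rewrite HU mulr0.
have kq' : (k < (size q).-1)%N by lia.
have /rowP/(_ (Ordinal kq')) := aA; rewrite !mxE => E; rewrite -[RHS]E.
by apply: eq_bigr => i _; rewrite !mxE.
Qed.

(** Solutions of the recurrence are determined by their first r terms, so r
    independent solutions form a basis. *)
Lemma annihilated_span r p (U : 'I_r -> nat -> F) u : size p = r.+1 ->
  (forall i, annihilates p (U i)) ->
  (forall a : 'rV[F]_r, (forall k, \sum_(i < r) a 0 i * U i k = 0) -> a = 0) ->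
  annihilates p u ->
  exists a : 'rV[F]_r, forall k, u k = \sum_(i < r) a 0 i * U i k.
Proof.
move=> sp HU indep Hu; have p0 : p != 0 by rewrite -size_poly_gt0 sp.
pose A := \matrix_(i < r, k < r) U i k.
have UA : A \in unitmx.
  rewrite -row_free_unit -kermx_eq0; apply/eqP/row_matrixP => i; rewrite row0.
  apply: indep; apply: (annihilated_eq0 p0) => [k|k].
    by rewrite shift_act_sum big1 // => j _; rewrite HU mulr0.
  rewrite sp ltnS => kr.
  have /rowP/(_ (Ordinal kr)) : row i (kermx A) *m A = 0.
    by apply/sub_kermxP; exact: row_sub.
  by rewrite !mxE => E; rewrite -[RHS]E; apply: eq_bigr => j _; rewrite !mxE.
pose b := (\row_(k < r) u k) *m invmx A; exists b => k.
apply/eqP; rewrite -subr_eq0; apply/eqP; move: k.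
apply: (annihilated_eq0 p0) => [k|k].
  have -> : shift_act p (fun k => u k - \sum_(i < r) b 0 i * U i k) k =
     shift_act p u k - shift_act p (fun k => \sum_(i < r) b 0 i * U i k) k.
    by rewrite /shift_act -sumrB; apply: eq_bigr => j _; rewrite mulrBr.
  by rewrite Hu shift_act_sum big1 ?subr0 // => i _; rewrite HU mulr0.
rewrite sp ltnS => kr.
have /rowP/(_ (Ordinal kr)) : b *m A = \row_(k < r) u k by rewrite mulmxKV.
rewrite !mxE => E; rewrite -[X in X - _]E; apply/eqP; rewrite subr_eq0; apply/eqP.
by apply: eq_bigr => j _; congr (_ * _); rewrite mxE.
Qed.

(** The coefficients of t^i / i! exp(lam t) as an exponential generating
    function. *)
Definition jordan_seq (lam : F) (i k : nat) : F := 'C(k, i)%:R * lam ^+ (k - i).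

Lemma jordan_seqS lam i k : jordan_seq lam i.+1 k.+1 =
  lam * jordan_seq lam i.+1 k + jordan_seq lam i k.
Proof.
rewrite /jordan_seq binS natrD mulrDl subSS; congr (_ + _).
have [ik|ki] := ltnP i k; last by rewrite bin_small ?ltnS // !mul0r mulr0.
by rewrite mulrCA -exprS subnSK.
Qed.

Lemma jordan_seq0 lam k : jordan_seq lam 0 k = lam ^+ k.
Proof. by rewrite /jordan_seq bin0 mul1r subn0. Qed.

(** Triples (c, lam, i) stand for the terms c * jordan_seq lam i. *)
Definition jordan_comb (s : seq (F * F * nat)) k : F :=
  \sum_(x <- s) x.1.1 * jordan_seq x.1.2 x.2 k.

Lemma jordan_comb_cat s1 s2 k :
  jordan_comb (s1 ++ s2) k = jordan_comb s1 k + jordan_comb s2 k.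
Proof. exact: big_cat. Qed.

Definition jordan_scale c s : seq (F * F * nat) :=
  [seq ((c * x.1.1, x.1.2), x.2) | x <- s].

Lemma jordan_comb_scale c s k :
  jordan_comb (jordan_scale c s) k = c * jordan_comb s k.
Proof.
rewrite /jordan_comb /jordan_scale big_map mulr_sumr.
by apply: eq_bigr => x _; rewrite /= mulrA.
Qed.

(** In the resonant case lam = mu the order goes up by one, as for a linear
    differential equation. *)
Lemma jordan_solve1 mu lam i : exists s, forall k,
  jordan_comb s k.+1 - mu * jordan_comb s k = jordan_seq lam i k.
Proof.
have [->|ne] := eqVneq lam mu.
  exists [:: (1, mu, i.+1)] => k; rewrite /jordan_comb !big_seq1 /= !mul1r.
  by rewrite jordan_seqS addrC addKr.
have d0 : lam - mu != 0 by rewrite subr_eq0.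
elim: i => [|i [s IH]].
  exists [:: ((lam - mu)^-1, lam, 0%N)] => k.
  rewrite /jordan_comb !big_seq1 /= !jordan_seq0 exprS.
  by field.
exists ([:: ((lam - mu)^-1, lam, i.+1)] ++ jordan_scale (- (lam - mu)^-1) s) => k.
rewrite !jordan_comb_cat !jordan_comb_scale {1 3}/jordan_comb !big_seq1 /=.
rewrite jordan_seqS -IH.
by field.
Qed.

Lemma jordan_solve mu s : exists s', forall k,
  jordan_comb s' k.+1 - mu * jordan_comb s' k = jordan_comb s k.
Proof.
elim: s => [|[[c lam] i] s [s' IH]].
  by exists [::] => k; rewrite /jordan_comb !big_nil mulr0 subr0.
have [t Ht] := jordan_solve1 mu lam i.
exists (jordan_scale c t ++ s') => k.
rewrite !jordan_comb_cat !jordan_comb_scale [in RHS]/jordan_comb big_cons /= -Ht.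
rewrite -/(jordan_comb s k) -IH.
by ring.
Qed.

(** One root mu is peeled off at a time: the remaining factors kill the sequence
    u k.+1 - mu * u k, a particular solution exists by jordan_solve, and the
    kernel of the shift minus mu is geometric. *)
Lemma annihilated_jordan (rs : seq F) u :
  annihilates (\prod_(z <- rs) ('X - z%:P)) u ->
  exists s, forall k, u k = jordan_comb s k.
Proof.
elim: rs u => [|mu rs IH] u.
  rewrite big_nil => H; exists [::] => k.
  by have := H k; rewrite -polyC1 shift_actC mul1r /jordan_comb big_nil.
rewrite big_cons mulrC => H.
have E k : shift_act ('X - mu%:P) u k = u k.+1 - mu * u k.
  by rewrite -polyCN shift_actD -['X]mul1r shift_act_mulX -polyC1 !shift_actC mul1r mulNr.
have [s Hs] := IH (shift_act ('X - mu%:P) u) (fun k => etrans (esym (shift_act_mul _ _ _ _)) (H k)).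
have [s' Hs'] := jordan_solve mu s.
exists ([:: (u 0%N - jordan_comb s' 0, mu, 0%N)] ++ s') => k.
rewrite jordan_comb_cat [X in X + _]/jordan_comb big_seq1 /= jordan_seq0.
elim: k => [|k IHk]; first by rewrite expr0 mulr1 subrK.
have -> : u k.+1 = mu * u k + jordan_comb s k by rewrite -Hs E; ring.
by rewrite IHk -Hs' exprS; ring.
Qed.

End Recurrences.

(** * The modulus and the l1 norm of complex polynomials *)

Notation cn := Normc.normc.

Section Cnorm.
Variable R : realType.
Implicit Types x y z : R[i].

Lemma cn0 : cn 0 = 0 :> R. Proof. exact: Normc.normc0. Qed.
Lemma cn1 : cn 1 = 1 :> R. Proof. exact: Normc.normc1. Qed.
Lemma cnM x y : cn (x * y) = cn x * cn y. Proof. exact: Normc.normcM. Qed.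
Lemma cnD x y : cn (x + y) <= cn x + cn y. Proof. exact: le_normcD. Qed.
Lemma cnN x : cn (- x) = cn x. Proof. exact: normcN. Qed.
Lemma cnB x y : cn (x - y) <= cn x + cn y.
Proof. by rewrite -(cnN y); exact: cnD. Qed.
Lemma cnBC x y : cn (x - y) = cn (y - x). Proof. by rewrite -opprB cnN. Qed.
Lemma cn_ge0 x : 0 <= cn x. Proof. by case: x => a b; exact: sqrtr_ge0. Qed.
Lemma cn_eq0 x : (cn x == 0) = (x == 0).
Proof.
by apply/eqP/eqP => [/Normc.eq0_normc//|->]; exact: cn0.
Qed.
Lemma cnV x : cn x^-1 = (cn x)^-1. Proof. exact: Normc.normcV. Qed.
Lemma cnX x n : cn (x ^+ n) = cn x ^+ n.
Proof. by elim: n => [|n IH]; rewrite ?expr0 ?cn1// !exprS cnM IH. Qed.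
Lemma cn_real (a : R) : cn a%:C = `|a|.
Proof. by rewrite /= expr0n /= addr0 sqrtr_sqr. Qed.
Lemma cn_nat n : cn (n%:R : R[i]) = n%:R.
Proof. by rewrite -(rmorph_nat (real_complex R)) cn_real ger0_norm. Qed.
Lemma cn_Re x : `|complex.Re x| <= cn x.
Proof.
by case: x => a b /=; rewrite -sqrtr_sqr ler_wsqrtr // lerDl sqr_ge0.
Qed.
Lemma cn_Im x : `|complex.Im x| <= cn x.
Proof.
by case: x => a b /=; rewrite -sqrtr_sqr ler_wsqrtr // lerDr sqr_ge0.
Qed.
Lemma cn_le_ReIm x : cn x <= `|complex.Re x| + `|complex.Im x|.
Proof.
have -> : x = (complex.Re x)%:C + 'i * (complex.Im x)%:C.
  by case: x => a b; apply/eqP; rewrite eq_complex /=; apply/andP; split; apply/eqP; ring.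
apply: le_trans (cnD _ _) _; rewrite cnM !cn_real /= expr0n expr1n /= add0r sqrtr1 mul1r.
by rewrite !(mul0r, mulr0, mul1r, addr0, add0r, subr0, sub0r, oppr0).
Qed.
Lemma cn_sum I (s : seq I) (P : pred I) (f : I -> R[i]) :
  cn (\sum_(i <- s | P i) f i) <= \sum_(i <- s | P i) cn (f i).
Proof.
elim/big_rec2: _ => [|i a b _ h]; first by rewrite cn0.
by apply: le_trans (cnD _ _) _; rewrite lerD2l.
Qed.
Lemma cn_prod I (s : seq I) (P : pred I) (f : I -> R[i]) :
  cn (\prod_(i <- s | P i) f i) = \prod_(i <- s | P i) cn (f i).
Proof. by elim/big_rec2: _ => [|i a b _ <-]; rewrite ?cn1 ?cnM. Qed.

Lemma cn_small_eq0 x (K : R) : (forall e : R, 0 < e -> cn x <= K * e) -> x = 0.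
Proof.
move=> H; apply/eqP; rewrite -cn_eq0; apply/negPn/negP => x0.
have xp : 0 < cn x by rewrite lt_neqAle eq_sym x0 cn_ge0.
have K0 : 0 < K by have := H 1 ltr01; rewrite mulr1; exact: lt_le_trans.
have := H (cn x / (K *+ 2)); rewrite divr_gt0 // ?mulrn_wgt0 // => /(_ isT).
rewrite leNgt => /negP; apply.
have -> : K * (cn x / (K *+ 2)) = cn x / 2 by field; rewrite gt_eqF.
lra.
Qed.

End Cnorm.

#[local] Arguments Normc.normc : simpl never.

Section PolyNorm.
Variable R : realType.
Implicit Types (p q N D Z : {poly R[i]}).

(** The l1 norm is submultiplicative, which makes it easy to bound products of
    linear factors. *)
Definition pnorm p : R := \sum_(i < size p) cn p`_i.

Lemma pnormE n p : (size p <= n)%N -> pnorm p = \sum_(i < n) cn p`_i.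
Proof.
move=> pn; rewrite /pnorm -!(big_mkord xpredT (fun j => cn p`_j)).
rewrite [RHS](big_cat_nat _ pn) //= [X in _ + X]big1_seq ?addr0 // => j.
by rewrite mem_index_iota => /andP[_ /andP[pj _]]; rewrite nth_default ?cn0.
Qed.

Lemma pnorm_ge0 p : 0 <= pnorm p.
Proof. by apply: sumr_ge0 => i _; exact: cn_ge0. Qed.

Lemma pnormD p q : pnorm (p + q) <= pnorm p + pnorm q.
Proof.
pose n := maxn (size p) (size q).
rewrite !(@pnormE n) ?leq_maxl ?leq_maxr ?size_polyD // -big_split /=.
by apply: ler_sum => j _; rewrite coefD cnD.
Qed.

Lemma pnormC c : pnorm c%:P = cn c.
Proof. by rewrite (@pnormE 1) ?size_polyC_leq1 // big_ord1 coefC. Qed.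

Lemma pnormZ c p : pnorm (c *: p) = cn c * pnorm p.
Proof.
rewrite !(@pnormE (size p)) ?size_scale_leq // mulr_sumr.
by apply: eq_bigr => j _; rewrite coefZ cnM.
Qed.

Lemma pnormMX p : pnorm (p * 'X) = pnorm p.
Proof.
rewrite (@pnormE (size p).+1) ?(leq_trans (size_polyMleq _ _)) //; last first.
  by rewrite size_polyX addn2.
rewrite big_ord_recl coefMX cn0 add0r /pnorm; apply: eq_bigr => j _.
by rewrite coefMX.
Qed.

Lemma pnormM p q : pnorm (p * q) <= pnorm p * pnorm q.
Proof.
elim/poly_ind: p => [|p c IH].
  by rewrite mul0r -[0]polyC0 pnormC cn0 mul0r.
have -> : pnorm (p * 'X + c%:P) = pnorm p + cn c.
  have [->|p0] := eqVneq p 0.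
    by rewrite mul0r add0r pnormC -[0]polyC0 pnormC cn0 add0r.
  rewrite {1}/pnorm size_MXaddC (negPf p0) /= big_ord_recl.
  rewrite coefD coefMX coefC add0r addrC; congr (_ + _); apply: eq_bigr => j _.
  by rewrite coefD coefMX coefC /= addr0.
rewrite mulrDl mul_polyC mulrAC mulrDl; apply: le_trans (pnormD _ _) _.
by rewrite pnormMX pnormZ lerD2r.
Qed.

Lemma pnorm_prod I (s : seq I) (P : pred I) (f : I -> {poly R[i]}) :
  pnorm (\prod_(i <- s | P i) f i) <= \prod_(i <- s | P i) pnorm (f i).
Proof.
elim/big_rec2: _ => [|i a b _ h]; first by rewrite -polyC1 pnormC cn1.
by apply: le_trans (pnormM _ _) _; rewrite ler_wpM2l ?pnorm_ge0.
Qed.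

Lemma pnorm_sum I (s : seq I) (P : pred I) (f : I -> {poly R[i]}) :
  pnorm (\sum_(i <- s | P i) f i) <= \sum_(i <- s | P i) pnorm (f i).
Proof.
elim/big_rec2: _ => [|i a b _ h]; first by rewrite -polyC0 pnormC cn0.
by apply: le_trans (pnormD _ _) _; rewrite lerD2l.
Qed.

Lemma pnormXsubC z : pnorm ('X - z%:P) = 1 + cn z.
Proof.
rewrite /pnorm size_XsubC big_ord_recl big_ord1 !coefB !coefX !coefC /=.
by rewrite sub0r cnN subr0 cn1 addrC.
Qed.

Lemma coef_le_pnorm p i : cn p`_i <= pnorm p.
Proof.
rewrite (@pnormE (maxn i.+1 (size p))) ?leq_maxr //.
have Hi : (i < maxn i.+1 (size p))%N by rewrite leq_max ltnSn.
rewrite (bigD1 (Ordinal Hi)) //= lerDl.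
by apply: sumr_ge0 => j _; exact: cn_ge0.
Qed.

Lemma horner_le_pnorm p z : cn z <= 1 -> cn p.[z] <= pnorm p.
Proof.
move=> z1; rewrite horner_coef; apply: le_trans (cn_sum _ _ _) _.
apply: ler_sum => i _; rewrite cnM cnX ler_piMr ?cn_ge0 //.
by rewrite exprn_ile1 ?cn_ge0.
Qed.

(** Apart from the constant term, p - p.[0] has the coefficients of p and is
    divisible by the variable. *)
Lemma horner_lip0 p z : cn z <= 1 -> cn (p.[z] - p.[0]) <= cn z * pnorm p.
Proof.
elim/poly_ind: p => [|p c _] z1; first by rewrite !horner0 subr0 cn0 mulr_ge0 ?cn_ge0 ?pnorm_ge0.
rewrite !hornerMXaddC mulr0 add0r addrK cnM mulrC ler_wpM2l ?cn_ge0 //.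
apply: le_trans (horner_le_pnorm _ z1) _.
have [->|p0] := eqVneq p 0.
  by rewrite mul0r add0r -[0]polyC0 !pnormC cn0 cn_ge0.
rewrite {2}/pnorm size_MXaddC (negPf p0) /= big_ord_recl.
rewrite ler_wpDl ?cn_ge0 // le_eqVlt; apply/orP; left; apply/eqP.
by apply: eq_bigr => j _; rewrite coefD coefMX coefC /= addr0.
Qed.

Lemma horner_lip p a : exists2 L : R, 0 <= L &
  forall z, cn (z - a) <= 1 -> cn (p.[z] - p.[a]) <= L * cn (z - a).
Proof.
exists (pnorm (p \Po ('X + a%:P))); first exact: pnorm_ge0.
move=> z z1; have := horner_lip0 (p \Po ('X + a%:P)) z1.
by rewrite !horner_comp !hornerD !hornerX !hornerC subrK add0r mulrC.
Qed.

Lemma horner_neq0_near Z (a : R[i]) (e : R) : Z != 0 -> 0 < e ->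
  exists d : R, [/\ 0 < d, d <= e & Z.[a + d%:C] != 0].
Proof.
move=> Z0 e0; pose x k := a + (e / k.+1%:R)%:C.
have [/allP H|] := boolP (all (root Z) (map x (iota 0 (size Z)))).
  suff /roots_geq_poly_eq0 : uniq (map x (iota 0 (size Z))).
    move=> /(_ Z (introT allP H)); rewrite size_map size_iota leqnn => /(_ isT).
    by move=> E; rewrite E eqxx in Z0.
  rewrite map_inj_uniq ?iota_uniq // => i j /addrI /complexI.
  move/(mulfI (lt0r_neq0 e0))/invr_inj/eqP; rewrite eqr_nat eqSS.
  by move/eqP.
rewrite -has_predC => /hasP[_ /mapP[k _ ->] /= Hk].
exists (e / k.+1%:R); split=> //; first by rewrite divr_gt0 // ltr0n.
by rewrite ler_pdivrMr ?ltr0n // ler_peMr ?ler1n // ltW.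
Qed.

Lemma poly_eq0_on_itv p (e : R) : 0 < e ->
  (forall d : R, 0 < d -> d <= e -> p.[d%:C] = 0) -> p = 0.
Proof.
move=> e0 H; apply/eqP/negPn/negP => p0.
have [d [d0 de]] := horner_neq0_near 0 p0 e0.
by rewrite add0r H ?eqxx.
Qed.

Lemma horner_le_closure Q Z (K r : R) : Z != 0 ->
  (forall z, Z.[z] != 0 -> cn z <= r + 1 -> cn Q.[z] <= K) ->
  forall z, cn z <= r -> cn Q.[z] <= K.
Proof.
move=> Z0 H a ar; have [L L0 HL] := horner_lip Q a.
apply/ler_addgt0Pr => e e0.
have e'0 : 0 < Num.min 1 (e / (L + 1)).
  by rewrite lt_min ltr01 divr_gt0 // ltr_wpDl.
have [d [d0 de Zd]] := horner_neq0_near a Z0 e'0.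
move: de; rewrite le_min => /andP[d1 de].
have dE : cn (a + d%:C - a) = d by rewrite addrAC subrr add0r cn_real gtr0_norm.
have -> : Q.[a] = Q.[a + d%:C] - (Q.[a + d%:C] - Q.[a]) by ring.
apply: le_trans (cnB _ _) _; apply: lerD.
  by apply: H => //; apply: le_trans (cnD _ _) _; rewrite lerD // cn_real gtr0_norm.
apply: le_trans (HL _ _) _; first by rewrite dE.
rewrite dE; apply: (@le_trans _ _ ((L + 1) * d)).
  by rewrite ler_pM2r // lerDl.
by rewrite mulrC -ler_pdivlMr // ltr_wpDl.
Qed.

(** A quotient bounded off a finite set has no poles.  By continuity a root of D
    is a root of N; cancelling it puts one more point into the exceptional set,
    which is recorded as the zero set of Z. *)
Lemma poly_dvd_of_bound D N Z (K : R[i] -> R) : D != 0 -> Z != 0 ->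
  (forall a, exists B, forall z, cn (z - a) <= 1 -> K z <= B) ->
  (forall z, Z.[z] != 0 -> cn N.[z] <= K z * cn D.[z]) ->
  exists Q Z', [/\ N = Q * D, Z' != 0 &
    forall z, Z'.[z] != 0 -> cn Q.[z] <= K z].
Proof.
move=> D0 + HK; have [n] := ubnP (size D).
elim: n D N Z D0 => // n IH D N Z D0 sD Z0 H.
have [/size_poly1P[c c0 Dc]|sD1] := boolP (size D == 1%N).
  exists (c^-1 *: N), Z; split=> //.
    by rewrite Dc mulrC mul_polyC scalerA divff // scale1r.
  move=> z /H; rewrite Dc hornerC hornerZ cnM cnV => h.
  by rewrite mulrC ler_pdivrMr // lt_neqAle eq_sym cn_eq0 c0 cn_ge0.
have /closed_rootP[a Da] := sD1.
have Na : N.[a] = 0.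
  have [B HB] := HK a.
  have [L L0 HL] := horner_lip D a; have [L' L'0 HL'] := horner_lip N a.
  apply: (@cn_small_eq0 _ _ (L' + `|B| * L)) => e e0.
  have e'0 : 0 < Num.min 1 e by rewrite lt_min ltr01.
  have [d [d0 de Zd]] := horner_neq0_near a Z0 e'0.
  move: de; rewrite le_min => /andP[d1 de].
  have dE : cn (a + d%:C - a) = d by rewrite addrAC subrr add0r cn_real gtr0_norm.
  have -> : N.[a] = N.[a + d%:C] - (N.[a + d%:C] - N.[a]) by ring.
  apply: le_trans (cnB _ _) _; rewrite mulrDl addrC; apply: lerD.
    apply: le_trans (HL' _ _) _; first by rewrite dE.
    by rewrite dE ler_wpM2l.
  apply: le_trans (H _ Zd) _.
  have := HL (a + d%:C); rewrite dE (eqP Da) subr0 => /(_ d1) HD.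
  apply: (@le_trans _ _ (`|B| * cn D.[a + d%:C])).
    rewrite ler_wpM2r ?cn_ge0 //; apply: le_trans (ler_norm _).
    by apply: HB; rewrite dE.
  rewrite -mulrA ler_wpM2l ?normr_ge0 //; apply: le_trans HD _.
  by rewrite ler_wpM2l.
have /factor_theorem[D1 ED] := Da.
have /factor_theorem[N1 EN] : root N a by apply/eqP.
have D10 : D1 != 0 by apply: contraNneq D0 => E; rewrite ED E mul0r.
have X0 : 'X - a%:P != 0 :> {poly R[i]} by rewrite polyXsubC_eq0.
have [|||Q [Z' [E1 E2 E3]]] := IH D1 N1 (Z * ('X - a%:P)) D10.
- by move: sD; rewrite ED size_Mmonic ?monicXsubC // size_XsubC addn2.
- by rewrite mulf_neq0.
- move=> z; rewrite hornerM mulf_eq0 negb_or => /andP[/H + za].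
  rewrite ED EN !hornerM !cnM mulrA ler_pM2r //.
  by rewrite lt_neqAle eq_sym cn_eq0 za cn_ge0.
by exists Q, Z'; split=> //; rewrite EN E1 ED mulrA.
Qed.

End PolyNorm.

(** * Equispaced interpolation, and growth of recurrent sequences *)

Section NodesAndRoots.
Variable R : realType.
Implicit Types (p q : {poly R[i]}).

(** The denominator is k + 1 rather than k so that the case k = 0 makes sense. *)
Definition node (k j : nat) : R := j%:R / k.+1%:R.

Lemma prod_dist k (j : nat) : (j <= k)%N ->
  \prod_(i < k.+1 | (i : nat) != j) `|j%:R - i%:R : R| = (j`! * (k - j)`!)%:R.
Proof.
move=> jk; rewrite -(big_mkord (fun i => i != j) (fun i => `|j%:R - i%:R : R|)).
rewrite (big_cat_nat (leq0n j) (leqW jk)) /= natrM; congr (_ * _).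
  rewrite big_mkcond /= big_nat_rev /= add0n -[RHS]mulr1.
  rewrite (eq_big_nat _ _ (F2 := fun i => i.+1%:R)); last first.
    move=> i /= ij; rewrite ifT; last by lia.
    rewrite -natrB; last by lia.
    by rewrite ger0_norm // subKn.
  by rewrite mulr1 fact_prod natr_prod big_add1.
rewrite big_ltn_cond ?ltnS // eqxx /= big_mkcond /=.
rewrite -{1}[j.+1]add0n big_addn subSS fact_prod natr_prod big_add1 /=.
apply: eq_big_nat => i /= ij; rewrite ifT; last by lia.
by rewrite distrC -natrB ?ger0_norm //; [congr _%:R|]; lia.
Qed.

(** Both sides are compared with (2k)! / k! = C(2k, k) k!. *)
Lemma leq_exp_fact k : (k.+1 ^ k <= 4 ^ k * k`!)%N.
Proof.
(* each of the k factors (k + k) - i is at least k + 1 *)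
apply: (@leq_trans ((k + k) ^_ k)).
  rewrite ffact_prod -[X in (_ ^ X <= _)%N]card_ord -prod_nat_const.
  by apply: leq_prod => i _; have := ltn_ord i; lia.
rewrite -bin_ffact leq_mul2r; apply/orP; right.
apply: (@leq_trans (2 ^ (k + k))); last by rewrite addnn -mul2n expnM.
rewrite -[2%N]/(1 + 1)%N Pascal; have H : (k < (k + k).+1)%N by lia.
rewrite (bigD1 (Ordinal H)) //= addnK !exp1n !muln1; exact: leq_addr.
Qed.

(** The numerators of the Lagrange polynomials are products of k factors of norm
    at most 2, and the denominators are j! (k - j)! / (k + 1)^k.  With
    (k + 1)^k <= 4^k k! the j-th norm is at most 8^k C(k, j), and the binomial
    coefficients sum up to 2^k. *)
Lemma lagrange_equispaced k : exists ell : 'I_k.+1 -> {poly R[i]},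
  [/\ forall q, (size q <= k.+1)%N ->
        q = \sum_(j < k.+1) q.[(node k j)%:C] *: ell j,
      forall j, (size (ell j) <= k.+1)%N &
      \sum_(j < k.+1) pnorm (ell j) <= 16 ^+ k].
Proof.
pose x (j : nat) : R[i] := (node k j)%:C.
have x_inj : injective x.
  move=> i j /complexI /eqP; rewrite /node (inj_eq (mulIf _)); last by rewrite invr_eq0 pnatr_eq0.
  by rewrite eqr_nat => /eqP.
exists (fun j => tnth (lagrange k.+1 x) j); split=> [q sq|j|].
- rewrite [LHS](lagrange_gen (ltn0Sn k) x_inj sq).
  by apply: eq_bigr => j _; rewrite mul_polyC.
- by rewrite size_lagrange_.
have -> : (16 : R) ^+ k = \sum_(j < k.+1) 8 ^+ k * 'C(k, j)%:R.
  rewrite -mulr_sumr (_ : 16 = 8 * 2); last by ring.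
  rewrite exprMn; congr (_ * _); rewrite -[2]/(1 + 1 : R) exprDn.
  by apply: eq_bigr => i _; rewrite !expr1n mul1r.
apply: ler_sum => j _; rewrite lagrangeE //= mul_polyC pnormZ cnV.
have jk : (j <= k)%N by rewrite -ltnS.
set p := \prod_(i < _ | _) _.
have -> : cn p.[x j] = (j`! * (k - j)`!)%:R / k.+1%:R ^+ k.
  rewrite horner_prod cn_prod -prod_dist //.
  rewrite (eq_bigr (fun i : 'I_k.+1 => `|j%:R - i%:R| * k.+1%:R^-1)) => [|i _]; last first.
    rewrite hornerXsubC -rmorphB cn_real /node -mulrBl normrM.
    by rewrite [`|_^-1|]ger0_norm // invr_ge0.
  rewrite big_split /=; congr (_ * _).
  rewrite prodr_const -exprVn; congr (_ ^+ _).
  rewrite (eq_card (B := predC1 j)) => [|i]; last by rewrite !inE.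
  by rewrite cardC1 card_ord.
have np : pnorm p <= 2 ^+ k.
  apply: le_trans (pnorm_prod _ _ _) _.
  have -> : (2 : R) ^+ k = \prod_(i < k.+1 | i != j) 2.
    rewrite prodr_const; congr (_ ^+ _).
    rewrite (eq_card (B := predC1 j)) => [|i]; last by rewrite !inE.
    by rewrite cardC1 card_ord.
  apply: ler_prod => i _; rewrite pnorm_ge0 /= pnormXsubC cn_real lerD2l.
  rewrite ger0_norm ?divr_ge0 // /node ler_pdivrMr ?ltr0n // mul1r ler_nat.
  exact: ltnW.
rewrite invf_div.
have f0 : (0 : R) < (j`! * (k - j)`!)%:R by rewrite ltr0n muln_gt0 !fact_gt0.
rewrite mulrAC ler_pdivrMr //.
have -> : 8 ^+ k * 'C(k, j)%:R * (j`! * (k - j)`!)%:R = 4 ^+ k * k`!%:R * 2 ^+ k :> R.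
  rewrite -[_ * _%:R * _]mulrA -natrM bin_fact // mulrAC.
  by rewrite -exprMn; congr (_ ^+ _ * _); ring.
apply: ler_pM; rewrite ?pnorm_ge0 ?exprn_ge0 //.
by rewrite -!natrX -natrM ler_nat leq_exp_fact.
Qed.

Lemma pnorm_le_nodes k q (K : R) : (size q <= k.+1)%N ->
  (forall j : 'I_k.+1, cn q.[(node k j)%:C] <= K) -> pnorm q <= K * 16 ^+ k.
Proof.
move=> sq HK; have [ell [H1 _ H3]] := lagrange_equispaced k.
have K0 : 0 <= K := le_trans (cn_ge0 _) (HK ord0).
rewrite (H1 q sq); apply: le_trans (pnorm_sum _ _ _) _.
apply: le_trans (_ : _ <= \sum_(j < k.+1) K * pnorm (ell j)) _.
  by apply: ler_sum => j _; rewrite pnormZ ler_wpM2r ?pnorm_ge0.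
by rewrite -mulr_sumr ler_wpM2l.
Qed.

Lemma node_itv k (j : 'I_k.+1) : 0 <= node k j <= 1.
Proof.
rewrite divr_ge0 //= /node ler_pdivrMr ?ltr0n // mul1r ler_nat; exact: ltnW.
Qed.

Lemma bounded_powers (x : R) M : 0 <= x -> (forall n, x ^+ n <= M) -> x <= 1.
Proof.
move=> x0 H; rewrite leNgt; apply/negP => x1.
have B n : 1 + (x - 1) * n%:R <= x ^+ n.
  elim: n => [|n IH]; first by rewrite mulr0 addr0.
  rewrite exprS; apply: le_trans (ler_wpM2l x0 IH); rewrite -natr1.
  have : 0 <= (x - 1) * ((x - 1) * n%:R) by rewrite !mulr_ge0 // subr_ge0 ltW.
  nra.
have d0 : 0 < x - 1 by rewrite subr_gt0.
have := archi_boundP (_ : 0 <= `|M| / (x - 1)); rewrite divr_ge0 ?normr_ge0 ?(ltW d0) //.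
move=> /(_ isT); rewrite ltr_pdivrMr // => h.
have := le_trans (B (Num.bound (`|M| / (x - 1)))) (H _).
have := ler_norm M; lra.
Qed.

(** Write p = (X - z) q.  By minimality q u is not zero; it is geometric of ratio
    z and grows at most like rho^k. *)
Lemma root_growth p (u : nat -> R[i]) (C rho : R) : p \is monic -> 0 < rho ->
  (forall q, q != 0 -> (size q < size p)%N -> ~ annihilates q u) ->
  annihilates p u -> (forall k, cn (u k) <= C * rho ^+ k) ->
  forall z, root p z -> cn z <= rho.
Proof.
move=> mp rho0 Hmin Hp Hu z /factor_theorem[q Eq].
have q0 : q != 0 by apply: contraTneq mp => E; rewrite Eq E mul0r monicE lead_coef0 eq_sym oner_eq0.
have sq : (size q < size p)%N.
  by rewrite Eq size_Mmonic ?monicXsubC // size_XsubC addn2.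
have /existsNP[k0 /eqP Hk0] := Hmin q q0 sq.
have W k : shift_act q u k.+1 = z * shift_act q u k.
  have := Hp k; rewrite Eq mulrC shift_act_mul -polyCN shift_actD -['X]mul1r shift_act_mulX.
  by rewrite -polyC1 !shift_actC mul1r mulNr => /eqP; rewrite subr_eq0 => /eqP.
have Wn n : shift_act q u (k0 + n)%N = z ^+ n * shift_act q u k0.
  elim: n => [|n IH]; first by rewrite addn0 mul1r.
  by rewrite addnS W IH exprS mulrA.
pose C' := \sum_(j < size q) cn q`_j * (C * rho ^+ j).
have B k : cn (shift_act q u k) <= C' * rho ^+ k.
  apply: le_trans (cn_sum _ _ _) _; rewrite mulr_suml; apply: ler_sum => j _.
  rewrite cnM -mulrA ler_wpM2l ?cn_ge0 //; apply: le_trans (Hu _) _.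
  by rewrite exprD [rho ^+ k * _]mulrC mulrA.
have w0 : 0 < cn (shift_act q u k0) by rewrite lt_neqAle eq_sym cn_eq0 Hk0 cn_ge0.
rewrite -[rho]mul1r -ler_pdivrMr //.
apply: (@bounded_powers _ (C' * rho ^+ k0 / cn (shift_act q u k0))).
  by rewrite divr_ge0 ?cn_ge0 // ltW.
move=> n; rewrite expr_div_n ler_pdivrMr ?exprn_gt0 // mulrAC ler_pdivlMr //.
by rewrite -cnX -cnM -Wn -mulrA -exprD.
Qed.

Lemma pnorm_le_roots p (rho : R) : p \is monic -> 0 <= rho ->
  (forall z, root p z -> cn z <= rho) -> pnorm p <= (1 + rho) ^+ (size p).-1.
Proof.
move=> mp rho0; have [rs ->] := closed_field_poly_normal p.
rewrite (monicP mp) scale1r => H; rewrite size_prod_XsubC /=.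
have -> : (1 + rho) ^+ size rs = \prod_(z <- rs) (1 + rho).
  by rewrite big_const_seq count_predT iter_mulr_1.
apply: le_trans (pnorm_prod _ _ _) _; rewrite !big_seq.
apply: ler_prod => z zrs; rewrite pnorm_ge0 pnormXsubC lerD2l H //.
by rewrite root_prod_XsubC.
Qed.

End NodesAndRoots.

(** * Exponential generating functions *)

Section Egf.
Variable R : realType.
Implicit Types (a b u : nat -> R[i]) (s t A C : R).

Definition egf_psum a t n : R[i] := \sum_(k < n) a k * (t ^+ k / k`!%:R)%:C.

Definition egfR (a : nat -> R) t : R :=
  limn (series (fun k => a k * (t ^+ k / k`!%:R))).

(** Real and imaginary parts are summed separately, as limits of real series. *)
Definition egf a t : R[i] :=
  egfR (fun k => complex.Re (a k)) t +i* egfR (fun k => complex.Im (a k)) t.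

(** The bound that makes an exponential generating function entire; it is kept
    explicit because uniformity in parameters matters. *)
Definition geo C A a := 0 <= A /\ forall k, cn (a k) <= C * A ^+ k.

Lemma geo_C_ge0 C A a : geo C A a -> 0 <= C.
Proof. by case=> _ /(_ 0%N); rewrite mulr1; apply: le_trans; exact: cn_ge0. Qed.

Lemma exp_psum_le (x : R) n : 0 <= x -> \sum_(k < n) x ^+ k / k`!%:R <= expR x.
Proof.
move=> x0; rewrite -(big_mkord xpredT (fun k => x ^+ k / k`!%:R)).
apply: (@nondecreasing_cvgn_le _ (series (exp_coeff x))); last exact: is_cvg_series_exp_coeff.
by apply: nondecreasing_series => k _ _; exact: exp_coeff_ge0.
Qed.

Lemma exp_block_le (x : R) n m : 0 <= x ->
  \sum_(n <= k < m) x ^+ k / k`!%:R <= x ^+ n / n`!%:R * expR x.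
Proof.
move=> x0; rewrite -{1}[n]add0n big_addn big_mkord.
apply: le_trans (_ : _ <= \sum_(k < m - n) (x ^+ n / n`!%:R) * (x ^+ k / k`!%:R)) _.
  apply: ler_sum => k _; rewrite exprD mulrACA [x ^+ k * _]mulrC.
  rewrite ler_wpM2l ?mulr_ge0 ?exprn_ge0 // -invfM -natrM.
  rewrite lef_pV2 ?posrE ?ltr0n ?muln_gt0 ?fact_gt0 // ler_nat.
  rewrite -(@bin_fact (k + n) n) ?leq_addl // addnK.
  by rewrite leq_pmull // bin_gt0 leq_addl.
by rewrite -mulr_sumr ler_wpM2l ?exp_psum_le // divr_ge0 ?exprn_ge0.
Qed.

Lemma exp_coeff_small (x e : R) : 0 < e ->
  exists N, forall n, (N <= n)%N -> `|x ^+ n / n`!%:R| < e.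
Proof.
move=> e0; have /cvgrPdist_lt/(_ _ e0) : exp_coeff x @ \oo --> 0.
  by apply: cvg_series_cvg_0; exact: is_cvg_series_exp_coeff.
move=> [N _ HN]; exists N => n Nn; have := HN n Nn.
by rewrite /= sub0r normrN.
Qed.

Lemma egfR_tail (a : nat -> R) C A t n : 0 <= A ->
  (forall k, `|a k| <= C * A ^+ k) ->
  `|egfR a t - \sum_(k < n) a k * (t ^+ k / k`!%:R)|
    <= C * ((A * `|t|) ^+ n / n`!%:R * expR (A * `|t|)).
Proof.
move=> A0 Ha.
have C0 : 0 <= C by have := Ha 0%N; rewrite mulr1; apply: le_trans; exact: normr_ge0.
have x0 : 0 <= A * `|t| by rewrite mulr_ge0.
pose f k := a k * (t ^+ k / k`!%:R).
have fle k : `|f k| <= C * ((A * `|t|) ^+ k / k`!%:R).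
  rewrite /f normrM normrM normrX [`|_^-1|]ger0_norm ?invr_ge0 // exprMn !mulrA.
  by rewrite ler_wpM2r ?invr_ge0 // ler_wpM2r ?exprn_ge0.
have cf : cvgn (series f).
  apply: normed_cvg; apply: (@series_le_cvg _ _ (fun k => C * exp_coeff (A * `|t|) k)).
  - by move=> k; exact: normr_ge0.
  - by move=> k; rewrite mulr_ge0 // exp_coeff_ge0.
  - by move=> k; exact: fle.
  - by apply: is_cvg_seriesZ; exact: is_cvg_series_exp_coeff.
have -> : \sum_(k < n) f k = series f n by rewrite /series /= big_mkord.
have cl : (fun m => `|series f m - series f n|) @ \oo --> `|egfR a t - series f n|.
  by apply: cvg_norm; apply: cvgB => //; exact: cvg_cst.
apply: (cvgr_to_le cl).
exists n => // m /= nm; rewrite /series /= (big_cat_nat _ nm) //= addrAC subrr add0r.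
apply: le_trans (ler_norm_sum _ _ _) _.
apply: le_trans (_ : _ <= \sum_(n <= k < m) C * ((A * `|t|) ^+ k / k`!%:R)) _.
  by apply: ler_sum => k _; exact: fle.
by rewrite -mulr_sumr ler_wpM2l // exp_block_le.
Qed.

Lemma egf_psum_split a t n : egf_psum a t n =
  (\sum_(k < n) complex.Re (a k) * (t ^+ k / k`!%:R)) +i*
  (\sum_(k < n) complex.Im (a k) * (t ^+ k / k`!%:R)).
Proof.
rewrite /egf_psum; elim: n => [|n IH]; first by rewrite !big_ord0.
rewrite !big_ord_recr /= IH; case: (a n) => x y /=.
by apply/eqP; rewrite eq_complex /=; apply/andP; split; apply/eqP; ring.
Qed.

(** The leading factor 2 adds the tails of the real and imaginary parts. *)
Definition egf_rest C A t n : R :=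
  2 * C * ((A * `|t|) ^+ n / n`!%:R * expR (A * `|t|)).

Lemma egf_tail a C A t n : geo C A a ->
  cn (egf a t - egf_psum a t n) <= egf_rest C A t n.
Proof.
move=> [A0 Ha]; rewrite egf_psum_split /egf.
set x := egfR _ t; set y := egfR _ t; set x' := bigop _ _ _; set y' := bigop _ _ _.
have -> : (x +i* y) - (x' +i* y') = (x - x') +i* (y - y') by [].
apply: le_trans (cn_le_ReIm _) _; rewrite /egf_rest -mulrA mulr_natl mulr2n /=.
apply: lerD; apply: egfR_tail => // k; apply: le_trans (Ha k).
- exact: cn_Re.
- exact: cn_Im.
Qed.

Lemma egf_rest_small C A t e : 0 < e -> 0 <= C ->
  exists N, forall n, (N <= n)%N -> egf_rest C A t n < e.
Proof.
move=> e0 C0; pose M := 2 * C * expR (A * `|t|) + 1.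
have M0 : 0 < M by rewrite ltr_wpDl // !mulr_ge0 ?expR_ge0.
have [N HN] := exp_coeff_small (A * `|t|) (divr_gt0 e0 M0).
exists N => n /HN h.
have h' : (A * `|t|) ^+ n / n`!%:R <= e / M by apply: le_trans (ltW h); exact: ler_norm.
rewrite /egf_rest mulrCA mulrC.
apply: (@le_lt_trans _ _ (e / M * (2 * C * expR (A * `|t|)))).
  by rewrite mulrC ler_wpM2r // !mulr_ge0 ?expR_ge0.
by rewrite mulrAC ltr_pdivrMr // ltr_pM2l // /M ltrDl.
Qed.

(** Values of series are identified through partial sums with an explicit
    remainder. *)
Lemma egf_unique a C A t v : geo C A a ->
  (forall e, 0 < e -> exists n, cn (v - egf_psum a t n) <= e /\
     egf_rest C A t n <= e) -> v = egf a t.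
Proof.
move=> ga H; apply/eqP; rewrite -subr_eq0; apply/eqP.
apply: (@cn_small_eq0 _ _ 2) => e /H[n [h1 h2]].
rewrite (_ : v - egf a t = (v - egf_psum a t n) - (egf a t - egf_psum a t n)); last by ring.
apply: le_trans (cnB _ _) _; rewrite mulr_natl mulr2n; apply: lerD => //.
exact: le_trans (egf_tail _ _ ga) _.
Qed.

Lemma egf_bound a C A t : geo C A a -> cn (egf a t) <= 2 * C * expR (A * `|t|).
Proof.
move=> ga; have := egf_tail t 0 ga.
by rewrite /egf_psum big_ord0 subr0 /egf_rest expr0 fact0 divr1 mul1r.
Qed.

Lemma eq_egf a b t : a =1 b -> egf a t = egf b t.
Proof. by move=> /funext ->. Qed.

Lemma geo_weaken C A C' A' a : C <= C' -> A <= A' -> geo C A a -> geo C' A' a.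
Proof.
move=> CC AA ga; have C0 := geo_C_ge0 ga; case: ga => A0 Ha; split; first exact: le_trans AA.
move=> k; apply: le_trans (Ha k) _; apply: ler_pM => //; first exact: exprn_ge0.
by apply: lerXn2r; rewrite // nnegrE // (le_trans A0).
Qed.

Lemma egf_linear a b C A c t : geo C A a -> geo C A b ->
  egf (fun k => c * a k + b k) t = c * egf a t + egf b t.
Proof.
move=> ga gb; have C0 := geo_C_ge0 ga; have [A0 Ha] := ga; have [_ Hb] := gb.
have gab : geo ((cn c + 1) * C) A (fun k => c * a k + b k).
  split=> // k; apply: le_trans (cnD _ _) _; rewrite cnM mulrDl mul1r mulrDl.
  by apply: lerD => //; rewrite -mulrA ler_wpM2l ?cn_ge0.
symmetry; apply: (egf_unique gab) => e e0.
have c1 : 0 < cn c + 1 by rewrite ltr_wpDl ?cn_ge0.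
have [N HN] := egf_rest_small A t (divr_gt0 e0 c1) C0.
exists N; have {}HN := ltW (HN N (leqnn _)).
have E : (cn c + 1) * egf_rest C A t N <= e by rewrite mulrC -ler_pdivlMr.
split; last by apply: le_trans E; rewrite /egf_rest; lra.
have -> : c * egf a t + egf b t - egf_psum (fun k => c * a k + b k) t N =
  c * (egf a t - egf_psum a t N) + (egf b t - egf_psum b t N).
  rewrite /egf_psum; under [X in _ - X = _]eq_bigr do rewrite mulrDl -mulrA.
  rewrite big_split /= -mulr_sumr; ring.
apply: le_trans E; apply: le_trans (cnD _ _) _; rewrite cnM mulrDl mul1r.
by apply: lerD; [rewrite ler_wpM2l ?cn_ge0 //|]; exact: egf_tail.
Qed.

Lemma geo0 A : 0 <= A -> geo 0 A (fun=> 0 : R[i]).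
Proof. by move=> A0; split=> // k; rewrite cn0 mul0r. Qed.

Lemma egf0 t : egf (fun=> 0) t = 0.
Proof.
have g0 := geo0 ler01.
symmetry; apply: (egf_unique g0) => e e0; exists 0%N.
by rewrite /egf_psum big_ord0 subr0 cn0 /egf_rest mulr0 mul0r; split; exact: ltW.
Qed.

Lemma egf_sum (I : Type) (r : seq I) (c : I -> R[i]) (U : I -> nat -> R[i]) C A t :
  0 <= C -> 0 <= A -> (forall i, geo C A (U i)) ->
  egf (fun k => \sum_(i <- r) c i * U i k) t = \sum_(i <- r) c i * egf (U i) t.
Proof.
move=> C0 A0 gU; elim: r => [|i r IH].
  by rewrite big_nil -[RHS](egf0 t); apply: eq_egf => k; rewrite big_nil.
rewrite big_cons -IH.
pose C' := C + C * \sum_(j <- r) cn (c j).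
have S0 : 0 <= \sum_(j <- r) cn (c j) by apply: sumr_ge0 => j _; exact: cn_ge0.
have g1 : geo C' A (U i) by apply: geo_weaken (gU i); rewrite ?lerDl ?mulr_ge0.
have g2 : geo C' A (fun k => \sum_(j <- r) c j * U j k).
  split=> // k; apply: (@le_trans _ _ (C * (\sum_(j <- r) cn (c j)) * A ^+ k)); last first.
    by rewrite ler_wpM2r ?exprn_ge0 // lerDr.
  apply: le_trans (cn_sum _ _ _) _; rewrite mulr_sumr mulr_suml; apply: ler_sum => j _.
  by rewrite cnM [C * _]mulrC -mulrA ler_wpM2l ?cn_ge0 //; case: (gU j).
rewrite -(egf_linear (c i) t g1 g2); apply: eq_egf => k; by rewrite big_cons.
Qed.

Lemma egf_scale a (c : R) t : egf (fun k => a k * (c ^+ k)%:C) t = egf a (c * t).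
Proof.
have E x y : x * (y%:C) = complex.Re x * y +i* (complex.Im x * y) :> R[i].
  by case: x => p q; apply/eqP; rewrite eq_complex /=; apply/andP; split; apply/eqP; ring.
rewrite /egf /egfR; congr (_ +i* _); apply: (congr1 (fun f => limn (series f)));
  by apply/funext => k; rewrite E /= exprMn !mulrA.
Qed.

Lemma egf_psum1 a n : egf_psum a 1 n = \sum_(k < n) a k * (k`!%:R^-1)%:C.
Proof. by apply: eq_bigr => k _; rewrite expr1n mul1r. Qed.

End Egf.

Section DoubleEgf.
Variable R : realType.
Implicit Types (a : nat -> nat -> R[i]) (s t A C : R).

Lemma triangle_sum (g : nat -> nat -> R[i]) n :
  \sum_(k < n) \sum_(j < k.+1) g (k - j)%N j = \sum_(i < n) \sum_(j < n - i) g i j.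
Proof.
elim: n => [|n IH]; first by rewrite !big_ord0.
rewrite big_ord_recr IH /= [RHS](eq_bigr (fun i : 'I_n.+1 =>
   \sum_(j < n - i) g i j + g i (n - i)%N)) => [|i _]; last first.
  by rewrite subSn -1?ltnS // big_ord_recr.
rewrite big_split /= [X in _ = X + _]big_ord_recr /= subnn big_ord0 addr0; congr (_ + _).
rewrite (reindex_inj rev_ord_inj) /=; apply: eq_bigr => j _.
by rewrite subSS subKn // -ltnS.
Qed.

(** The k-th Taylor coefficient at 0 of c |-> g(c x, c y), where g is the double
    exponential generating function of a. *)
Definition antidiag (a : nat -> nat -> R[i]) (x y : R[i]) (k : nat) : R[i] :=
  \sum_(j < k.+1) ('C(k, j)%:R * (x ^+ (k - j) * y ^+ j)) * a (k - j)%N j.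

Definition geo2 C A (a : nat -> nat -> R[i]) :=
  0 <= A /\ forall i j, cn (a i j) <= C * A ^+ (i + j).

Lemma geo2_C_ge0 C A a : geo2 C A a -> 0 <= C.
Proof. by case=> _ /(_ 0%N 0%N); rewrite mulr1; apply: le_trans; exact: cn_ge0. Qed.

Lemma geo2_row C A a i : geo2 C A a -> geo (C * A ^+ i) A (a i).
Proof. by case=> A0 H; split=> // k; rewrite -mulrA -exprD. Qed.

Lemma geo_egf2 C A a t : geo2 C A a ->
  geo (2 * C * expR (A * `|t|)) A (fun i => egf (a i) t).
Proof.
move=> ga; split=> [|i]; first by case: ga.
by apply: le_trans (egf_bound _ (geo2_row i ga)) _; lra.
Qed.

Lemma geo_antidiag C A a x y : geo2 C A a -> geo C (A * (cn x + cn y)) (antidiag a x y).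
Proof.
move=> [A0 Ha]; split=> [|k]; first by rewrite mulr_ge0 ?addr_ge0 ?cn_ge0.
apply: le_trans (cn_sum _ _ _) _; rewrite exprMn exprDn !mulr_sumr.
apply: ler_sum => j _; have jk : (j <= k)%N by rewrite -ltnS.
rewrite !cnM cn_nat !cnX -[in leRHS]mulr_natl.
have := Ha (k - j)%N j; rewrite subnK // => h.
apply: le_trans (ler_wpM2l _ h) _; last by rewrite mulrC -mulrA.
by rewrite !mulr_ge0 ?exprn_ge0 ?cn_ge0.
Qed.

(** Both sides are compared with the sum over the triangle i + j < n.  The tails
    of the n inner series add up, by the binomial theorem, to at most a multiple
    of (A (|s| + |t|))^n / n!. *)
Lemma egf_egf a C A s t : geo2 C A a ->
  egf (fun i => egf (a i) t) s = egf (antidiag a s%:C t%:C) 1.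
Proof.
move=> ga; have C0 := geo2_C_ge0 ga; have [A0 Ha] := ga.
have gd := geo_antidiag s%:C t%:C ga; rewrite !cn_real in gd.
have go := geo_egf2 t ga.
pose E := expR (A * `|t|).
have E0 : 0 <= E by exact: expR_ge0.
have C'0 : 0 <= 2 * C * E by rewrite !mulr_ge0.
apply: (egf_unique gd) => e e0.
have e3 : 0 < e / 2 by rewrite divr_gt0.
have M0 : 0 < 2 * C * E + 1 by rewrite ltr_wpDl.
have [N1 H1] := egf_rest_small A s e3 C'0.
have [N2 H2] := egf_rest_small (A * (`|s| + `|t|)) 1 e0 C0.
have [N3 H3] := exp_coeff_small (A * (`|s| + `|t|)) (divr_gt0 e3 M0).
pose n := maxn N1 (maxn N2 N3); exists n.
have {}H1 : egf_rest (2 * C * E) A s n < e / 2 by apply: H1; rewrite leq_maxl.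
have {}H2 : egf_rest C (A * (`|s| + `|t|)) 1 n < e.
  by apply: H2; rewrite /n !leq_max leqnn orbT.
have {}H3 : `|(A * (`|s| + `|t|)) ^+ n / n`!%:R| < e / 2 / (2 * C * E + 1).
  by apply: H3; rewrite /n !leq_max leqnn !orbT.
split; last exact: ltW.
have -> : egf_psum (antidiag a s%:C t%:C) 1 n =
  \sum_(i < n) egf_psum (a i) t (n - i) * (s ^+ i / i`!%:R)%:C.
  rewrite egf_psum1.
  pose g i j := a i j * ((s ^+ i / i`!%:R) * (t ^+ j / j`!%:R))%:C.
  transitivity (\sum_(k < n) \sum_(j < k.+1) g (k - j)%N j).
    apply: eq_bigr => k _; rewrite /antidiag mulr_suml; apply: eq_bigr => j _.
    have jk : (j <= k)%N by rewrite -ltnS.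
    rewrite /g -!rmorphXn -rmorphM -(rmorph_nat (real_complex R)) -rmorphM.
    rewrite mulrAC -rmorphM mulrC; congr (_ * _%:C).
    rewrite -(bin_fact jk) !natrM.
    have := fact_gt0 j; have := fact_gt0 (k - j); have := bin_gt0 k j.
    rewrite jk -!(ltr0n R) => h1 h2 h3.
    by field; rewrite !gt_eqF.
  rewrite triangle_sum; apply: eq_bigr => i _; rewrite /egf_psum mulr_suml.
  by apply: eq_bigr => j _; rewrite /g mulrC rmorphM; ring.
rewrite (_ : _ - _ = (egf (fun i => egf (a i) t) s - egf_psum (fun i => egf (a i) t) s n)
  + \sum_(i < n) (egf (a i) t - egf_psum (a i) t (n - i)) * (s ^+ i / i`!%:R)%:C); last first.
  under [X in _ = _ + X]eq_bigr do rewrite mulrBl.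
  by rewrite sumrB -/(egf_psum (fun i => egf (a i) t) s n) addrA subrK.
apply: le_trans (cnD _ _) _; rewrite [e]splitr; apply: lerD.
  by apply: le_trans (egf_tail _ _ go) _; exact: ltW.
apply: le_trans (cn_sum _ _ _) _.
apply: (@le_trans _ _ (2 * C * E * ((A * (`|s| + `|t|)) ^+ n / n`!%:R))); last first.
  apply: le_trans (_ : _ <= (2 * C * E + 1) * (e / 2 / (2 * C * E + 1))) _; last first.
    by rewrite mulrC divfK // gt_eqF.
  have X0 : 0 <= A * (`|s| + `|t|) by rewrite mulr_ge0 // addr_ge0.
  apply: ler_pM => //; [by rewrite divr_ge0 // exprn_ge0|by rewrite lerDl|].
  by apply: le_trans (ltW H3); exact: ler_norm.
have -> : (A * (`|s| + `|t|)) ^+ n / n`!%:R =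
  \sum_(i < n.+1) ((A * `|s|) ^+ i / i`!%:R) * ((A * `|t|) ^+ (n - i) / (n - i)`!%:R).
  rewrite mulrDr addrC exprDn mulr_suml; apply: eq_bigr => i _.
  have iN : (i <= n)%N by rewrite -ltnS.
  rewrite -mulr_natl -(bin_fact iN) !natrM.
  have := fact_gt0 i; have := fact_gt0 (n - i); have := bin_gt0 n i.
  rewrite iN -!(ltr0n R) => h1 h2 h3.
  by field; rewrite !gt_eqF.
rewrite big_ord_recr /= mulrDr ler_wpDr //.
  by rewrite !mulr_ge0 ?exprn_ge0 ?invr_ge0 ?mulr_ge0.
rewrite mulr_sumr; apply: ler_sum => i _; rewrite cnM cn_real.
apply: le_trans (ler_wpM2r (normr_ge0 _) (egf_tail _ _ (geo2_row i ga))) _.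
rewrite /egf_rest -/E normrM normrX [`|_^-1|]ger0_norm ?invr_ge0 // !exprMn.
rewrite le_eqVlt; apply/orP; left; apply/eqP.
move: (A ^+ (n - i)) (`|t| ^+ (n - i)) (A ^+ i) (`|s| ^+ i) => x1 x2 x3 x4; ring.
Qed.

End DoubleEgf.

#[local] Opaque egf.

(** * Uniqueness and change of origin *)

Section EgfIdentities.
Variable R : realType.
Implicit Types (a b u : nat -> R[i]) (s t A C : R).

(** If a i is the first nonzero coefficient, then a i t^i / i! is O(t^(i+1)). *)
Lemma egf_vanishing_order a C A K (d : R) n : geo C A a -> 0 < d ->
  (forall t, 0 < t -> t <= d -> cn (egf a t) <= K * t ^+ n.+1) ->
  forall i, (i <= n)%N -> a i = 0.
Proof.
move=> ga d0 H; have C0 := geo_C_ge0 ga; have [A0 _] := ga.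
elim/ltn_ind => i IH lein.
pose M := i`!%:R * (`|K| + 2 * C * (A ^+ i.+1 * expR A)).
have M0 : 0 <= M by rewrite mulr_ge0 // addr_ge0 // !mulr_ge0 ?exprn_ge0 ?expR_ge0.
pose d' := Num.min 1 d.
have d'0 : 0 < d' by rewrite lt_min ltr01.
have small t : 0 < t -> t <= d' -> cn (a i) <= M * t.
  move=> t0; rewrite le_min => /andP[t1 td].
  have ti0 : 0 < t ^+ i by rewrite exprn_gt0.
  have fi0 : 0 < (i`!%:R : R) by rewrite ltr0n fact_gt0.
  (* only the last term of the partial sum survives *)
  have E : egf_psum a t i.+1 = a i * (t ^+ i / i`!%:R)%:C.
    rewrite /egf_psum big_ord_recr /= big1 ?add0r // => j _.
    by rewrite IH ?mul0r // (leq_trans (ltnW (ltn_ord j)) lein).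
  have : cn (egf_psum a t i.+1) <= (`|K| + 2 * C * (A ^+ i.+1 * expR A)) * t ^+ i.+1.
    have -> : egf_psum a t i.+1 = egf a t - (egf a t - egf_psum a t i.+1) by ring.
    apply: le_trans (cnB _ _) _; rewrite mulrDl; apply: lerD.
      apply: le_trans (H t t0 td) _; apply: (@le_trans _ _ (`|K| * t ^+ n.+1)).
        by rewrite ler_wpM2r ?exprn_ge0 ?(ltW t0) // ler_norm.
      by rewrite ler_wpM2l // ler_wiXn2l // (ltW t0).
    apply: le_trans (egf_tail _ _ ga) _; rewrite /egf_rest -[leRHS]mulrA ler_wpM2l ?mulr_ge0 //.
    rewrite gtr0_norm // exprMn -!mulrA ler_wpM2l ?exprn_ge0 //.
    rewrite [expR A * _]mulrC ler_wpM2l ?exprn_ge0 ?(ltW t0) //.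
    apply: (@le_trans _ _ (1 * expR A)); last by rewrite mul1r.
    apply: ler_pM; rewrite ?invr_ge0 ?expR_ge0 //.
      by rewrite invf_le1 ?ltr0n ?fact_gt0 // ler1n fact_gt0.
    by rewrite ler_expR ler_piMr // ltW.
  rewrite E cnM cn_real ger0_norm; last by rewrite divr_ge0 // ltW.
  move=> /(ler_wpM2l (ltW fi0)).
  have -> : i`!%:R * (cn (a i) * (t ^+ i / i`!%:R)) = cn (a i) * t ^+ i.
    by field; rewrite gt_eqF.
  have -> : i`!%:R * ((`|K| + 2 * C * (A ^+ i.+1 * expR A)) * t ^+ i.+1) = M * t * t ^+ i.
    by rewrite /M [t ^+ _]exprS; ring.
  by rewrite ler_pM2r.
apply/eqP; rewrite -cn_eq0; apply/negPn/negP => ai.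
have ai0 : 0 < cn (a i) by rewrite lt_neqAle eq_sym ai cn_ge0.
have t0 : 0 < Num.min d' (cn (a i) / (M + 1) / 2).
  by rewrite lt_min d'0 !divr_gt0 // ltr_wpDl.
have := small _ t0; rewrite ge_min lexx => /(_ isT).
have M1 : 0 < M + 1 by rewrite ltr_wpDl.
set t := Num.min _ _ in t0 *.
have tle : t <= cn (a i) / (M + 1) / 2 by rewrite /t ge_min lexx orbT.
rewrite leNgt => /negP; apply.
apply: (@le_lt_trans _ _ ((M + 1) * (cn (a i) / (M + 1) / 2))).
  by apply: ler_pM => //; rewrite ?lerDl // ltW.
have -> : (M + 1) * (cn (a i) / (M + 1) / 2) = cn (a i) / 2.
  by field; rewrite gt_eqF.
by rewrite ltr_pdivrMr // ltr_pMr // ltr1n.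
Qed.

Lemma geo_max C A C' A' a b : geo C A a -> geo C' A' b ->
  geo (Num.max C C') (Num.max A A') a /\ geo (Num.max C C') (Num.max A A') b.
Proof.
by move=> ga gb; split; [apply: geo_weaken ga|apply: geo_weaken gb];
  rewrite le_max lexx ?orbT.
Qed.

Lemma egf_inj a b C A C' A' (d : R) : geo C A a -> geo C' A' b -> 0 < d ->
  (forall t, 0 < t -> t <= d -> egf a t = egf b t) -> a =1 b.
Proof.
move=> ga gb d0 H k; have [ga' gb'] := geo_max ga gb.
set C2 := Num.max C C' in ga' gb'; set A2 := Num.max A A' in ga' gb'.
have A20 : 0 <= A2 by case: ga'.
have gn : geo (2 * C2) A2 (fun k => (-1) * b k + a k).
  split=> // j; apply: le_trans (cnD _ _) _; rewrite mulN1r cnN -mulrA mulr_natl mulr2n.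
  by apply: lerD; [case: gb'|case: ga'].
apply/eqP; rewrite -subr_eq0; apply/eqP.
have -> : a k - b k = (-1) * b k + a k by ring.
apply: (egf_vanishing_order (K := 0) gn d0) (leqnn k) => t t0 td.
by rewrite (egf_linear _ _ gb' ga') H // mulN1r addNr cn0 mul0r.
Qed.

Lemma egf_at0 a C A : geo C A a -> egf a 0 = a 0%N.
Proof.
move=> ga; have := egf_tail 0 1 ga.
rewrite /egf_rest normr0 mulr0 expr1 mul0r mul0r mulr0 => h.
have : cn (egf a 0 - egf_psum a 0 1) = 0 by apply/eqP; rewrite eq_le h cn_ge0.
move/eqP; rewrite cn_eq0 subr_eq0 => /eqP ->.
by rewrite /egf_psum big_ord1 expr0 fact0 divr1 mulr1.
Qed.

Definition shift (n : nat) a := fun k => a (n + k)%N.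

Lemma geo_shift C A a n : geo C A a -> geo (C * A ^+ n) A (shift n a).
Proof. by move=> [A0 H]; split=> // k; rewrite -mulrA -exprD; exact: H. Qed.

(** The case a (i + j) of a double series: its sums along antidiagonals are given
    by the binomial theorem. *)
Lemma egfD a C A s t : geo C A a ->
  egf a (s + t) = egf (fun k => egf (shift k a) t) s.
Proof.
move=> ga; have g2 : geo2 C A (fun i j => a (i + j)%N) by case: ga.
rewrite (egf_egf s t g2) -[s + t]mulr1 -egf_scale; apply: eq_egf => k.
rewrite /antidiag rmorphXn rmorphD exprDn mulr_sumr; apply: eq_bigr => j _.
by rewrite subnK -1?ltnS // mulr_natl mulrC.
Qed.

Lemma geo_recenter C A a t : geo C A a ->
  geo (2 * C * expR (A * `|t|)) A (fun k => egf (shift k a) t).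
Proof.
move=> ga; split=> [|k]; first by case: ga.
by apply: le_trans (egf_bound t (geo_shift k ga)) _; lra.
Qed.

Lemma egf_swap (a : nat -> nat -> R[i]) C A s t : geo2 C A a ->
  egf (fun i => egf (a i) t) s = egf (fun j => egf (fun i => a i j) s) t.
Proof.
move=> ga; have gb : geo2 C A (fun j i => a i j).
  by case: ga => A0 H; split=> // i j; rewrite addnC.
apply: etrans (egf_egf s t ga) _; apply: etrans (esym (egf_egf t s gb)).
apply: eq_egf => k.
rewrite /antidiag (reindex_inj rev_ord_inj) /=; apply: eq_bigr => j _.
have jk : (j <= k)%N by rewrite -ltnS.
by rewrite subSS subKn // bin_sub // [_ ^+ j * _]mulrC.
Qed.

Lemma egf_line (a : nat -> nat -> R[i]) C A s t c : geo2 C A a ->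
  egf (fun i => egf (a i) (c * t)) (c * s) = egf (antidiag a s%:C t%:C) c.
Proof.
move=> ga; apply: etrans (egf_egf (c * s) (c * t) ga) _.
rewrite -[in RHS](mulr1 c) -egf_scale; apply: eq_egf => k.
rewrite /antidiag mulr_suml; apply: eq_bigr => j _.
have jk : (j <= k)%N by rewrite -ltnS.
rewrite !rmorphM !exprMn rmorphXn.
have -> : c%:C ^+ k = c%:C ^+ (k - j) * c%:C ^+ j :> R[i] by rewrite -exprD subnK.
ring.
Qed.

(** The Taylor coefficients at (s0, t0). *)
Definition recenter2 (a : nat -> nat -> R[i]) (s0 t0 : R) (i j : nat) : R[i] :=
  egf (fun k => egf (fun l => a (i + k)%N (j + l)%N) t0) s0.

Lemma geo2_shift C A (a : nat -> nat -> R[i]) i j : geo2 C A a ->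
  geo2 (C * A ^+ (i + j)) A (fun k l => a (i + k)%N (j + l)%N).
Proof.
move=> [A0 H]; split=> // k l; apply: le_trans (H _ _) _.
by rewrite -mulrA -exprD addnACA.
Qed.

Lemma geo2_recenter C A (a : nat -> nat -> R[i]) s0 t0 : geo2 C A a ->
  geo2 (4 * C * (expR (A * `|t0|) * expR (A * `|s0|))) A (recenter2 a s0 t0).
Proof.
move=> ga; split=> [|i j]; first by case: ga.
apply: le_trans (egf_bound _ (geo_egf2 t0 (geo2_shift i j ga))) _.
rewrite le_eqVlt; apply/orP; left; apply/eqP; ring.
Qed.

Lemma egf2D (a : nat -> nat -> R[i]) C A s0 t0 s t : geo2 C A a ->
  egf (fun i => egf (a i) (t0 + t)) (s0 + s) =
  egf (fun i => egf (recenter2 a s0 t0 i) t) s.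
Proof.
move=> ga.
pose a1 i j := egf (fun l => a i (j + l)%N) t0.
have ga1 : geo2 (2 * C * expR (A * `|t0|)) A a1.
  split=> [|i j]; first by case: ga.
  have gs : geo (C * A ^+ (i + j)) A (fun l => a i (j + l)%N).
    by case: ga => A0 H; split=> // k; rewrite -mulrA -exprD -addnA.
  apply: le_trans (egf_bound _ gs) _.
  rewrite le_eqVlt; apply/orP; left; apply/eqP; ring.
have E1 i : egf (a i) (t0 + t) = egf (a1 i) t.
  by rewrite addrC (egfD _ _ (geo2_row i ga)).
have -> : egf (fun i => egf (a i) (t0 + t)) (s0 + s) = egf (fun i => egf (a1 i) t) (s + s0).
  by rewrite [s0 + s]addrC; apply: eq_egf.
rewrite (egfD _ _ (geo_egf2 t ga1)); apply: eq_egf => i.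
have gs : geo2 (2 * C * expR (A * `|t0|) * A ^+ i) A (fun k j => a1 (i + k)%N j).
  by case: ga1 => A0 H; split=> // k l; rewrite -mulrA -exprD addnA; exact: H.
exact: egf_swap gs.
Qed.

End EgfIdentities.

(** * Antiderivatives and the Taylor formula *)

Section Calculus.
Variable R : realType.
Implicit Types (s t : R).

Lemma within_continuous_is_derive (f df : R -> R) (a b : R) :
  (forall x, a <= x <= b -> is_derive x 1 f (df x)) ->
  {within `[a, b], continuous f}.
Proof.
move=> H; apply: derivable_within_continuous => x; rewrite in_itv /= => /H h.
exact: ex_derive.
Qed.

Lemma mean_value (f df : R -> R) (a b : R) : a < b ->
  (forall x, a <= x <= b -> is_derive x 1 f (df x)) ->
  exists2 c, a <= c <= b & f b - f a = df c * (b - a).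
Proof.
move=> ab H; have [||c cab E] := @MVT R f df a b ab.
- by move=> x; rewrite in_itv /= => /andP[/ltW h1 /ltW h2]; apply: H; rewrite h1.
- exact: within_continuous_is_derive H.
- exists c => //; move: cab; rewrite in_itv /= => /andP[h1 h2].
  by rewrite !ltW.
Qed.

Lemma zero_derivative (f : R -> R) (T x : R) : `|x| < T ->
  (forall y : R, `|y| < T -> is_derive y (1 : R) f (0 : R)) -> f x = f 0.
Proof.
rewrite ltr_norml => /andP[x1 x2] H.
have [x0|x0|->//] := ltgtP x 0.
- have [|c _ /eqP] := @mean_value f (fun=> 0) x 0 x0.
    by move=> y /andP[h1 h2]; apply: H; rewrite ltr_norml; apply/andP; split; lra.
  by rewrite mul0r subr_eq0 => /eqP ->.
- have [|c _ /eqP] := @mean_value f (fun=> 0) 0 x x0.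
    by move=> y /andP[h1 h2]; apply: H; rewrite ltr_norml; apply/andP; split; lra.
  by rewrite mul0r subr_eq0 => /eqP ->.
Qed.

Lemma local_antiderivative (f : R -> R) (T : R) : continuous f -> 0 < T ->
  exists g : R -> R, g 0 = 0 /\ forall x : R, `|x| < T -> is_derive x (1 : R) g (f x).
Proof.
move=> cf T0.
pose g (x : R) := (\int[lebesgue_measure]_(t in `[- T, x]) f t)%R.
exists (fun x => g x - g 0); split; first by rewrite subrr.
move=> x; rewrite ltr_norml => /andP[x1 x2].
have [|||d e] := @continuous_FTC1_closed R f (- T) x T x2.
- apply: continuous_compact_integrable; first exact: segment_compact.
  by apply: continuous_subspaceT => y; exact: cf.
- by [].
- exact: cf.
have Hg : is_derive x (1 : R) g (f x) by split; [exact: d|rewrite -derive1E; exact: e].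
by have := is_deriveB Hg (is_derive_cst (g 0) x (1 : R)); rewrite subr0.
Qed.

(** Primitives on the intervals (-n, n) vanishing at 0 agree on common domains and
    can be glued. *)
Lemma antiderivative (f : R -> R) : continuous f ->
  exists g : R -> R, forall x : R, is_derive x (1 : R) g (f x).
Proof.
move=> cf.
have /choice[G HG] : forall n : nat, exists g : R -> R, g 0 = 0 /\
  forall x : R, `|x| < n.+1%:R -> is_derive x (1 : R) g (f x).
  by move=> n; apply: local_antiderivative; rewrite ?ltr0n.
have GE n m x : (n <= m)%N -> `|x| < n.+1%:R -> G n x = G m x.
  move=> nm xn; apply/eqP; rewrite -subr_eq0; apply/eqP.
  have -> : 0 = G n 0 - G m 0 by rewrite (HG n).1 (HG m).1 subrr.
  apply: (@zero_derivative (fun x => G n x - G m x) n.+1%:R) => // y yn.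
  have ym : `|y| < m.+1%:R by apply: lt_le_trans yn _; rewrite ler_nat.
  by have := is_deriveB ((HG n).2 y yn) ((HG m).2 y ym); rewrite subrr.
pose N (x : R) := Num.bound `|x|.
have NP x : `|x| < (N x).+1%:R.
  by apply: lt_trans (archi_boundP (normr_ge0 x)) _; rewrite ltr_nat.
exists (fun x => G (N x) x) => x.
pose M := (N x).+1.
have xM : `|x| < M.+1%:R by apply: lt_trans (NP x) _; rewrite ltr_nat.
apply: (near_eq_is_derive (f := G M)); last exact: (HG M).2.
have : \forall y \near x, `|y| < M.+1%:R.
  have : `|y| @[y --> x] --> `|x| by apply: cvg_norm; exact: cvg_id.
  by move/cvgr_lt; exact.
apply: filterS => y yM.
have [h|h] := leqP M (N y); first by rewrite (GE M (N y)).
by rewrite (GE (N y) M) // ltnW.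
Qed.

Lemma is_derive_pow k t :
  is_derive t 1 (fun x : R => x ^+ k.+1 / k.+1`!%:R) (t ^+ k / k`!%:R).
Proof.
have -> : (fun x : R => x ^+ k.+1 / k.+1`!%:R) = (k.+1`!%:R^-1) \*: (fun x : R => x) ^+ k.+1.
  by apply/funext => x; rewrite /= mulrC exprfctE.
apply: is_derive_eq.
rewrite /= /GRing.scale /= mulr1 factS natrM.
have := fact_gt0 k; rewrite -(ltr0n R) => h.
have h2 : (0 : R) < k.+1%:R by rewrite ltr0n.
by field; rewrite !gt_eqF // addr_gt0.
Qed.

Lemma is_derive_psum (c : nat -> R) n t :
  is_derive t 1 (fun x : R => \sum_(k < n.+1) c k * (x ^+ k / k`!%:R))
    (\sum_(k < n) c k.+1 * (t ^+ k / k`!%:R)).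
Proof.
have -> : (fun x : R => \sum_(k < n.+1) c k * (x ^+ k / k`!%:R)) =
   cst (c 0%N) + \sum_(k < n) (c k.+1 \*: (fun x : R => x ^+ k.+1 / k.+1`!%:R)).
  apply/funext => x; rewrite big_ord_recl /= expr0 fact0 divr1 mulr1.
  by rewrite fctE /= fct_sumE.
have H := is_derive_sum (fun i : 'I_n => is_deriveZ (c i.+1) (is_derive_pow i t)).
by have := is_deriveD (is_derive_cst (c 0%N) t (1 : R)) H; rewrite add0r.
Qed.

(** The remainder of order n + 1 has as derivative the remainder of order n of the
    next function, so the mean value theorem gives an induction on n for all m
    at once. *)
Lemma taylor_bound (psi : nat -> R -> R) (C A T : R) :
  (forall k t, is_derive t 1 (psi k) (psi k.+1 t)) ->
  (forall k t, 0 <= t <= T -> `|psi k t| <= C * A ^+ k) ->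
  forall n m t, 0 <= t <= T ->
   `|psi m t - \sum_(k < n) psi (m + k)%N 0 * (t ^+ k / k`!%:R)|
      <= C * A ^+ (m + n) * (t ^+ n / n`!%:R).
Proof.
move=> Hd Hb; elim=> [|n IH] m t tT.
  by rewrite big_ord0 subr0 addn0 expr0 fact0 divr1 mulr1; exact: Hb.
have /andP[t0 tT'] := tT.
pose Rm x := psi m x - \sum_(k < n.+1) psi (m + k)%N 0 * (x ^+ k / k`!%:R).
pose dR x := psi m.+1 x - \sum_(k < n) psi (m + k.+1)%N 0 * (x ^+ k / k`!%:R).
pose K := C * A ^+ (m + n.+1).
have DR (x : R) : is_derive x (1 : R) Rm (dR x).
  exact: is_deriveB (Hd m x) (is_derive_psum (fun k => psi (m + k)%N 0) n x).
have DK (x : R) : is_derive x (1 : R) (fun x : R => K * (x ^+ n.+1 / n.+1`!%:R)) (K * (x ^+ n / n`!%:R)).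
  by have := is_deriveZ K (is_derive_pow n x); exact.
have R0 : Rm 0 = 0.
  rewrite /Rm big_ord_recl /= expr0 fact0 divr1 mulr1 addn0 big1 ?addr0 ?subrr //.
  by move=> i _; rewrite expr0n /= mul0r mulr0.
have [->|tn0] := eqVneq t 0.
  by rewrite -/(Rm 0) R0 normr0 expr0n /= mul0r mulr0.
have tp : 0 < t by rewrite lt_neqAle eq_sym tn0.
rewrite -/(Rm t) -/K.
have bnd c : 0 <= c <= t -> `|dR c| <= K * (c ^+ n / n`!%:R).
  move=> /andP[c0 ct]; rewrite /K addnS -addSn.
  have -> : dR c = psi m.+1 c - \sum_(k < n) psi (m.+1 + k)%N 0 * (c ^+ k / k`!%:R).
    by congr (_ - _); apply: eq_bigr => k _; rewrite addnS.
  by apply: IH; rewrite c0 (le_trans ct).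
rewrite ler_norml; apply/andP; split.
- have D (x : R) : is_derive x (1 : R) (fun x : R => K * (x ^+ n.+1 / n.+1`!%:R) + Rm x)
    (K * (x ^+ n / n`!%:R) + dR x) by exact: is_deriveD (DK x) (DR x).
  have [c ct] := @mean_value _ _ 0 t tp (fun x _ => D x).
  rewrite R0 expr0n /= mul0r mulr0 addr0 !subr0 => E.
  have := bnd c ct; rewrite ler_norml => /andP[h _].
  have : 0 <= (K * (c ^+ n / n`!%:R) + dR c) * t by rewrite mulr_ge0 // -lerBlDl sub0r.
  by rewrite -E; lra.
- have D (x : R) : is_derive x (1 : R) (fun x : R => K * (x ^+ n.+1 / n.+1`!%:R) - Rm x)
    (K * (x ^+ n / n`!%:R) - dR x) by exact: is_deriveB (DK x) (DR x).
  have [c ct] := @mean_value _ _ 0 t tp (fun x _ => D x).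
  rewrite R0 expr0n /= mul0r mulr0 !subr0 => E.
  have := bnd c ct; rewrite ler_norml => /andP[_ h].
  have : 0 <= (K * (c ^+ n / n`!%:R) - dR c) * t by rewrite mulr_ge0 // subr_ge0.
  by rewrite -E; lra.
Qed.

End Calculus.

(** * Complex-valued functions of a real variable *)

Section ComplexCalculus.
Variable R : realType.
Implicit Types (s t : R) (F G : R -> R[i]).

Definition cderiv F G := forall t : R,
  is_derive t (1 : R) (fun x => complex.Re (F x)) (complex.Re (G t)) /\
  is_derive t (1 : R) (fun x => complex.Im (F x)) (complex.Im (G t)).

Definition ccontinuous F := continuous (fun x => complex.Re (F x)) /\
  continuous (fun x => complex.Im (F x)).

Lemma Re_mul (x y : R[i]) : complex.Re (x * y) =
  complex.Re x * complex.Re y - complex.Im x * complex.Im y.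
Proof. by case: x; case: y. Qed.

Lemma Im_mul (x y : R[i]) : complex.Im (x * y) =
  complex.Re x * complex.Im y + complex.Im x * complex.Re y.
Proof. by case: x => a b; case: y => c d /=. Qed.

Lemma Re_add (x y : R[i]) : complex.Re (x + y) = complex.Re x + complex.Re y.
Proof. by case: x; case: y. Qed.

Lemma Im_add (x y : R[i]) : complex.Im (x + y) = complex.Im x + complex.Im y.
Proof. by case: x; case: y. Qed.

Lemma cderiv_ext F F' G G' : F =1 F' -> G =1 G' -> cderiv F G -> cderiv F' G'.
Proof. by move=> /funext <- /funext <-. Qed.

Lemma cderivD F G F' G' : cderiv F G -> cderiv F' G' ->
  cderiv (fun t => F t + F' t) (fun t => G t + G' t).
Proof.
move=> H H' t; have [h1 h2] := H t; have [h1' h2'] := H' t.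
rewrite Re_add Im_add; split.
- have -> : (fun x => complex.Re (F x + F' x)) =
    (fun x => complex.Re (F x)) + (fun x => complex.Re (F' x)).
    by apply/funext => x; rewrite Re_add.
  exact: is_deriveD.
- have -> : (fun x => complex.Im (F x + F' x)) =
    (fun x => complex.Im (F x)) + (fun x => complex.Im (F' x)).
    by apply/funext => x; rewrite Im_add.
  exact: is_deriveD.
Qed.

Lemma cderivZ (c : R[i]) F G : cderiv F G ->
  cderiv (fun t => c * F t) (fun t => c * G t).
Proof.
move=> H t; have [h1 h2] := H t; rewrite Re_mul Im_mul; split.
- have -> : (fun x => complex.Re (c * F x)) =
    (complex.Re c \*: (fun x => complex.Re (F x))) - (complex.Im c \*: (fun x => complex.Im (F x))).
    by apply/funext => x; rewrite Re_mul.
  exact: is_deriveB.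
- have -> : (fun x => complex.Im (c * F x)) =
    (complex.Re c \*: (fun x => complex.Im (F x))) + (complex.Im c \*: (fun x => complex.Re (F x))).
    by apply/funext => x; rewrite Im_mul.
  exact: is_deriveD.
Qed.

Lemma cderiv_cst (c : R[i]) : cderiv (fun=> c) (fun=> 0).
Proof. by move=> t; split; exact: is_derive_cst. Qed.

Lemma cderivB F G F' G' : cderiv F G -> cderiv F' G' ->
  cderiv (fun t => F t - F' t) (fun t => G t - G' t).
Proof.
move=> H H'; have := cderivD H (cderivZ (-1) H').
by apply: cderiv_ext => t; rewrite mulN1r.
Qed.

Lemma cderiv_sum (I : Type) (r : seq I) (c : I -> R[i]) (F G : I -> R -> R[i]) :
  (forall i, cderiv (F i) (G i)) ->
  cderiv (fun t => \sum_(i <- r) c i * F i t) (fun t => \sum_(i <- r) c i * G i t).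
Proof.
move=> H; elim: r => [|i r IH].
  by apply: cderiv_ext (cderiv_cst 0) => t; rewrite big_nil.
have := cderivD (cderivZ (c i) (H i)) IH.
by apply: cderiv_ext => t; rewrite big_cons.
Qed.

Lemma is_derive_shift (f : R -> R) (x s d : R) :
  is_derive (x + s) (1 : R) f d -> is_derive x (1 : R) (fun y => f (y + s)) d.
Proof.
move=> H; have Hs : is_derive x (1 : R) (fun y : R => y + s) 1.
  by have := is_deriveD (is_derive_id x (1 : R)) (is_derive_cst s x (1 : R)); rewrite addr0.
by have := @is_derive1_comp R f (fun y => y + s) x d 1 H Hs; rewrite mulr1.
Qed.

Lemma cderiv_shift F G s : cderiv F G -> cderiv (fun t => F (t + s)) (fun t => G (t + s)).
Proof. by move=> H t; have [h1 h2] := H (t + s); split; apply: is_derive_shift. Qed.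

Lemma cderiv_opp F G : cderiv F G -> cderiv (fun t => F (- t)) (fun t => - G (- t)).
Proof.
move=> H t; have [h1 h2] := H (- t).
have ReN (x : R[i]) : complex.Re (- x) = complex.Re x * -1 by case: x => a b /=; rewrite mulrN1.
have ImN (x : R[i]) : complex.Im (- x) = complex.Im x * -1 by case: x => a b /=; rewrite mulrN1.
rewrite ReN ImN; split.
- exact: (@is_derive1_comp R (fun x => complex.Re (F x)) -%R t _ _ h1 (is_deriveNid t (1 : R))).
- exact: (@is_derive1_comp R (fun x => complex.Im (F x)) -%R t _ _ h2 (is_deriveNid t (1 : R))).
Qed.

Lemma cderiv0_cst F t : cderiv F (fun=> 0) -> F t = F 0.
Proof.
move=> H; have t1 : `|t| < `|t| + 1 by rewrite ltrDl.
have := zero_derivative t1 (fun y _ => (H y).1).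
have := zero_derivative t1 (fun y _ => (H y).2).
by case: (F t) (F 0) => a b [c d] /= -> ->.
Qed.

Lemma cderiv_mean F G (e M : R) : 0 < e -> cderiv F G ->
  (forall t, 0 <= t <= e -> cn (G t) <= M) -> cn (F e - F 0) <= 2 * M * e.
Proof.
move=> e0 H HM.
have [c1 h1 E1] := mean_value e0 (fun x _ => (H x).1).
have [c2 h2 E2] := mean_value e0 (fun x _ => (H x).2).
have ReB (x y : R[i]) : complex.Re (x - y) = complex.Re x - complex.Re y by case: x; case: y.
have ImB (x y : R[i]) : complex.Im (x - y) = complex.Im x - complex.Im y by case: x; case: y.
apply: le_trans (cn_le_ReIm _) _; rewrite ReB ImB E1 E2 subr0 !normrM.
rewrite (gtr0_norm e0) -mulrDl ler_wpM2r ?(ltW e0) // mulr_natl mulr2n.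
by apply: lerD; [apply: le_trans (cn_Re _) _|apply: le_trans (cn_Im _) _]; exact: HM.
Qed.

Lemma cantiderivative F : ccontinuous F -> exists2 G, cderiv G F & G 0 = 0.
Proof.
move=> [h1 h2]; have [g1 H1] := antiderivative h1; have [g2 H2] := antiderivative h2.
have HG : cderiv (fun t => g1 t +i* g2 t) F by move=> t; split; [exact: H1|exact: H2].
exists (fun t => (g1 t +i* g2 t) - (g1 0 +i* g2 0)); last by rewrite subrr.
by have := cderivB HG (cderiv_cst (g1 0 +i* g2 0)); apply: cderiv_ext => t //; rewrite subr0.
Qed.

Lemma continuous_bounded (f : R -> R) (T : R) : continuous f ->
  exists M, forall t, `|t| <= T -> `|f t| <= M.
Proof.
move=> cf; have [T0|T0] := ltP T 0.
  by exists 0 => t tT; have := le_lt_trans tT T0; rewrite normr_lt0.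
have TT : - T <= T by lra.
have cn : {within `[- T, T], continuous (fun x => `|f x|)}.
  apply: continuous_subspaceT => x.
  by apply: (@continuous_comp _ _ _ f (fun y => `|y|)); [exact: cf|exact: norm_continuous].
have [c _ Hc] := EVT_max TT cn; exists `|f c| => t.
by rewrite ler_norml => tT; apply: Hc; rewrite in_itv.
Qed.

Lemma ccontinuous_bounded F (T : R) : ccontinuous F -> exists M, forall t, `|t| <= T -> cn (F t) <= M.
Proof.
move=> [h1 h2]; have [M1 H1] := continuous_bounded T h1; have [M2 H2] := continuous_bounded T h2.
exists (M1 + M2) => t tT; apply: le_trans (cn_le_ReIm _) _.
by apply: lerD; [exact: H1|exact: H2].
Qed.

Lemma taylor_pos (psi : nat -> R -> R[i]) (C A T t : R) : 0 <= A ->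
  (forall k, cderiv (psi k) (psi k.+1)) ->
  (forall k t, 0 <= t <= T -> cn (psi k t) <= C * A ^+ k) -> 0 <= t <= T ->
  psi 0%N t = egf (fun k => psi k 0) t.
Proof.
move=> A0 Hd Hb tT; have /andP[t0 tT'] := tT.
have T0 : (0 : R) <= 0 <= T by apply/andP; split=> //; exact: le_trans tT'.
have g : geo C A (fun k => psi k 0) by split=> // k; exact: Hb.
have C0 := geo_C_ge0 g.
apply: (egf_unique g) => e e0.
have [N HN] := egf_rest_small A t e0 C0; exists N.
have {}HN := HN N (leqnn _); split; last exact: ltW.
have := @taylor_bound R (fun k x => complex.Re (psi k x)) C A T
   (fun k x => (Hd k x).1) (fun k x h => le_trans (cn_Re _) (Hb k x h)) N 0%N t tT.
have := @taylor_bound R (fun k x => complex.Im (psi k x)) C A T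
   (fun k x => (Hd k x).2) (fun k x h => le_trans (cn_Im _) (Hb k x h)) N 0%N t tT.
rewrite !add0n => h1 h2; rewrite egf_psum_split.
have -> : psi 0%N t = complex.Re (psi 0%N t) +i* complex.Im (psi 0%N t) by case: (psi 0%N t).
set x := complex.Re _ in h2 *; set y := complex.Im _ in h1 *.
set x' := \sum_(k < N) _ in h2; set y' := \sum_(k < N) _ in h1.
have -> : (x +i* y) - (x' +i* y') = (x - x') +i* (y - y') by [].
apply: le_trans (cn_le_ReIm _) _ => /=.
apply: le_trans (lerD h2 h1) _; apply: le_trans (ltW HN).
rewrite /egf_rest (ger0_norm t0) exprMn.
have X0 : 0 <= C * A ^+ N * (t ^+ N / N`!%:R).
  by rewrite !mulr_ge0 ?exprn_ge0 ?invr_ge0.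
have E1 : 1 <= expR (A * t) by rewrite -expR0 ler_expR mulr_ge0.
have := ler_wpM2l X0 E1; rewrite mulr1; lra.
Qed.

(** Negative t are reduced to positive ones by the reflection t |-> - t. *)
Lemma taylor_egf (psi : nat -> R -> R[i]) (A : R) t : 0 <= A ->
  (forall k, cderiv (psi k) (psi k.+1)) ->
  (forall T, exists C, forall k t, `|t| <= T -> cn (psi k t) <= C * A ^+ k) ->
  psi 0%N t = egf (fun k => psi k 0) t.
Proof.
move=> A0 Hd Hb; have [C HC] := Hb `|t|.
have [t0|t0] := leP 0 t.
  apply: (@taylor_pos psi C A `|t|) => //.
    by move=> k x /andP[x0 xt]; apply: HC; rewrite ger0_norm.
  by rewrite t0 ler_norm.
(* the derivatives of x |-> psi 0 (- x) *)
pose phi k x := (-1) ^+ k * psi k (- x).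
have Hphi k : cderiv (phi k) (phi k.+1).
  have := cderivZ ((-1) ^+ k) (cderiv_opp (Hd k)).
  by apply: cderiv_ext => x //; rewrite /phi exprSr mulrN1 mulNr mulrN.
have Ht : 0 <= - t <= `|t| by rewrite oppr_ge0 (ltW t0) /= (ltr0_norm t0).
have E : phi 0%N (- t) = egf (fun k => phi k 0) (- t).
  apply: (@taylor_pos phi C A `|t|) => //.
  move=> k x /andP[x0 xt]; rewrite /phi cnM cnX cnN cn1 expr1n mul1r.
  by apply: HC; rewrite normrN ger0_norm.
rewrite /phi mul1r opprK in E; rewrite E -[- t]mulN1r -egf_scale; apply: eq_egf => k.
rewrite oppr0 mulrAC -{1}(rmorphN1 (real_complex R)) -rmorphXn -rmorphM -exprMn.
by rewrite mulN1r opprK expr1n mul1r.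
Qed.

End ComplexCalculus.

(** * Continuous linear group laws *)

Section Group.
Variable R : realType.
Implicit Types (s t : R).

Definition cnorm1 r (v : 'cV[R[i]]_r) : R := \sum_i cn (v i 0).

Lemma cnorm1_ge0 r (v : 'cV[R[i]]_r) : 0 <= cnorm1 v.
Proof. by apply: sumr_ge0 => i _; exact: cn_ge0. Qed.

Lemma cn_le_cnorm1 r (v : 'cV[R[i]]_r) i : cn (v i 0) <= cnorm1 v.
Proof.
by rewrite /cnorm1 (bigD1 i) //= lerDl; apply: sumr_ge0 => j _; exact: cn_ge0.
Qed.

Lemma cnorm1_eq0 r (v : 'cV[R[i]]_r) : cnorm1 v <= 0 -> v = 0.
Proof.
move=> H; apply/colP => i; rewrite mxE; apply/eqP; rewrite -cn_eq0 eq_le cn_ge0 andbT.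
exact: le_trans (cn_le_cnorm1 v i) H.
Qed.

Lemma cnorm1M r (A : 'M[R[i]]_r) (v : 'cV[R[i]]_r) (K : R) :
  (forall j, \sum_i cn (A i j) <= K) -> cnorm1 (A *m v) <= K * cnorm1 v.
Proof.
move=> H; apply: (@le_trans _ _ (\sum_i \sum_j cn (A i j) * cn (v j 0))).
  apply: ler_sum => i _; rewrite mxE; apply: le_trans (cn_sum _ _ _) _.
  by apply: ler_sum => j _; rewrite cnM.
rewrite exchange_big mulr_sumr; apply: ler_sum => j _ /=.
by rewrite -mulr_suml ler_wpM2r ?cn_ge0.
Qed.

(** A vector in the kernel satisfies v = - E v, hence has norm at most half of
    its own. *)
Lemma near_identity_unit r (E : 'M[R[i]]_r) :
  (forall j, \sum_i cn (E i j) <= 2^-1) -> 1%:M + E \in unitmx.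
Proof.
move=> HE; rewrite -unitmx_tr unitmxE unitfE; apply/negP => /det0P[v v0 Hv].
have : (1%:M + E) *m v^T = 0 by rewrite -[LHS]trmxK trmx_mul trmxK Hv trmx0.
rewrite mulmxDl mul1mx => /eqP; rewrite addrC addr_eq0 => /eqP Ev.
move/eqP: v0; apply; rewrite -[v]trmxK (@cnorm1_eq0 _ v^T) ?trmx0 //.
have := cnorm1M v^T HE.
have -> : cnorm1 (E *m v^T) = cnorm1 v^T.
  by rewrite Ev /cnorm1; apply: eq_bigr => i _; rewrite [in LHS]mxE cnN.
have := cnorm1_ge0 v^T; lra.
Qed.

(** Integration over [0, e] turns the group law into
    G(t + e) - G(t) = b(e) F(t), where G is an antiderivative of F and b one of
    B.  Since B is close to the identity, b(e) / e is invertible, so F is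
    differentiable and F' = b(e)^-1 (B(e) - 1) F. *)
Lemma group_generator r (F : 'I_r -> R -> R[i]) (B : R -> 'M[R[i]]_r) (e kap : R) :
  (forall i, ccontinuous (F i)) -> (forall i j, ccontinuous (fun s => B s i j)) ->
  (forall i s t, F i (t + s) = \sum_j B s i j * F j t) ->
  0 < e -> 4 * r%:R * kap <= 1 ->
  (forall s, 0 <= s <= e -> forall i j, cn (B s i j - (i == j)%:R) <= kap) ->
  exists L : 'M[R[i]]_r, (forall j, \sum_i cn (L i j) <= e^-1) /\
    forall i, cderiv (F i) (fun t => \sum_j L i j * F j t).
Proof.
move=> HF HB Hgrp e0 kap4 Hk.
have /choice[G HG] : forall i, exists G, cderiv G (F i).
  by move=> i; have [G ? _] := cantiderivative (HF i); exists G.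
have /choice[b Hb] : forall ij : 'I_r * 'I_r, exists b, cderiv b (fun s => B s ij.1 ij.2) /\ b 0 = 0.
  by move=> ij; have [b ? ?] := cantiderivative (HB ij.1 ij.2); exists b.
have int i t : G i (t + e) - G i t = \sum_j b (i, j) e * F j t.
  have H : cderiv (fun s => G i (s + t) - \sum_j F j t * b (i, j) s) (fun=> 0).
    have := cderivB (cderiv_shift t (HG i))
      (cderiv_sum (index_enum 'I_r) (fun j => F j t) (fun j => (Hb (i, j)).1)).
    apply: cderiv_ext => s //=; rewrite [s + t]addrC Hgrp.
    by apply/eqP; rewrite subr_eq0; apply/eqP; apply: eq_bigr => j _; rewrite mulrC.
  have := cderiv0_cst e H; rewrite add0r [X in _ = _ - X]big1 => [|j _]; last first.
    by rewrite (Hb (i, j)).2 mulr0.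
  rewrite subr0 => E; rewrite [t + e]addrC -E opprB [LHS]addrC subrK.
  by apply: eq_bigr => j _; rewrite mulrC.
pose ec : R[i] := e%:C.
have ec0 : ec != 0 by rewrite /ec (inj_eq (@complexI R) e 0) gt_eqF.
pose be := \matrix_(i < r, j < r) b (i, j) e.
pose E := \matrix_(i < r, j < r) (ec^-1 * (b (i, j) e - ec * (i == j)%:R)).
have beE : be = ec *: (1%:M + E).
  apply/matrixP => i j; rewrite !mxE; field.
  by [].
(* b(s) - s has derivative B(s) - 1 *)
have Ebound i j : cn (E i j) <= 2 * kap.
  rewrite mxE cnM cnV cn_real gtr0_norm // mulrC ler_pdivrMr //.
  have H : cderiv (fun s => b (i, j) s - (i == j)%:R * (s%:C)) (fun s => B s i j - (i == j)%:R).
    apply: cderivB; first exact: (Hb (i, j)).1.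
    have Hid : cderiv (fun s : R => s%:C) (fun=> 1).
      by move=> s; split; [exact: is_derive_id|exact: is_derive_cst].
    by have := cderivZ (i == j)%:R Hid; apply: cderiv_ext => s //; rewrite mulr1.
  have := cderiv_mean e0 H (fun s hs => Hk s hs i j).
  by rewrite (Hb (i, j)).2 mulr0 subr0 subr0 [_ * e%:C]mulrC.
have Ecol j : \sum_i cn (E i j) <= 2^-1.
  apply: (@le_trans _ _ (\sum_(i < r) 2 * kap)); first by apply: ler_sum.
  by rewrite sumr_const card_ord -mulr_natl; lra.
have U := near_identity_unit Ecol.
have Ube : be \in unitmx by rewrite beE unitmxZ ?unitfE.
pose L := invmx be *m (B e - 1%:M).
exists L; split=> [j|i].
- have EL : (1%:M + E) *m (ec *: L) = B e - 1%:M.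
    by rewrite -scalemxAr scalemxAl -beE /L mulKVmx.
  pose v := col j L.
  (* for a column v of L, by (1 + E) (e L) = B(e) - 1 the norm of e v is at
     most 1/4 + |e v| / 2 *)
  have Ev : ec *: v = col j (B e - 1%:M) - E *m (ec *: v).
    have -> : ec *: v = col j (ec *: L) by apply/colP => i; rewrite !mxE.
    rewrite -EL mulmxDl mul1mx; apply/colP => i; rewrite !mxE.
    rewrite [X in _ + X - _](_ : _ = \sum_j0 E i j0 * (col j (ec *: L)) j0 0); first by rewrite addrK.
    by apply: eq_bigr => k _; rewrite [col _ _ _ _]mxE.
  have nB : cnorm1 (col j (B e - 1%:M)) <= 4^-1.
    apply: (@le_trans _ _ (\sum_(i < r) kap)).
      by apply: ler_sum => i _; rewrite !mxE; apply: Hk; rewrite (ltW e0) lexx.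
    by rewrite sumr_const card_ord -mulr_natl; lra.
  have nE := cnorm1M (ec *: v) Ecol.
  have nS : cnorm1 (ec *: v) = e * cnorm1 v.
    rewrite /cnorm1 mulr_sumr; apply: eq_bigr => i _.
    by rewrite mxE cnM cn_real gtr0_norm.
  have : cnorm1 (ec *: v) <= cnorm1 (col j (B e - 1%:M)) + cnorm1 (E *m (ec *: v)).
    rewrite {1}Ev /cnorm1 -big_split /=; apply: ler_sum => i _.
    by rewrite mxE [X in cn (_ + X)]mxE; exact: cnB.
  have -> : \sum_i cn (L i j) = cnorm1 v by apply: eq_bigr => i _; rewrite [in RHS]mxE.
  rewrite nS in nE *; move=> h.
  rewrite -[e^-1]mul1r ler_pdivlMr // mulrC; lra.
- pose K := invmx be.
  have FE t : F i t = \sum_k K i k * (G k (t + e) - G k t).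
    transitivity ((K *m (be *m \col_j F j t)) i 0); first by rewrite mulKmx // mxE.
    rewrite mxE; apply: eq_bigr => k _; congr (_ * _).
    by rewrite int mxE; apply: eq_bigr => j _; rewrite !mxE.
  have H := cderiv_sum (index_enum 'I_r) (fun k => K i k)
    (fun k => cderivB (cderiv_shift e (HG k)) (HG k)).
  apply: cderiv_ext H => t; first by rewrite FE.
  transitivity ((K *m ((B e - 1%:M) *m \col_j F j t)) i 0).
    rewrite mxE; apply: eq_bigr => k _; congr (_ * _).
    rewrite mulmxBl mul1mx [RHS]mxE [X in _ = _ + X]mxE [X in _ = _ - X]mxE Hgrp.
    congr (_ - _); rewrite mxE.
    by apply: eq_bigr => j _; rewrite mxE.
  by rewrite mulmxA -[K *m _]/L mxE; apply: eq_bigr => j _; congr (_ * _); rewrite mxE.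
Qed.

(** The iterated derivatives at 0 are the entries of L^k F(0): they grow at most
    like the powers of the norm of L, and the characteristic polynomial of L
    annihilates them. *)
Lemma group_expansion r (F : 'I_r.+1 -> R -> R[i]) (B : R -> 'M[R[i]]_r.+1) (e kap M : R) :
  (forall i, ccontinuous (F i)) -> (forall i j, ccontinuous (fun s => B s i j)) ->
  (forall i s t, F i (t + s) = \sum_j B s i j * F j t) ->
  0 < e -> 4 * r.+1%:R * kap <= 1 ->
  (forall s, 0 <= s <= e -> forall i j, cn (B s i j - (i == j)%:R) <= kap) ->
  (forall i, cn (F i 0) <= M) ->
  forall i, exists u : nat -> R[i], [/\ geo (r.+1%:R * M) e^-1 u,
    forall t, F i t = egf u t &
    exists p : {poly R[i]}, [/\ p \is monic, size p = r.+2 & annihilates p u]].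
Proof.
move=> HF HB Hgrp e0 kap4 Hk HM i.
have [L [HL HdL]] := group_generator HF HB Hgrp e0 kap4 Hk.
pose Fv t : 'cV[R[i]]_r.+1 := \col_j F j t.
have ie0 : 0 <= e^-1 by rewrite invr_ge0 ltW.
have nL k (v : 'cV[R[i]]_r.+1) : cnorm1 (L ^+ k *m v) <= e^-1 ^+ k * cnorm1 v.
  elim: k => [|k IH]; first by rewrite expr0 mul1mx mul1r.
  rewrite !exprS -mulmxE -mulmxA; apply: le_trans (cnorm1M _ HL) _.
  by rewrite -mulrA ler_wpM2l.
pose psi k t := (L ^+ k *m Fv t) i 0.
have Hpsi k : cderiv (psi k) (psi k.+1).
  have := cderiv_sum (index_enum 'I_r.+1) (fun j => (L ^+ k) i j) HdL.
  apply: cderiv_ext => t; rewrite /psi.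
    by rewrite mxE; apply: eq_bigr => j _; rewrite [Fv _ _ _]mxE.
  rewrite exprSr -mulmxE -mulmxA mxE; apply: eq_bigr => j _; congr (_ * _).
  by rewrite mxE; apply: eq_bigr => l _; rewrite [Fv _ _ _]mxE.
pose u k := psi k 0.
have gu : geo (r.+1%:R * M) e^-1 u.
  split=> // k; apply: le_trans (cn_le_cnorm1 _ _) _.
  apply: le_trans (nL k _) _; rewrite mulrC ler_wpM2r ?exprn_ge0 //.
  apply: (@le_trans _ _ (\sum_(j < r.+1) M)).
    by apply: ler_sum => j _; rewrite mxE.
  by rewrite sumr_const card_ord mulr_natl.
exists u; split=> // [t|].
  have <- : psi 0%N t = F i t by rewrite /psi expr0 mul1mx mxE.
  apply: (@taylor_egf _ psi e^-1) => // T.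
  have /choice[m Hm] := fun j => ccontinuous_bounded T (HF j).
  exists (\sum_j m j) => k x xT; apply: le_trans (cn_le_cnorm1 _ _) _.
  apply: le_trans (nL k _) _; rewrite mulrC ler_wpM2r ?exprn_ge0 //.
  by apply: ler_sum => j _; rewrite mxE; exact: Hm.
exists (char_poly L); split; [exact: char_poly_monic|exact: size_char_poly|].
have H p k : shift_act p u k = (horner_mx L p *m (L ^+ k *m Fv 0)) i 0.
  elim/poly_ind: p k => [|p c IH] k.
    by rewrite rmorph0 mul0mx mxE /shift_act size_poly0 big_ord0.
  rewrite shift_actD shift_act_mulX IH shift_actC rmorphD rmorphM /= horner_mx_X horner_mx_C.
  rewrite mulmxDl mul_scalar_mx [RHS]mxE [X in _ = _ + X]mxE; congr (_ + _).
  by rewrite exprS -!mulmxE !mulmxA.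
by move=> k; rewrite H Cayley_Hamilton mul0mx mxE.
Qed.

End Group.

(** * Pointwise continuity and Schur complements *)

Section PointwiseContinuity.
Variable R : realType.
Variable T : topologicalType.
Implicit Types (F G : T -> R[i]) (x : T).

(** Stated with the real-valued modulus, in order to mix it with real estimates. *)
Definition cont_at F x := forall e : R, 0 < e -> \forall y \near x, cn (F y - F x) < e.

Lemma cont_at_cst (c : R[i]) x : cont_at (fun=> c) x.
Proof. by move=> e e0; near=> y; rewrite subrr cn0. Unshelve. all: by end_near. Qed.

Lemma cont_atD F G x : cont_at F x -> cont_at G x -> cont_at (fun y => F y + G y) x.
Proof.
move=> HF HG e e0; have e2 : 0 < e / 2 by rewrite divr_gt0.
have := HF _ e2; have := HG _ e2; apply: filterS2 => y h1 h2.
have -> : F y + G y - (F x + G x) = (F y - F x) + (G y - G x) by ring.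
by apply: le_lt_trans (cnD _ _) _; rewrite [e]splitr ltrD.
Qed.

Lemma cont_atM F G x : cont_at F x -> cont_at G x -> cont_at (fun y => F y * G y) x.
Proof.
move=> HF HG e e0.
pose K := cn (F x) + cn (G x) + 1.
have K0 : 0 < K by rewrite ltr_wpDl // addr_ge0 ?cn_ge0.
pose d := Num.min 1 (e / K).
have d0 : 0 < d by rewrite lt_min ltr01 divr_gt0.
have := HF _ d0; have := HG _ d0; apply: filterS2 => y hG hF.
have dK : d * K <= e by rewrite -ler_pdivlMr // /d ge_min lexx orbT.
have d1 : d <= 1 by rewrite /d ge_min lexx.
have -> : F y * G y - F x * G x =
  (F y - F x) * (G y - G x) + (F y - F x) * G x + F x * (G y - G x) by ring.
apply: le_lt_trans (cnD _ _) _; apply: le_lt_trans (lerD (cnD _ _) (lexx _)) _.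
rewrite !cnM; apply: lt_le_trans dK; rewrite /K.
have := cn_ge0 (F y - F x); have := cn_ge0 (G y - G x).
have := cn_ge0 (F x); have := cn_ge0 (G x) => h1 h2 h3 h4.
have e1 : cn (F y - F x) * cn (G y - G x) < d * 1.
  apply: (@le_lt_trans _ _ (cn (F y - F x) * 1)); last by rewrite !mulr1.
  by rewrite ler_wpM2l // (le_trans (ltW hG)).
have e2 : cn (F y - F x) * cn (G x) <= d * cn (G x) by rewrite ler_wpM2r // ltW.
have e3 : cn (F x) * cn (G y - G x) <= d * cn (F x) by rewrite mulrC ler_wpM2r // ltW.
lra.
Qed.

Lemma cont_at_sum (I : Type) (s : seq I) (P : pred I) (F : I -> T -> R[i]) x :
  (forall i, cont_at (F i) x) -> cont_at (fun y => \sum_(i <- s | P i) F i y) x.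
Proof.
move=> H; elim: s => [|i s IH].
  have -> : (fun y => \sum_(i <- [::] | P i) F i y) = (fun=> 0).
    by apply/funext => y; rewrite big_nil.
  exact: cont_at_cst.
have -> : (fun y => \sum_(i <- i :: s | P i) F i y) =
  (fun y => (if P i then F i y else 0) + \sum_(i <- s | P i) F i y).
  by apply/funext => y; rewrite big_cons; case: ifP => // _; rewrite add0r.
by apply: cont_atD => //; case: (P i); [exact: H|exact: cont_at_cst].
Qed.

Lemma cont_at_prod (I : Type) (s : seq I) (F : I -> T -> R[i]) x :
  (forall i, cont_at (F i) x) -> cont_at (fun y => \prod_(i <- s) F i y) x.
Proof.
move=> H; elim: s => [|i s IH].
  have -> : (fun y => \prod_(i <- [::]) F i y) = (fun=> 1).
    by apply/funext => y; rewrite big_nil.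
  exact: cont_at_cst.
have -> : (fun y => \prod_(i <- i :: s) F i y) =
  (fun y => F i y * \prod_(i <- s) F i y).
  by apply/funext => y; rewrite big_cons.
exact: cont_atM.
Qed.

Lemma cont_at_det n (M : T -> 'M[R[i]]_n) x :
  (forall i j, cont_at (fun y => M y i j) x) -> cont_at (fun y => \det (M y)) x.
Proof.
move=> H; apply: cont_at_sum => s; apply: cont_atM; first exact: cont_at_cst.
by apply: cont_at_prod.
Qed.

Lemma cont_at_adj n (M : T -> 'M[R[i]]_n) x :
  (forall i j, cont_at (fun y => M y i j) x) ->
  forall i j, cont_at (fun y => (\adj (M y)) i j) x.
Proof.
move=> H i j.
have -> : (fun y => (\adj (M y)) i j) = (fun y => cofactor (M y) j i).
  by apply/funext => y; rewrite mxE.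
apply: cont_atM; first exact: cont_at_cst.
apply: cont_at_det => k l.
have -> : (fun y => row' j (col' i (M y)) k l) = (fun y => M y (lift j k) (lift i l)).
  by apply/funext => y; rewrite !mxE.
exact: H.
Qed.

Lemma cont_at_near_gt F x (c : R) : cont_at F x -> c < cn (F x) ->
  \forall y \near x, c < cn (F y).
Proof.
move=> H cF; have d0 : 0 < cn (F x) - c by rewrite subr_gt0.
apply: filterS (H _ d0) => y h.
have : cn (F x) <= cn (F y) + cn (F y - F x).
  by rewrite -{1}[F x](subKr (F y)); apply: le_trans (cnB _ _) _; rewrite lexx.
lra.
Qed.

Lemma cont_at_near_neq0 F x : cont_at F x -> F x != 0 -> \forall y \near x, F y != 0.
Proof.
move=> H Fx; have c0 : 0 < cn (F x) by rewrite lt_neqAle eq_sym cn_eq0 Fx cn_ge0.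
by apply: filterS (cont_at_near_gt H c0) => y; apply: contraTneq => ->; rewrite cn0 ltxx.
Qed.

Lemma cont_at_near_le F x : cont_at F x -> \forall y \near x, cn (F y) <= cn (F x) + 1.
Proof.
move=> H; apply: filterS (H 1 ltr01) => y h.
have -> : F y = F x + (F y - F x) by ring.
by apply: le_trans (cnD _ _) _; rewrite lerD2l ltW.
Qed.

End PointwiseContinuity.

Lemma cont_at_comp (R : realType) (S T : topologicalType) (g : S -> T) (F : T -> R[i]) x :
  {for x, continuous g} -> cont_at F (g x) -> cont_at (fun y => F (g y)) x.
Proof. by move=> cg H e e0; exact: (cg _ (H e e0)). Qed.

Lemma ccontinuous_of_cont_at (R : realType) (F : R -> R[i]) : (forall x, cont_at F x) -> ccontinuous F.
Proof.
move=> H; split=> x; apply/cvgrPdist_lt => e e0; apply: filterS (H x e e0) => y h.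
- apply: le_lt_trans h; rewrite distrC.
  have -> : complex.Re (F y) - complex.Re (F x) = complex.Re (F y - F x).
    by case: (F y) (F x) => a b [c d].
  exact: cn_Re.
- apply: le_lt_trans h; rewrite distrC.
  have -> : complex.Im (F y) - complex.Im (F x) = complex.Im (F y - F x).
    by case: (F y) (F x) => a b [c d].
  exact: cn_Im.
Qed.

Lemma cont_at_of_continuous (R : realType) (T : topologicalType) (f : T -> R[i]) :
  continuous (f : T -> R[i]^o) -> forall x, cont_at f x.
Proof.
move=> cf x e e0; have := cf x => /cvgrPdist_lt/(_ e%:C).
rewrite ltcR => /(_ e0); apply: filterS => y.
by rewrite -cnBC -ltcR.
Qed.

Section Schur.
Variable F : fieldType.

(** The determinant of the bordered matrix is det M times the Schur complement
    d - b M^-1 c. *)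
Lemma bordered_singular r (M : 'M[F]_r) (c : 'cV[F]_r) (b : 'rV[F]_r) (d : F) :
  \det M != 0 -> \det (block_mx M c b d%:M) = 0 -> d = (b *m invmx M *m c) 0 0.
Proof.
move=> M0 /eqP/det0P[v v0].
rewrite -[v]hsubmxK mul_row_block => /eqP; rewrite -[0]hsubmxK => /eqP/eq_row_mx.
rewrite !linear0 => -[E1 E2].
set v1 := lsubmx v in E1 E2; set v2 := rsubmx v in E1 E2.
have UM : M \in unitmx by rewrite unitmxE unitfE.
have Ev1 : v1 = - (v2 *m b *m invmx M).
  by move/eqP: E1; rewrite addr_eq0 => /eqP E1; rewrite -[v1](mulmxK UM) E1 mulNmx.
have v20 : v2 0 0 != 0.
  apply: contraNneq v0 => E; have v2E : v2 = 0 by apply/rowP => i; rewrite ord1 E mxE.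
  by rewrite -[v]hsubmxK -/v1 -/v2 Ev1 v2E !mul0mx oppr0 row_mx0.
move: E2; rewrite Ev1 mulNmx => /eqP; rewrite addrC subr_eq0 => /eqP E2.
have v2s : v2 = (v2 0 0)%:M by rewrite [LHS]mx11_scalar.
move: E2; rewrite v2s !mul_scalar_mx -!scalemxAl => /matrixP/(_ 0 0).
rewrite [LHS]mxE [RHS]mxE => /(mulfI v20); rewrite mxE eqxx mulr1n => ->.
by [].
Qed.

End Schur.

(** * Vanishing minors and uniform expansions *)

Section Minors.
Variable R : realType.
Implicit Types (phi : R -> R[i]) (p q : nat -> R).

Definition node_mx phi r p q (s : R) : 'M[R[i]]_r := \matrix_(i < r, j < r) phi (p i + q j + s).

Definition minor phi r p q : R[i] := \det (node_mx phi r p q 0).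

(** The nonzero minor bordered by the row x and the column y is a minor of size
    r + 1. *)
Lemma schur_kernel phi r p q : (forall p q, minor phi r.+1 p q = 0) ->
  minor phi r p q != 0 -> forall x y,
  phi (x + y) =
  \sum_(j < r) (\sum_(k < r) phi (x + q k) * invmx (node_mx phi r p q 0) k j) * phi (p j + y).
Proof.
move=> H0 M0 x y.
pose c : 'cV[R[i]]_r := \col_j phi (p j + y).
pose b : 'rV[R[i]]_r := \row_k phi (x + q k).
have := @bordered_singular _ r (node_mx phi r p q 0) c b (phi (x + y)) M0.
have H1 : \det (block_mx (node_mx phi r p q 0) c b (phi (x + y))%:M) = 0.
  pose p' i := if (i < r)%N then p i else x.
  pose q' i := if (i < r)%N then q i else y.
  have := H0 p' q'; rewrite /minor -addn1 => <-; congr (\det _).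
  apply/matrixP => i j; rewrite [RHS]mxE addr0 /p' /q'.
  case: (split_ordP i) => i1 ->; case: (split_ordP j) => j1 ->.
  - by rewrite block_mxEul mxE addr0.
  - by rewrite block_mxEur mxE.
  - by rewrite block_mxEdl mxE.
  - by rewrite block_mxEdr mxE /= !ord1 eqxx.
move=> /(_ H1) ->; rewrite mxE; apply: eq_bigr => j _; rewrite [c _ _]mxE; congr (_ * _).
by rewrite mxE; apply: eq_bigr => k _; rewrite [b _ _]mxE.
Qed.

Lemma minor_shift phi r p q (d : R) :
  minor phi r p q = minor phi r (fun i => p i - d) (fun j => q j + d).
Proof. by congr (\det _); apply/matrixP => i j; rewrite !mxE; congr (phi _); ring. Qed.

(** The transition matrix B(s) - 1 = (M(s) - M(0)) M(0)^-1 is a quotient of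
    jointly continuous functions of the parameter and s, which vanishes at s = 0
    and whose denominator stays away from 0.  So one interval of s serves all
    parameters near th0, and the constants of group_expansion depend on this
    interval only. *)
Lemma uniform_expansion (T : topologicalType) (th0 : T) (Phi : T -> R -> R[i]) r p q :
  (forall th t, cont_at (Phi th) t) ->
  (forall t : R, cont_at (fun z : T * R => Phi z.1 (t + z.2)) (th0, 0)) ->
  (forall th p q, minor (Phi th) r.+2 p q = 0) ->
  p 0%N = 0 -> minor (Phi th0) r.+1 p q != 0 ->
  exists C A : R, 0 < A /\ \forall th \near th0, exists u : nat -> R[i],
    [/\ geo C A u, forall t, Phi th t = egf u t &
     exists P : {poly R[i]}, [/\ P \is monic, size P = r.+2 & annihilates P u]].
Proof.
move=> Hc Hj H0 p0 M0.
pose kap : R := (4 * r.+1%:R)^-1.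
have r0 : (0 : R) < 4 * r.+1%:R by rewrite mulr_gt0 // ltr0n.
have kap0 : 0 < kap by rewrite invr_gt0.
pose M th s := node_mx (Phi th) r.+1 p q s.
have cM i j : cont_at (fun z : T * R => M z.1 z.2 i j) (th0, 0).
  have -> : (fun z : T * R => M z.1 z.2 i j) = (fun z => Phi z.1 (p i + q j + z.2)).
    by apply/funext => z; rewrite mxE.
  exact: Hj.
have c0 : {for (th0, 0 : R), continuous (fun z : T * R => (z.1, 0 : R))}.
  move=> V [[A B] /= [hA hB] AB]; exists (A, setT) => /=.
    by split=> //; exact: filterT.
  by move=> [x y] [/= Ax _]; apply: AB; split=> //=; exact: nbhs_singleton hB.
have cM0 i j : cont_at (fun z : T * R => M z.1 0 i j) (th0, 0).
  exact: (cont_at_comp (g := fun z : T * R => (z.1, 0 : R)) (F := fun z => M z.1 z.2 i j) c0 (cM i j)).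
pose D th := \det (M th 0).
have cD : cont_at (fun z : T * R => D z.1) (th0, 0) by apply: cont_at_det.
have D0 : 0 < cn (D th0) by rewrite lt_neqAle eq_sym cn_eq0 M0 cn_ge0.
pose c := cn (D th0) / 2.
have cp : 0 < c by rewrite divr_gt0.
have near1 : \forall z \near (th0, 0 : R), c < cn (D z.1).
  by apply: (cont_at_near_gt cD); rewrite /c ltr_pdivrMr // ltr_pMr // ltr1n.
pose N z i j : R[i] := \sum_k (M z.1 z.2 i k - M z.1 0 i k) * (\adj (M z.1 0)) k j.
have cN i j : cont_at (fun z => N z i j) (th0, 0).
  apply: cont_at_sum => k; apply: cont_atM; last exact: cont_at_adj.
  apply: cont_atD => //; have := cont_atM (cont_at_cst (-1) _) (cM0 i k).
  by under eq_fun do rewrite mulN1r.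
have N00 i j : N (th0, 0) i j = 0.
  by rewrite /N big1 // => k _; rewrite subrr mul0r.
have near2 : \forall z \near (th0, 0 : R), forall ij : 'I_r.+1 * 'I_r.+1,
    cn (N z ij.1 ij.2) < kap * c.
  apply: (@filter_forall _ _ (fun (ij : 'I_r.+1 * 'I_r.+1) (z : T * R) =>
    cn (N z ij.1 ij.2) < kap * c) (nbhs (th0, 0 : R))) => ij.
  have := cN ij.1 ij.2 (kap * c); rewrite mulr_gt0 // => /(_ isT).
  by apply: filterS => z; rewrite N00 subr0.
have near3 : \forall z \near (th0, 0 : R), forall i : 'I_r.+1,
    cn (Phi z.1 (p i)) <= cn (Phi th0 (p i)) + 1.
  apply: (@filter_forall _ _ (fun (i : 'I_r.+1) (z : T * R) =>
    cn (Phi z.1 (p i)) <= cn (Phi th0 (p i)) + 1) (nbhs (th0, 0 : R))) => i.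
  have := cont_at_near_le (Hj (p i)); rewrite addr0 => h.
  have := cont_at_near_le (cont_at_comp (g := fun z : T * R => (z.1, 0 : R))
    (F := fun z => Phi z.1 (p i + z.2)) c0 (Hj (p i))).
  by apply: filterS => z /=; rewrite !addr0.
have [[A B] /= [hA hB] AB] := filterI near1 (filterI near2 near3).
have /nbhs_ballP[e /= e0 He] := hB.
pose C0 := \sum_(i < r.+1) (cn (Phi th0 (p i)) + 1).
have C0i (i : 'I_r.+1) : cn (Phi th0 (p i)) + 1 <= C0.
  rewrite /C0 (bigD1 i) //= lerDl; apply: sumr_ge0 => j _.
  by rewrite addr_ge0 ?cn_ge0.
have e20 : 0 < e / 2 by rewrite divr_gt0.
exists (r.+1%:R * C0), (e / 2)^-1; split; first by rewrite invr_gt0.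
apply: filterS hA => th Ath.
have all s : 0 <= s <= e / 2 -> [/\ c < cn (D th),
   forall i j, cn (N (th, s) i j) < kap * c &
   forall i : 'I_r.+1, cn (Phi th (p i)) <= cn (Phi th0 (p i)) + 1].
  move=> /andP[s0 se].
  have Bs : B s.
    apply: He; rewrite /ball /= sub0r normrN ger0_norm //.
    by apply: le_lt_trans se _; rewrite ltr_pdivrMr // ltr_pMr // ltr1n.
  have [] := AB (th, s) (conj Ath Bs); move=> h1 [h2 h3]; split=> // i j.
  exact: (h2 (i, j)).
have [Dth _ Pb] := all 0 (introT andP (conj (lexx 0) (ltW e20))).
have Mth : minor (Phi th) r.+1 p q != 0.
  by apply: contraTneq Dth => E; rewrite (E : D th = 0) cn0 -leNgt ltW.
have U : M th 0 \in unitmx by rewrite unitmxE unitfE.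
pose F (i : 'I_r.+1) t := Phi th (p i + t).
pose Bm s := M th s *m invmx (M th 0).
have shc (s t : R) : cont_at (fun x => Phi th (s + x)) t.
  apply: (@cont_at_comp _ _ _ (fun x : R => s + x) (Phi th) t); last exact: Hc.
  by apply: cvgD; [exact: cvg_cst|exact: cvg_id].
have HF i : ccontinuous (F i) by apply: ccontinuous_of_cont_at => t; exact: shc.
have HB i j : ccontinuous (fun s => Bm s i j).
  apply: ccontinuous_of_cont_at => s.
  have -> : (fun s => Bm s i j) =
    (fun s => \sum_(k < r.+1) Phi th (p i + q k + s) * invmx (M th 0) k j).
    by apply/funext => x; rewrite mxE; apply: eq_bigr => k _; rewrite mxE.
  by apply: cont_at_sum => k; apply: cont_atM; [exact: shc|exact: cont_at_cst].
have Hg i s t : F i (t + s) = \sum_j Bm s i j * F j t.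
  rewrite /F (_ : p i + (t + s) = (p i + s) + t); last by ring.
  rewrite (schur_kernel (H0 th) Mth); apply: eq_bigr => j _; congr (_ * _).
  rewrite mxE; apply: eq_bigr => k _; congr (_ * _).
  by rewrite mxE; congr (Phi th _); ring.
have Hk s : 0 <= s <= e / 2 -> forall i j, cn (Bm s i j - (i == j)%:R) <= kap.
  move=> /all[_ hN _] i j.
  have -> : Bm s i j - (i == j)%:R = (D th)^-1 * N (th, s) i j.
    have -> : (i == j)%:R = (M th 0 *m invmx (M th 0)) i j by rewrite mulmxV // mxE.
    rewrite /Bm /invmx U !mxE -sumrB mulr_sumr; apply: eq_bigr => k _.
    by rewrite !mxE; rewrite /D; ring.
  rewrite cnM cnV mulrC ler_pdivrMr; last exact: lt_trans Dth.
  by apply: le_trans (ltW (hN i j)) _; rewrite ler_pM2l // ltW.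
have HM i : cn (F i 0) <= C0.
  by rewrite /F addr0; apply: le_trans (Pb i) _; exact: C0i.
have kap4 : 4 * r.+1%:R * kap <= 1 by rewrite /kap mulfV // gt_eqF.
have [u [gu Eu HP]] := group_expansion HF HB Hg e20 kap4 Hk HM ord0.
exists u; split=> // t; rewrite -Eu /F.
by rewrite (_ : p (ord0 : 'I_r.+1) = 0) ?add0r.
Qed.

End Minors.

(** * Restrictions to lines *)

Section Lines.
Variable R : realType.
Implicit Types (phi : R -> R[i]) (p q : nat -> R).

Lemma maximal_rank (vanish : nat -> Prop) n : ~ vanish 0%N -> vanish n ->
  exists r, [/\ (r < n)%N, vanish r.+1 & ~ vanish r].
Proof.
move=> H0; elim: n => [//|n IH] Hn.
have [/IH[r [rn h1 h2]]|h] := pselect (vanish n).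
  by exists r; split=> //; exact: ltnW.
by exists n; split.
Qed.

Lemma minor0 phi p q : minor phi 0 p q <> 0.
Proof. by rewrite /minor det_mx00; apply/eqP; exact: oner_neq0. Qed.

(** The normalisation p 0 = 0 makes phi itself the first of the functions
    phi (p i + t). *)
Lemma not_forall_minor phi r : ~ (forall p q, minor phi r p q = 0) ->
  exists p q, p 0%N = 0 /\ minor phi r p q != 0.
Proof.
move=> /existsNP[p /existsNP[q /eqP H]].
exists (fun i => p i - p 0%N), (fun j => q j + p 0%N); split; first by rewrite subrr.
by rewrite -minor_shift.
Qed.

Lemma annihilates_pad (F : fieldType) (P : {poly F}) (u : nat -> F) r n :
  P \is monic -> size P = r.+1 -> annihilates P u -> (r <= n)%N ->
  exists P' : {poly F}, [/\ P' \is monic, size P' = n.+1 & annihilates P' u].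
Proof.
move=> mP sP aP rn; exists ('X^(n - r) * P); split.
- by rewrite monicMl ?monicXn.
- by rewrite size_monicM ?monicXn // -?size_poly_eq0 ?sP // size_polyXn /= addnS subnK.
- exact: annihilates_mull.
Qed.

Lemma line_expansion phi n : (forall t, cont_at phi t) ->
  (forall p q, minor phi n.+1 p q = 0) ->
  exists (C A : R) (u : nat -> R[i]), [/\ geo C A u, forall t, phi t = egf u t &
     exists P : {poly R[i]}, [/\ P \is monic, size P = n.+1 & annihilates P u]].
Proof.
move=> cphi H.
have [|r [rn H1 H2]] := @maximal_rank (fun r => forall p q, minor phi r p q = 0) n.+1 _ H.
  by move=> /(_ (fun=> 0) (fun=> 0)); exact: minor0.
case: r rn H1 H2 => [|r] rn H1 H2.
  exists 0, 1, (fun=> 0); split; first exact: geo0.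
    move=> t; rewrite egf0; have := H1 (fun=> t) (fun=> 0).
    by rewrite /minor det_mx11 mxE !addr0.
  exists 'X^n; split; [exact: monicXn|exact: size_polyXn|].
  by move=> k; apply: shift_act_eq0.
have [p [q [p0 M0]]] := not_forall_minor H2.
have Hj t : cont_at (fun z : R * R => phi (t + z.2)) (0, 0).
  apply: (@cont_at_comp _ _ _ (fun z : R * R => t + z.2) phi); last exact: cphi.
  by apply: cvgD; [exact: cvg_cst|exact: cvg_snd].
have [C [A [A0 HC]]] := @uniform_expansion R R 0 (fun _ => phi) r p q
  (fun _ => cphi) Hj (fun _ => H1) p0 M0.
have [u [gu Eu [P [mP sP aP]]]] := nbhs_singleton HC.
by exists C, A, u; split=> //; exact: (annihilates_pad mP sP aP rn).
Qed.

(** The multiple of h next below x; the value at h = 0 makes it continuous there. *)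
Definition rounded (x h : R) : R := if h == 0 then x else (Num.floor (x / h))%:~R * h.

Lemma cont_at_rounded phi (x y : R) : (forall t, cont_at phi t) ->
  cont_at (fun h : R => phi (rounded x h + rounded y h)) 0.
Proof.
move=> cphi; apply: (@cont_at_comp _ _ _ (fun h : R => rounded x h + rounded y h) phi); last exact: cphi.
have cr z : {for 0, continuous (rounded z)}.
  apply/cvgrPdist_le => e e0; exists e => //= h; rewrite /= sub0r normrN => he.
  rewrite /rounded eqxx; case: eqVneq => [_|h0]; first by rewrite subrr normr0 ltW.
  have -> : z - (Num.floor (z / h))%:~R * h = (z / h - (Num.floor (z / h))%:~R) * h.
    by rewrite mulrBl divfK.
  rewrite normrM; apply: le_trans (ltW he); rewrite ler_piMl //.
  have /andP[f1 f2] := floor_itv (z / h); rewrite ger0_norm ?subr_ge0 //.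
  by rewrite intrD in f2; rewrite lerBlDl; exact: ltW f2.
exact: cvgD (cr x) (cr y).
Qed.

(** For h nonzero the rounded nodes lie on the lattice h Z, where minors_of_hankel
    applies; let h tend to 0. *)
Lemma minors_of_equispaced phi N : (forall t, cont_at phi t) ->
  (forall x h : R, \det (\matrix_(i < N, j < N) phi (x + (i + j)%:R * h)) = 0) ->
  forall p q, minor phi N p q = 0.
Proof.
move=> cphi H p q.
pose D h := \det (\matrix_(i < N, j < N) phi (rounded (p i) h + rounded (q j) h)).
have -> : minor phi N p q = D 0.
  congr (\det _); apply/matrixP => i j; rewrite !mxE /rounded eqxx addr0 //.
have Dh h : h != 0 -> D h = 0.
  move=> h0; have Hh m : hankel_det (fun k : int => phi (k%:~R * h)) N m = 0.
    rewrite -[RHS](H (m%:~R * h) h); congr (\det _); apply/matrixP => i j.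
    by rewrite !mxE rmorphD mulrDl.
  have := minors_of_hankel Hh (fun i : 'I_N => Num.floor (p i / h)) (fun i : 'I_N => Num.floor (q i / h)).
  move=> <-; congr (\det _); apply/matrixP => i j.
  by rewrite !mxE /rounded (negPf h0) rmorphD mulrDl.
have cD : cont_at D 0.
  apply: cont_at_det => i j.
  have -> : (fun h : R => (\matrix_(i < N, j < N) phi (rounded (p i) h + rounded (q j) h)) i j) =
    (fun h => phi (rounded (p i) h + rounded (q j) h)) by apply/funext => h; rewrite mxE.
  exact: cont_at_rounded.
apply/eqP/negPn/negP => D0.
have [e /= e0 He] := cont_at_near_neq0 cD D0.
have := He (e / 2); rewrite /= sub0r normrN gtr0_norm ?divr_gt0 //.
rewrite ltr_pdivrMr // ltr_pMr // ltr1n => /(_ isT).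
by rewrite Dh ?eqxx // gt_eqF // divr_gt0.
Qed.

End Lines.

Section Space.
Variables (R : realType) (V : normedModType R) (f : V -> R[i]).
Hypothesis cf : forall x, cont_at f x.

Definition on_line (x h : V) (t : R) : R[i] := f (x + t *: h).

Lemma cont_at_on_line x h t : cont_at (on_line x h) t.
Proof.
apply: (@cont_at_comp _ _ _ (fun t : R => x + t *: h) f); last exact: cf.
by apply: cvgD; [exact: cvg_cst|apply: cvgZr_tmp; exact: cvg_id].
Qed.

(** Base point and direction vary near (x0, u), where the minor stays nonzero. *)
Lemma plane_uniform r p q (x0 u v : V) :
  (forall x h p q, minor (on_line x h) r.+2 p q = 0) -> p 0%N = 0 ->
  minor (on_line x0 u) r.+1 p q != 0 ->
  exists C A d : R, [/\ 0 < A, 0 < d & forall s a b : R,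
    `|s| <= d -> `|a| <= d -> `|b| <= d ->
    exists w : nat -> R[i], geo C A w /\
      forall t, on_line (x0 + s *: u) ((1 + a) *: u + b *: v) t = egf w t].
Proof.
move=> H0 p0 M0.
pose Phi (th : R * R * R) t :=
  on_line (x0 + th.1.1 *: u) ((1 + th.1.2) *: u + th.2 *: v) t.
have Hj (t : R) : cont_at (fun z : R * R * R * R => Phi z.1 (t + z.2)) (0, 0, 0, 0).
  apply: (@cont_at_comp _ _ _ (fun z : R * R * R * R => x0 + z.1.1.1 *: u +
    (t + z.2) *: ((1 + z.1.1.2) *: u + z.1.2 *: v)) f); last exact: cf.
  have h2 : (fun z : R * R * R * R => z.2) @ ((0 : R), (0 : R), (0 : R), (0 : R)) --> (0 : R) by exact: cvg_snd.
  have h1 : (fun z : R * R * R * R => z.1) @ ((0 : R), (0 : R), (0 : R), (0 : R)) --> ((0 : R), (0 : R), (0 : R)).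
    exact: cvg_fst.
  have h12 : (fun z : R * R * R * R => z.1.2) @ ((0 : R), (0 : R), (0 : R), (0 : R)) --> (0 : R).
    exact: (cvg_comp _ _ h1 cvg_snd).
  have h11 : (fun z : R * R * R * R => z.1.1) @ ((0 : R), (0 : R), (0 : R), (0 : R)) --> ((0 : R), (0 : R)).
    exact: (cvg_comp _ _ h1 cvg_fst).
  have h112 : (fun z : R * R * R * R => z.1.1.2) @ ((0 : R), (0 : R), (0 : R), (0 : R)) --> (0 : R).
    exact: (cvg_comp _ _ h11 cvg_snd).
  have h111 : (fun z : R * R * R * R => z.1.1.1) @ ((0 : R), (0 : R), (0 : R), (0 : R)) --> (0 : R).
    exact: (cvg_comp _ _ h11 cvg_fst).
  apply: cvgD.
    by apply: cvgD; [exact: cvg_cst|apply: cvgZr_tmp h111].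
  apply: cvgZ; first by apply: cvgD; [exact: cvg_cst|exact: h2].
  apply: cvgD; last exact: cvgZr_tmp h12.
  by apply: cvgZr_tmp; apply: cvgD; [exact: cvg_cst|exact: h112].
have P0 : Phi (0, 0, 0) = on_line x0 u.
  by apply/funext => t; rewrite /Phi /on_line /= scale0r !addr0 scale1r scale0r addr0.
rewrite -P0 in M0.
have [C [A [A0 HC]]] := @uniform_expansion R (R * R * R)%type (0, 0, 0) Phi r p q
  (fun th t => cont_at_on_line _ _ _) Hj (fun th => H0 _ _) p0 M0.
have /nbhs_ballP[e /= e0 He] := HC.
exists C, A, (e / 2); split=> //; first by rewrite divr_gt0.
have e2 : e / 2 < e by rewrite ltr_pdivrMr // ltr_pMr // ltr1n.
move=> s a b sd ad bd.
have [|w [gw Ew _]] := He (s, a, b); last by exists w.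
by split=> /=; [split=> /=|]; rewrite /ball /= sub0r normrN; apply: le_lt_trans e2.
Qed.

End Space.

(** * Power series on planes *)

Section Cone.
Variable R : realType.
Variables (g : R -> R -> R[i]) (C A d : R).
Hypotheses (d0 : 0 < d) (A0 : 0 <= A).
Hypothesis strip : forall s, `|s| <= d ->
  exists al, geo C A al /\ forall t, g s t = egf al t.
Hypothesis rays : forall m, 0 <= m <= 1 ->
  exists be, geo C A be /\ forall s, g s (s * m) = egf be s.

(** At abscissa s the points of the rays lie on one vertical segment, where g has a
    Taylor expansion with bounds uniform in s.  Weights with vanishing moments up
    to order k kill its first k + 1 terms, so the weighted sum of the ray
    expansions is O(s^(k+1)). *)
Lemma weighted_rays (be : R -> nat -> R[i]) (k : nat) (ws : seq (R[i] * R)) :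
  (forall m, geo C A (be m)) ->
  (forall x, x \in ws -> 0 <= x.2 <= 1) ->
  (forall m s, 0 <= m <= 1 -> g s (s * m) = egf (be m) s) ->
  (forall i, (i <= k)%N -> \sum_(x <- ws) x.1 * (x.2 ^+ i)%:C = 0) ->
  \sum_(x <- ws) x.1 * be x.2 k = 0.
Proof.
move=> gbe ws01 Hbe mom; have C0 := geo_C_ge0 (gbe 0).
pose S := \sum_(x <- ws) cn x.1.
have S0 : 0 <= S by apply: sumr_ge0 => x _; exact: cn_ge0.
pose psi i := \sum_(x <- ws) x.1 * be x.2 i.
have gpsi : geo (S * C) A psi.
  split=> // i; apply: le_trans (cn_sum _ _ _) _; rewrite -mulrA mulr_suml.
  by apply: ler_sum => x _; rewrite cnM ler_wpM2l ?cn_ge0 //; case: (gbe x.2).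
pose d' := Num.min 1 d.
have d'0 : 0 < d' by rewrite lt_min ltr01.
have Hsmall s : 0 < s -> s <= d' ->
    cn (egf psi s) <= S * (2 * C * (A ^+ k.+1 * expR A)) * s ^+ k.+1.
  move=> s0; rewrite le_min => /andP[s1 sd].
  have [|al [gal Eal]] := @strip s; first by rewrite gtr0_norm.
  rewrite /psi (egf_sum _ (fun x => x.1) s C0 A0 (fun x : R[i] * R => gbe x.2)).
  have E0 : \sum_(x <- ws) x.1 * egf_psum al (s * x.2) k.+1 = 0.
    under eq_bigr do rewrite /egf_psum mulr_sumr.
    rewrite exchange_big big1 //= => i _.
    have -> : \sum_(x <- ws) x.1 * (al i * ((s * x.2) ^+ i / i`!%:R)%:C) =
      al i * (s ^+ i / i`!%:R)%:C * \sum_(x <- ws) x.1 * (x.2 ^+ i)%:C.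
      rewrite mulr_sumr; apply: eq_bigr => x _.
      rewrite exprMn [_ * _ ^+ _]mulrC -[X in X%:C]mulrA rmorphM; ring.
    by rewrite mom ?mulr0 // -ltnS.
  rewrite -[X in cn X]subr0 -[X in _ - X]E0 -sumrB.
  apply: le_trans (cn_sum _ _ _) _; rewrite -mulrA mulr_suml.
  rewrite [leLHS]big_seq [leRHS]big_seq; apply: ler_sum => x xw.
  rewrite -mulrBr cnM ler_wpM2l ?cn_ge0 //.
  have /andP[x0 x1] := ws01 x xw.
  rewrite -Hbe ?x0 // Eal; apply: le_trans (egf_tail _ _ gal) _.
  rewrite /egf_rest -[leRHS]mulrA ler_wpM2l ?mulr_ge0 //.
  have sx0 : 0 <= s * x.2 by rewrite mulr_ge0 // ltW.
  have sx : s * x.2 <= s by rewrite ler_piMr // ltW.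
  rewrite ger0_norm // exprMn -!mulrA ler_wpM2l ?exprn_ge0 //.
  rewrite [expR A * _]mulrC; apply: ler_pM.
  - exact: exprn_ge0.
  - by rewrite mulr_ge0 ?invr_ge0 ?expR_ge0.
  - by apply: lerXn2r; rewrite ?nnegrE // ltW.
  rewrite -[leRHS]mul1r; apply: ler_pM; rewrite ?invr_ge0 ?expR_ge0 //.
    by rewrite invf_le1 ?ltr0n ?fact_gt0 // ler1n fact_gt0.
  by rewrite ler_expR ler_piMr // (le_trans sx).
exact: (egf_vanishing_order gpsi d'0 Hsmall (leqnn k)).
Qed.

(** The k-th coefficient along the ray of slope m agrees with its interpolation
    polynomial of degree k at the nodes: the weights given by Lagrange
    interpolation, together with -1 at m, have vanishing moments.  The norms of
    the Lagrange polynomials cost the factor 16^k. *)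
Lemma cone_expansion : exists (a : nat -> nat -> R[i]), geo2 C (16 * A) a /\
  forall s m, 0 <= m <= 1 -> g s (s * m) = egf (fun i => egf (a i) (s * m)) s.
Proof.
have C0 : 0 <= C.
  by have [|al [gal _]] := @strip 0; [rewrite normr0 ltW|exact: geo_C_ge0 gal].
have /choice[be Hbe] : forall m, exists be, geo C A be /\
    (0 <= m <= 1 -> forall s, g s (s * m) = egf be s).
  move=> m; have [hm|hm] := boolP (0 <= m <= 1).
    by have [be [gb Eb]] := rays hm; exists be.
  by exists (fun=> 0); split=> //; split=> // k; rewrite cn0 mulr_ge0 ?exprn_ge0.
have gbe m : geo C A (be m) := (Hbe m).1.
have Ebe m s : 0 <= m <= 1 -> g s (s * m) = egf (be m) s by move=> hm; exact: (Hbe m).2.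
pose ell k := projT1 (cid (lagrange_equispaced R k)).
have Hell k := projT2 (cid (lagrange_equispaced R k)).
pose Q k : {poly R[i]} := \sum_(j < k.+1) be (node R k j) k *: ell k j.
have sQ k : (size (Q k) <= k.+1)%N.
  apply: (leq_trans (size_sum _ _ _)); apply/bigmax_leqP => j _.
  apply: leq_trans (size_scale_leq _ _) _.
  by have [_ h _] := Hell k; exact: h.
have nQ k : pnorm (Q k) <= C * A ^+ k * 16 ^+ k.
  apply: le_trans (pnorm_sum _ _ _) _.
  apply: le_trans (_ : _ <= \sum_(j < k.+1) C * A ^+ k * pnorm (ell k j)) _.
    apply: ler_sum => j _; rewrite pnormZ ler_wpM2r ?pnorm_ge0 //.
    by case: (gbe (node R k j)).
  rewrite -mulr_sumr ler_wpM2l ?mulr_ge0 ?exprn_ge0 //.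
  by have [_ _ h] := Hell k.
have QE k m : 0 <= m <= 1 -> (Q k).[m%:C] = be m k.
  move=> hm.
  (* interpolation weights at the nodes, against the value at m *)
  pose ws : seq (R[i] * R) := (-1, m) ::
    [seq ((ell k j).[m%:C], node R k j) | j <- enum 'I_k.+1].
  have H1 x : x \in ws -> 0 <= x.2 <= 1.
    by rewrite inE => /orP[/eqP->//|/mapP[j _ ->]] /=; exact: node_itv.
  have H2 i : (i <= k)%N -> \sum_(x <- ws) x.1 * (x.2 ^+ i)%:C = 0.
    move=> ik; rewrite big_cons big_map big_enum /=.
    have [h _ _] := Hell k.
    have := h 'X^i; rewrite size_polyXn ltnS => /(_ ik) E.
    have := congr1 (fun P : {poly R[i]} => P.[m%:C]) E.
    rewrite hornerXn horner_sum => {}E.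
    rewrite rmorphXn /= E mulN1r addrC; apply/eqP; rewrite subr_eq0; apply/eqP.
    by apply: eq_bigr => j _; rewrite hornerZ hornerXn mulrC rmorphXn.
  have := weighted_rays gbe H1 (fun m s hm => Ebe m s hm) H2.
  rewrite big_cons big_map big_enum /= mulN1r addrC => /eqP.
  rewrite subr_eq0 => /eqP <-; rewrite /Q horner_sum.
  by apply: eq_bigr => j _; rewrite hornerZ mulrC.
pose a i j := (Q (i + j)%N)`_j * (((i`! * j`!)%:R / (i + j)`!%:R) : R)%:C.
have ga : geo2 C (16 * A) a.
  split=> [|i j]; first by rewrite mulr_ge0.
  rewrite /a cnM cn_real ger0_norm; last by rewrite divr_ge0.
  apply: (@le_trans _ _ (cn (Q (i + j)%N)`_j * 1)).
    rewrite ler_wpM2l ?cn_ge0 // ler_pdivrMr ?ltr0n ?fact_gt0 // mul1r ler_nat.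
    by rewrite -(bin_fact (leq_addr j i)) addKn leq_pmull // bin_gt0 leq_addr.
  rewrite mulr1; apply: le_trans (coef_le_pnorm _ _) _; apply: le_trans (nQ _) _.
  by rewrite exprMn mulrA mulrAC.
exists a; split=> // s m hm.
rewrite (Ebe m s hm); have := egf_line 1 m s ga; rewrite mulr1 => ->.
apply: eq_egf => k.
rewrite -QE // (horner_coef_wide _ (sQ k)) /antidiag; apply: eq_bigr => j _.
have jk : (j <= k)%N by rewrite -ltnS.
rewrite /a subnK // expr1n mul1r.
rewrite -(rmorph_nat (real_complex R)).
have -> : 'C(k, j)%:R%:C * m%:C ^+ j * ((Q k)`_j * (((k - j)`! * j`!)%:R / k`!%:R)%:C) =
  (Q k)`_j * m%:C ^+ j * ('C(k, j)%:R * (((k - j)`! * j`!)%:R / k`!%:R))%:C :> R[i].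
  by rewrite rmorphM; ring.
rewrite mulrA -natrM [((k - j)`! * _)%N]mulnC bin_fact // divff ?mulr1 //.
Qed.

End Cone.

Section Extend.
Variable R : realType.

(** The line through (2, 1), a point inside the cone 0 <= t <= s, and any (s, t)
    stays in the cone near (2, 1); both sides are exponential generating
    functions along it, hence agree up to (s, t). *)
Lemma plane_extension (g : R -> R -> R[i]) (a : nat -> nat -> R[i]) C A :
  geo2 C A a ->
  (forall s0 t0 s1 t1, exists C A u, geo C A u /\
     forall c, g (s0 + c * s1) (t0 + c * t1) = egf u c) ->
  (forall s m, 0 <= m <= 1 -> g s (s * m) = egf (fun i => egf (a i) (s * m)) s) ->
  forall s t, g s t = egf (fun i => egf (a i) t) s.
Proof.
move=> ga Hl Hcone s t.
have [Cu [Au [u [gu Eu]]]] := Hl 2 1 (s - 2) (t - 1).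
pose w1 := s - 2; pose w2 := t - 1.
have gb := geo2_recenter 2 1 ga.
have Eb c : egf (fun i => egf (a i) (1 + c * w2)) (2 + c * w1) =
  egf (antidiag (recenter2 a 2 1) w1%:C w2%:C) c.
  by rewrite (egf2D _ _ _ _ ga) (egf_line _ _ _ gb).
(* along c <= d both coordinates of (2, 1) move by at most 1/2 *)
pose d := (2 * (`|w1| + `|w2| + 1))^-1.
have D0 : 0 < 2 * (`|w1| + `|w2| + 1) by rewrite mulr_gt0 // ltr_wpDl // addr_ge0.
have d0 : 0 < d by rewrite invr_gt0.
have E : u =1 antidiag (recenter2 a 2 1) w1%:C w2%:C.
  apply: (egf_inj gu (geo_antidiag _ _ gb) d0) => c c0 cd.
  rewrite -Eu -Eb -/w1 -/w2.
  have cB : c * (2 * (`|w1| + `|w2| + 1)) <= 1 by rewrite -ler_pdivlMr // mul1r.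
  have n1 : `|c * w1| <= c * (`|w1| + `|w2| + 1).
    by rewrite normrM gtr0_norm // ler_pM2l //; have := normr_ge0 w2; lra.
  have n2 : `|c * w2| <= c * (`|w1| + `|w2| + 1).
    by rewrite normrM gtr0_norm // ler_pM2l //; have := normr_ge0 w1; lra.
  have {}n1 : `|c * w1| <= 2^-1 by lra.
  have {}n2 : `|c * w2| <= 2^-1 by lra.
  move: n1 n2; rewrite !ler_norml => /andP[a1 a2] /andP[b1 b2].
  have s0 : 0 < 2 + c * w1 by lra.
  have -> : 1 + c * w2 = (2 + c * w1) * ((1 + c * w2) / (2 + c * w1)).
    by rewrite [RHS]mulrC divfK // gt_eqF.
  apply: Hcone; apply/andP; split; first by rewrite divr_ge0 //; lra.
  by rewrite ler_pdivrMr // mul1r; lra.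
have := Eu 1; rewrite !mul1r !subrKC => ->.
have := Eb 1; rewrite !mul1r !subrKC => ->.
exact: eq_egf.
Qed.

End Extend.

(** * Recurrences along lines of variable slope *)

Section SizeBounds.
Variable F : fieldType.

Lemma size_mul_le (p q : {poly F}) a b :
  (size p <= a.+1)%N -> (size q <= b.+1)%N -> (size (p * q)%R <= (a + b).+1)%N.
Proof.
move=> pa qb; apply: leq_trans (size_polyMleq _ _) _.
by move: pa qb; case: (size p) (size q) => [|m] [|n] /=; lia.
Qed.

Lemma size_sum_le (I : Type) (s : seq I) (P : pred I) (p : I -> {poly F}) a :
  (forall i, P i -> (size (p i) <= a)%N) -> (size (\sum_(i <- s | P i) p i)%R <= a)%N.
Proof.
move=> H; elim/big_rec: _ => [|i q Pi IH]; first by rewrite size_poly0.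
by apply: leq_trans (size_polyD _ _) _; rewrite geq_max H.
Qed.

Lemma size_det_le n (M : 'M[{poly F}]_n) s :
  (forall i j, (size (M i j) <= s.+1)%N) -> (size (\det M) <= (n * s).+1)%N.
Proof.
move=> H; apply: size_sum_le => w _.
have -> : (n * s).+1 = (0 + n * s).+1 by [].
apply: size_mul_le; first by rewrite -signr_odd; case: (odd _); rewrite ?expr1 ?expr0 ?size_polyN size_poly1.
rewrite -[X in (X * s)%N]card_ord -sum_nat_const.
elim/big_rec2: _ => [|i m p _ IH]; first by rewrite size_poly1.
exact: size_mul_le.
Qed.

Lemma size_adj_le n (M : 'M[{poly F}]_n) s :
  (forall i j, (size (M i j) <= s.+1)%N) ->
  forall i j, (size ((\adj M) i j) <= (n * s).+1)%N.
Proof.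
move=> H i j; rewrite mxE.
have -> : (n * s).+1 = (0 + n * s).+1 by [].
apply: size_mul_le; first by rewrite -signr_odd; case: (odd _); rewrite ?expr1 ?expr0 ?size_polyN size_poly1.
apply: (@leq_trans (n.-1 * s).+1); last by rewrite ltnS leq_mul2r leq_pred orbT.
by apply: size_det_le => k l; rewrite !mxE.
Qed.

End SizeBounds.

Lemma shift_act_monic (F : fieldType) (P : {poly F}) r u k : P \is monic -> size P = r.+1 ->
  shift_act P u k = \sum_(j < r) P`_j * u (k + j)%N + u (k + r)%N.
Proof.
move=> mP sP; rewrite /shift_act sP big_ord_recr /=; congr (_ + _).
by have := monicP mP; rewrite lead_coefE sP /= => ->; rewrite mul1r.
Qed.

Section MovingLines.
Variable R : realType.
Variables (r : nat) (a : nat -> nat -> R[i]) (C A : R).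
Hypotheses (A0 : 0 < A) (ga : geo2 C A a).

(** Taylor coefficients at (s0, t0) along the direction (1, m).  They are
    polynomials in m, which extends them to complex slopes. *)
Definition line_seq (s0 t0 : R) (m : R[i]) : nat -> R[i] :=
  antidiag (recenter2 a s0 t0) 1 m.

Definition line_poly (s0 t0 : R) (k : nat) : {poly R[i]} :=
  \sum_(j < k.+1) ('C(k, j)%:R * recenter2 a s0 t0 (k - j) j) *: 'X^j.

Lemma horner_line_poly s0 t0 k m : (line_poly s0 t0 k).[m] = line_seq s0 t0 m k.
Proof.
rewrite horner_sum; apply: eq_bigr => j _.
by rewrite hornerZ hornerXn expr1n mul1r mulrAC.
Qed.

Lemma size_line_poly s0 t0 k : (size (line_poly s0 t0 k) <= k.+1)%N.
Proof.
apply: size_sum_le => j _; apply: leq_trans (size_scale_leq _ _) _.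
by rewrite size_polyXn.
Qed.

Definition hankel_poly s0 t0 : 'M[{poly R[i]}]_r :=
  \matrix_(i < r, j < r) line_poly s0 t0 (i + j).

Definition det_poly s0 t0 := \det (hankel_poly s0 t0).

(** The numerators of Cramer's rule for the coefficients of the recurrence of
    order r, with det_poly as the common denominator. *)
Definition num_poly s0 t0 (j : 'I_r) : {poly R[i]} :=
  (\adj (hankel_poly s0 t0) *m \col_i (- line_poly s0 t0 (r + i))) j 0.

Lemma map_hankel_poly s0 t0 m :
  map_mx (horner_eval m) (hankel_poly s0 t0) = hankel_mx r (line_seq s0 t0 m).
Proof. by apply/matrixP => i j; rewrite !mxE /= /horner_eval horner_line_poly. Qed.

Lemma horner_det_poly s0 t0 m :
  (det_poly s0 t0).[m] = \det (hankel_mx r (line_seq s0 t0 m)).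
Proof. by rewrite -map_hankel_poly -[LHS]/(horner_eval m _) -det_map_mx. Qed.

Lemma horner_num_poly s0 t0 m j : (num_poly s0 t0 j).[m] =
  (\adj (hankel_mx r (line_seq s0 t0 m)) *m \col_i (- line_seq s0 t0 m (r + i))) j 0.
Proof.
rewrite -map_hankel_poly -map_mx_adj /num_poly !mxE horner_sum.
apply: eq_bigr => i _; rewrite hornerM [in RHS]mxE; congr (_ * _).
by rewrite !mxE hornerN horner_line_poly.
Qed.

Lemma num_poly_coef s0 t0 m (P : {poly R[i]}) j : P \is monic -> size P = r.+1 ->
  annihilates P (line_seq s0 t0 m) ->
  (num_poly s0 t0 j).[m] = (det_poly s0 t0).[m] * P`_j.
Proof.
move=> mP sP aP; rewrite horner_num_poly horner_det_poly.
have -> : \col_i (- line_seq s0 t0 m (r + i)) =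
  hankel_mx r (line_seq s0 t0 m) *m \col_(i < r) P`_i.
  apply/colP => i; rewrite !mxE; apply/esym/eqP; rewrite -addr_eq0; apply/eqP.
  rewrite -[RHS](aP i) (shift_act_monic _ _ mP sP) [(r + i)%N]addnC; congr (_ + _).
  by apply: eq_bigr => k _; rewrite !mxE mulrC.
by rewrite mulmxA mul_adj_mx mul_scalar_mx !mxE.
Qed.

Hypothesis line_ann : forall s0 t0 m : R, exists P : {poly R[i]},
  [/\ P \is monic, size P = r.+1 & annihilates P (line_seq s0 t0 m%:C)].

(** Known for real slopes, and polynomial in the slope. *)
Lemma recurrence_poly s0 t0 : det_poly s0 t0 != 0 -> forall k m,
  (det_poly s0 t0).[m] * line_seq s0 t0 m (k + r)%N +
  \sum_(j < r) (num_poly s0 t0 j).[m] * line_seq s0 t0 m (k + j)%N = 0.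
Proof.
move=> D0 k m; set D := det_poly s0 t0 in D0 *.
pose W := D * line_poly s0 t0 (k + r) +
  \sum_(j < r) num_poly s0 t0 j * line_poly s0 t0 (k + j).
have WE z : W.[z] = D.[z] * line_seq s0 t0 z (k + r)%N +
    \sum_(j < r) (num_poly s0 t0 j).[z] * line_seq s0 t0 z (k + j)%N.
  rewrite hornerD hornerM horner_line_poly; congr (_ + _).
  by rewrite horner_sum; apply: eq_bigr => j _; rewrite hornerM horner_line_poly.
rewrite -WE; suff -> : W = 0 by rewrite horner0.
apply: (@poly_eq0_on_itv _ _ 1) => // x _ _; rewrite WE.
have [P [mP sP aP]] := line_ann s0 t0 x.
under eq_bigr do rewrite (num_poly_coef _ mP sP aP) -mulrA.
rewrite -mulr_sumr -mulrDr addrC.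
by have := aP k; rewrite (shift_act_monic _ _ mP sP) => ->; rewrite mulr0.
Qed.

Definition coef_bound (m : R[i]) : R := (1 + A * (1 + cn m)) ^+ r.

(** At a slope where the denominator is nonzero the recurrence is minimal, so its
    roots are bounded by the growth rate A (1 + |m|) of the Taylor coefficients.
    Moving the base point changes the constant in front of the geometric bound on
    these coefficients but not the rate. *)
Lemma num_poly_bound s0 t0 m j : (det_poly s0 t0).[m] != 0 ->
  cn (num_poly s0 t0 j).[m] <= coef_bound m * cn (det_poly s0 t0).[m].
Proof.
move=> Dm; have D0 : det_poly s0 t0 != 0 by apply: contraNneq Dm => ->; rewrite horner0.
set D := (det_poly s0 t0).[m] in Dm *.
(* P is the monic recurrence of order r at slope m *)
pose P0 : {poly R[i]} :=
  \poly_(i < r) (if insub i is Some i' then (num_poly s0 t0 i').[m] / D else 0).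
pose P : {poly R[i]} := 'X^r + P0.
have sp : (size P0 < size ('X^r : {poly R[i]}))%N.
  by rewrite size_polyXn ltnS size_poly.
have sP : size P = r.+1 by rewrite /P size_polyDl // size_polyXn.
have mP : P \is monic by rewrite monicE /P lead_coefDl // lead_coefXn.
have Pj (i : 'I_r) : P`_i = (num_poly s0 t0 i).[m] / D.
  rewrite /P coefD coefXn coef_poly ltn_ord valK.
  by rewrite (ltn_eqF (ltn_ord i)) add0r.
have aP : annihilates P (line_seq s0 t0 m).
  move=> k; rewrite (shift_act_monic _ _ mP sP).
  have := recurrence_poly D0 k m; rewrite -/D => /(congr1 (fun x => x / D)).
  rewrite mul0r mulrDl mulrAC divff // mul1r mulr_suml addrC => E.
  rewrite -[RHS]E; congr (_ + _); apply: eq_bigr => i _.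
  by rewrite Pj mulrAC.
have rho0 : 0 < A * (1 + cn m) by rewrite mulr_gt0 // ltr_wpDr ?cn_ge0.
have [_ gl] := geo_antidiag 1 m (geo2_recenter s0 t0 ga).
rewrite cn1 in gl.
have roots z : root P z -> cn z <= A * (1 + cn m).
  apply: (root_growth mP rho0 _ aP gl) => q q0 sq aq.
  move/eqP: Dm; apply; rewrite /D horner_det_poly.
  by apply: (annihilator_hankel0 q0 _ aq); rewrite -ltnS -sP.
have := coef_le_pnorm P j; rewrite Pj cnM cnV => h.
rewrite -ler_pdivrMr; last by rewrite lt_neqAle eq_sym cn_eq0 Dm cn_ge0.
apply: le_trans h _; apply: le_trans (pnorm_le_roots mP (ltW rho0) roots) _.
by rewrite sP.
Qed.

(** The quotient Q is a polynomial by poly_dvd_of_bound.  It is bounded on the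
    unit disc and of degree at most dl, independently of the base point, so its
    norm is bounded by interpolation. *)
Lemma coef_poly_lipschitz : exists2 L : R, 0 <= L & forall s0 t0, det_poly s0 t0 != 0 ->
  forall j : 'I_r, exists Q : {poly R[i]},
    num_poly s0 t0 j = Q * det_poly s0 t0 /\
    forall m, cn m <= 1 -> cn (Q.[m] - Q.[0]) <= L * cn m.
Proof.
(* coef_bound on the disc of radius 2, which leaves room to avoid the zeros of Z *)
pose K0 := (1 + A * 3) ^+ r.
have K00 : 0 <= K0 by rewrite exprn_ge0 // addr_ge0 // mulr_ge0 // ltW.
(* degree of an adjugate entry, plus degree of the right-hand side *)
pose dl := (r * (2 * r) + 2 * r)%N.
exists (K0 * 16 ^+ dl) => [|s0 t0 D0 j]; first by rewrite mulr_ge0 // exprn_ge0.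
have Kmono m B : cn m <= B -> coef_bound m <= (1 + A * (1 + B)) ^+ r.
  move=> mB; apply: lerXn2r; rewrite ?nnegrE ?addr_ge0 ?mulr_ge0 ?addr_ge0 ?cn_ge0 ?(ltW A0) //.
    exact: le_trans (cn_ge0 m) mB.
  by rewrite lerD2l ler_wpM2l ?(ltW A0) // lerD2l.
have HK z0 : exists B, forall z, cn (z - z0) <= 1 -> coef_bound z <= B.
  exists ((1 + A * (1 + (1 + cn z0))) ^+ r) => z zz; apply: Kmono.
  by rewrite -[z](subrK z0); apply: le_trans (cnD _ _) _; rewrite lerD2r.
have [Q [Z [EQ Z0 HQ]]] := poly_dvd_of_bound D0 D0 HK (fun z => @num_poly_bound s0 t0 z j).
exists Q; split=> // m m1.
have Qb z : cn z <= 1 -> cn Q.[z] <= K0.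
  apply: (horner_le_closure (r := 1) Z0) => x Zx x2; apply: le_trans (HQ x Zx) _.
  by rewrite /K0 (_ : 3 = 1 + (1 + 1)); [exact: Kmono|ring].
have sN : (size (num_poly s0 t0 j) <= dl.+1)%N.
  rewrite /num_poly mxE; apply: size_sum_le => i _; apply: size_mul_le.
    apply: size_adj_le => k l; rewrite mxE; apply: leq_trans (size_line_poly _ _ _) _.
    have := ltn_ord k; have := ltn_ord l; lia.
  rewrite mxE size_polyN; apply: leq_trans (size_line_poly _ _ _) _.
  have := ltn_ord i; lia.
have sQ : (size Q <= dl.+1)%N.
  have [->|Q0] := eqVneq Q 0; first by rewrite size_poly0.
  apply: leq_trans sN; rewrite EQ size_mul //.
  by have := D0; rewrite -size_poly_gt0; case: (size _) => // n _; rewrite addnS leq_addr.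
have nQ : pnorm Q <= K0 * 16 ^+ dl.
  apply: pnorm_le_nodes => // i; apply: Qb; rewrite cn_real.
  by have /andP[h1 h2] := node_itv R i; rewrite ger0_norm.
apply: le_trans (horner_lip0 _ m1) _; rewrite mulrC.
by rewrite ler_wpM2r ?cn_ge0.
Qed.

End MovingLines.

(** * One recurrence for all parallel lines *)

Section Shift.
Variable R : realType.

Lemma annihilates_recenter (P : {poly R[i]}) (u : nat -> R[i]) C A c :
  geo C A u -> annihilates P u -> annihilates P (fun k => egf (shift k u) c).
Proof.
move=> gu aP k; have C0 := geo_C_ge0 gu; have [A0 _] := gu.
pose K := C * \sum_(j < size P) A ^+ (k + j).
have gs (j : 'I_(size P)) : geo K A (shift (k + j) u).
  apply: geo_weaken (geo_shift (k + j) gu) => //.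
  rewrite /K ler_wpM2l // (bigD1 j) //= lerDl.
  by apply: sumr_ge0 => i _; exact: exprn_ge0.
have K0 : 0 <= K by rewrite mulr_ge0 // sumr_ge0 // => i _; exact: exprn_ge0.
rewrite /shift_act -(egf_sum _ (fun j : 'I_(size P) => P`_j) c K0 A0 gs) -[RHS](egf0 c).
apply: eq_egf => l; rewrite -[RHS](aP (k + l)%N); apply: eq_bigr => j _.
by rewrite /shift addnAC.
Qed.

(** Translate back by - c. *)
Lemma annihilates_of_recenter (P : {poly R[i]}) (u : nat -> R[i]) C A c :
  geo C A u -> annihilates P (fun k => egf (shift k u) c) -> annihilates P u.
Proof.
move=> gu /(annihilates_recenter (- c) (geo_recenter c gu)) H k.
rewrite -[RHS](H k); apply: eq_shift_act => l.
have gs := geo_shift l gu.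
have -> : egf (shift l (fun k => egf (shift k u) c)) (- c) =
  egf (fun k => egf (shift k (shift l u)) c) (- c).
  apply: eq_egf => i; apply: eq_egf => j; by rewrite /shift addnA.
by rewrite -(egfD (- c) c gs) addNr (egf_at0 gs) /shift addn0.
Qed.

Lemma cont_at_egf0 (u : nat -> R[i]) C A : geo C A u -> cont_at (fun t : R => egf u t) 0.
Proof.
move=> gu e e0; have C0 := geo_C_ge0 gu; have [A0 _] := gu.
pose K := 2 * C * (A * expR A) + 1.
have K0 : 0 < K by rewrite ltr_wpDl // !mulr_ge0 // expR_ge0.
have d0 : 0 < Num.min 1 (e / K) by rewrite lt_min ltr01 divr_gt0.
exists (Num.min 1 (e / K)) => //= t; rewrite /= sub0r normrN lt_min => /andP[t1 te].
have := egf_tail t 1 gu; rewrite /egf_psum big_ord1 expr0 fact0 divr1 mulr1.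
rewrite -(egf_at0 gu) => h; apply: le_lt_trans h _.
rewrite /egf_rest expr1 factS fact0 muln1 divr1.
apply: (@le_lt_trans _ _ (K * `|t|)); last by rewrite mulrC -ltr_pdivlMr.
apply: (@le_trans _ _ (2 * C * (A * expR A) * `|t|)); last by rewrite ler_wpM2r // /K lerDl.
rewrite -!mulrA ler_wpM2l // ler_wpM2l // ler_wpM2l // mulrC ler_wpM2r //.
by rewrite ler_expR ler_piMr // ltW.
Qed.

End Shift.

Section CommonRecurrence.
Variable R : realType.
Variables (r : nat) (a : nat -> nat -> R[i]) (C A : R).
Hypotheses (A0 : 0 < A) (ga : geo2 C A a).
Hypothesis line_ann : forall s0 t0 m : R, exists P : {poly R[i]},
  [/\ P \is monic, size P = r.+1 & annihilates P (line_seq a s0 t0 m%:C)].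

Lemma geo_line_seq s0 t0 m : exists C' A', geo C' A' (line_seq a s0 t0 m).
Proof. by have := geo_antidiag 1 m (geo2_recenter s0 t0 ga); eexists; eexists; eauto. Qed.

Lemma egf_line_seq (s0 t0 m c : R) : egf (line_seq a s0 t0 m%:C) c =
  egf (fun i => egf (a i) (t0 + c * m)) (s0 + c).
Proof.
rewrite (egf2D _ _ _ _ ga); have := egf_line 1 m c (geo2_recenter s0 t0 ga).
by rewrite mulr1 => ->.
Qed.

(** Moving the base point along the line recentres the series. *)
Lemma line_seq_shift (s0 t0 m c : R) :
  line_seq a (s0 + c) (t0 + c * m) m%:C =1
  (fun k => egf (shift k (line_seq a s0 t0 m%:C)) c).
Proof.
have [C1 [A1 g1]] := geo_line_seq s0 t0 m%:C.
have [C2 [A2 g2]] := geo_line_seq (s0 + c) (t0 + c * m) m%:C.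
apply: (egf_inj g2 (geo_recenter c g1) ltr01) => x _ _.
apply: etrans (egf_line_seq _ _ _ _) _.
apply: etrans _ (egfD x c g1); apply: etrans _ (esym (egf_line_seq _ _ _ _)).
have -> : t0 + c * m + x * m = t0 + (x + c) * m by ring.
by have -> : s0 + c + x = s0 + (x + c) by ring.
Qed.

(** The minimal recurrence along the line has order exactly r. *)
Definition nondegenerate s0 t0 m := \det (hankel_mx r (line_seq a s0 t0 m)) != 0.

Lemma nondegenerate_shift (s0 t0 m c : R) : nondegenerate s0 t0 m%:C ->
  nondegenerate (s0 + c) (t0 + c * m) m%:C.
Proof.
move=> H; apply: contraNneq H => E.
have [P [mP sP aP]] := line_ann (s0 + c) (t0 + c * m) m.
have [q [q0 sq aq]] := hankel0_annihilator sP aP E.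
have [C1 [A1 g1]] := geo_line_seq s0 t0 m%:C.
apply/eqP/(annihilator_hankel0 q0 sq)/(annihilates_of_recenter g1 (c := c)).
by move=> k; rewrite -[RHS](aq k); apply: eq_shift_act => l; rewrite line_seq_shift.
Qed.

Lemma annihilates_line_shift (P : {poly R[i]}) (s0 t0 m c : R) :
  annihilates P (line_seq a s0 t0 m%:C) ->
  annihilates P (line_seq a (s0 + c) (t0 + c * m) m%:C).
Proof.
move=> aP k; have [C1 [A1 g1]] := geo_line_seq s0 t0 m%:C.
rewrite -[RHS](annihilates_recenter c g1 aP k).
by apply: eq_shift_act => l; rewrite line_seq_shift.
Qed.

(** The line of slope m through (0, 0) meets the line of slope 0 through (0, t) at
    (t / m, t).  The recurrence is constant along each of the lines, and at both
    (0, 0) and (t / m, t) its coefficients at slopes 0 and m differ by at most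
    L m.  Let m tend to 0. *)
Lemma same_annihilator (P : {poly R[i]}) (t : R) :
  P \is monic -> size P = r.+1 -> annihilates P (line_seq a 0 0 0) ->
  nondegenerate 0 0 0 -> nondegenerate 0 t 0 ->
  annihilates P (line_seq a 0 t 0).
Proof.
move=> mP sP aP N0 Nt.
have [->//|t0] := eqVneq t 0.
have [Py [mPy sPy aPy]] := line_ann 0 t 0.
have [L L0 HL] := coef_poly_lipschitz A0 ga line_ann.
have val s1 t1 (m : R[i]) (P1 Q : {poly R[i]}) (j : 'I_r) :
    (det_poly r a s1 t1).[m] != 0 -> P1 \is monic -> size P1 = r.+1 ->
    annihilates P1 (line_seq a s1 t1 m) ->
    num_poly a s1 t1 j = Q * det_poly r a s1 t1 -> Q.[m] = P1`_j.
  move=> Dm m1 s1' a1 E; have := num_poly_coef j m1 s1' a1.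
  by rewrite E hornerM mulrC => /(mulfI Dm).
suff E : P = Py by rewrite E.
apply/polyP => j; have [jr|rj] := ltnP j r; last first.
  have [->|nj] := eqVneq j r.
    have := monicP mP; have := monicP mPy; rewrite !lead_coefE sP sPy /= => -> ->.
    by [].
  by rewrite !nth_default // ?sP ?sPy ltn_neqAle eq_sym nj.
pose jo := Ordinal jr.
apply/eqP; rewrite -subr_eq0; apply/eqP.
apply: (@cn_small_eq0 _ _ (2 * L)) => e e0.
have e'0 : 0 < Num.min 1 e by rewrite lt_min ltr01.
have D0 : (det_poly r a 0 0).[0] != 0 by rewrite horner_det_poly; exact: N0.
have D0p : det_poly r a 0 0 != 0 by apply: contraNneq D0 => ->; rewrite horner0.
have [m [m0 me Dm]] := horner_neq0_near 0 D0p e'0.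
rewrite add0r in Dm; move: me; rewrite le_min => /andP[m1 me].
have mn0 : m != 0 by rewrite gt_eqF.
have Nm : nondegenerate 0 0 m%:C by rewrite /nondegenerate -horner_det_poly; exact: Dm.
have Nz : nondegenerate (t / m) t m%:C.
  by have := nondegenerate_shift (t / m) Nm; rewrite !add0r (divfK mn0); exact.
have Nz0 : nondegenerate (t / m) t 0.
  have := @nondegenerate_shift 0 t 0 (t / m); rewrite rmorph0 => /(_ Nt).
  by rewrite add0r mulr0 addr0; exact.
have Dzm : (det_poly r a (t / m) t).[m%:C] != 0 by rewrite horner_det_poly; exact: Nz.
have Dz0 : (det_poly r a (t / m) t).[0] != 0 by rewrite horner_det_poly; exact: Nz0.
have Dzp : det_poly r a (t / m) t != 0 by apply: contraNneq Dz0 => ->; rewrite horner0.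
have [Pm [mPm sPm aPm]] := line_ann 0 0 m.
have aPz : annihilates Pm (line_seq a (t / m) t m%:C).
  by have := annihilates_line_shift (t / m) aPm; rewrite !add0r (divfK mn0); exact.
have aPyz : annihilates Py (line_seq a (t / m) t 0).
  have := @annihilates_line_shift Py 0 t 0 (t / m); rewrite rmorph0 => /(_ aPy).
  by rewrite add0r mulr0 addr0; exact.
have [Q0 [EQ0 HQ0]] := HL 0 0 D0p jo.
have [Qz [EQz HQz]] := HL (t / m) t Dzp jo.
have V1 : Q0.[0] = P`_j := val _ _ _ _ _ jo D0 mP sP aP EQ0.
have V2 : Q0.[m%:C] = Pm`_j := val _ _ _ _ _ jo Dm mPm sPm aPm EQ0.
have V3 : Qz.[m%:C] = Pm`_j := val _ _ _ _ _ jo Dzm mPm sPm aPz EQz.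
have V4 : Qz.[0] = Py`_j := val _ _ _ _ _ jo Dz0 mPy sPy aPyz EQz.
have cm : cn m%:C = m by rewrite cn_real gtr0_norm.
have h1 := HQ0 m%:C; have h2 := HQz m%:C.
rewrite cm in h1 h2.
have -> : P`_j - Py`_j = (Qz.[m%:C] - Qz.[0]) - (Q0.[m%:C] - Q0.[0]).
  by rewrite -V1 -V4 V2 V3; ring.
apply: le_trans (cnB _ _) _; rewrite -mulrA mulr_natl mulr2n.
apply: lerD.
  by apply: le_trans (h2 m1) _; rewrite ler_wpM2l.
by apply: le_trans (h1 m1) _; rewrite ler_wpM2l.
Qed.

Lemma line_seq_horizontal t : line_seq a 0 t 0 =1 (fun k => egf (a k) t).
Proof.
move=> k; rewrite /line_seq /antidiag big_ord_recl big1 => [|j _]; last first.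
  by rewrite expr0n /= mulr0 mulr0 mul0r.
rewrite bin0 expr1n expr0 !mul1r subn0 addr0 /recenter2.
have gt := geo_egf2 t ga; have gk := geo_shift k gt.
rewrite [RHS](_ : _ = shift k (fun i => egf (a i) t) 0); last by rewrite /shift addn0.
rewrite -(egf_at0 gk); apply: eq_egf => i; rewrite /shift; congr egf.
Qed.

(** For small t the line is nondegenerate and same_annihilator applies; the
    relation is an identity between exponential generating functions in t, so it
    extends to all t. *)
Lemma common_annihilator (P : {poly R[i]}) :
  P \is monic -> size P = r.+1 -> annihilates P (fun k => egf (a k) 0) ->
  \det (hankel_mx r (fun k => egf (a k) 0)) != 0 ->
  forall t, annihilates P (fun k => egf (a k) t).
Proof.
move=> mP sP aP N0.
have C0 := geo2_C_ge0 ga; have A0' := ltW A0.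
have E0 t : hankel_mx r (line_seq a 0 t 0) = hankel_mx r (fun k => egf (a k) t).
  by apply/matrixP => i j; rewrite !mxE line_seq_horizontal.
have cdet : cont_at (fun t : R => \det (hankel_mx r (fun k => egf (a k) t))) 0.
  apply: cont_at_det => i j.
  have -> : (fun t : R => hankel_mx r (fun k => egf (a k) t) i j) = (fun t => egf (a (i + j)%N) t).
    by apply/funext => t; rewrite mxE.
  exact: cont_at_egf0 (geo2_row _ ga).
have [d /= d0 Hd] := cont_at_near_neq0 cdet N0.
have aPt t : `|t| < d -> annihilates P (fun k => egf (a k) t).
  move=> td k; rewrite -(eq_shift_act P k (line_seq_horizontal t)).
  apply: same_annihilator => //.
  - by move=> l; rewrite (eq_shift_act P l (line_seq_horizontal 0)).
  - by rewrite /nondegenerate E0.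
  - by rewrite /nondegenerate E0; apply: Hd; rewrite /= sub0r normrN.
have rows k : exists2 K, 0 <= K & forall j : 'I_(size P), geo K A (a (k + j)%N).
  pose K := C * \sum_(j < size P) A ^+ (k + j); exists K => [|j].
    by rewrite mulr_ge0 // sumr_ge0 // => i _; exact: exprn_ge0.
  apply: geo_weaken (geo2_row (k + j) ga) => //.
  rewrite /K ler_wpM2l // (bigD1 j) //= lerDl.
  by apply: sumr_ge0 => i _; exact: exprn_ge0.
have coef k l : \sum_(j < size P) P`_j * a (k + j)%N l = 0.
  have [K K0 gs] := rows k.
  pose psi l := \sum_(j < size P) P`_j * a (k + j)%N l.
  have gpsi : geo (\sum_(j < size P) cn P`_j * K) A psi.
    split=> // i; apply: le_trans (cn_sum _ _ _) _; rewrite mulr_suml.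
    apply: ler_sum => j _; rewrite cnM -mulrA ler_wpM2l ?cn_ge0 //.
    by case: (gs j).
  have d2 : 0 < d / 2 by rewrite divr_gt0.
  apply: (egf_inj gpsi (geo0 A0') d2) => t t0 td.
  rewrite egf0 /psi (egf_sum _ (fun j : 'I_(size P) => P`_j) t K0 A0' gs).
  apply: (aPt t); rewrite gtr0_norm //; apply: le_lt_trans td _.
  by rewrite ltr_pdivrMr // ltr_pMr // ltr1n.
move=> t k; rewrite /shift_act.
have [K K0 gs] := rows k.
rewrite -(egf_sum _ (fun j : 'I_(size P) => P`_j) t K0 A0' gs) -[RHS](egf0 t).
by apply: eq_egf => l; rewrite coef.
Qed.

End CommonRecurrence.

(** * Directions of maximal rank *)

Lemma affine_comb (R : realType) (V : lmodType R) (x u q : V) (s0 t0 s1 t1 c : R) :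
  x + (s0 + c * s1) *: u + (t0 + c * t1) *: q =
  (x + s0 *: u + t0 *: q) + c *: (s1 *: u + t1 *: q).
Proof.
rewrite !scalerDl scalerDr !scalerA -!addrA.
by congr (_ + (_ + _)); rewrite addrCA.
Qed.

Section Translates.
Variable R : realType.
Variables (phi : R -> R[i]) (C A : R) (w : nat -> R[i]).
Hypotheses (gw : geo C A w) (Ew : forall t, phi t = egf w t).

Lemma geo_translates (N : nat) (p : nat -> R) : exists C', 0 <= C' /\
  forall i : 'I_N, geo C' A (fun k => egf (shift k w) (p i)).
Proof.
have C0 := geo_C_ge0 gw.
exists (\sum_(i < N) 2 * C * expR (A * `|p i|)); split.
  by apply: sumr_ge0 => i _; rewrite !mulr_ge0 ?expR_ge0.
move=> i; apply: geo_weaken (geo_recenter (p i) gw) => //.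
rewrite (bigD1 i) //= lerDl; apply: sumr_ge0 => j _.
by rewrite !mulr_ge0 ?expR_ge0.
Qed.

Lemma translates_comb r (p : nat -> R) (al : 'I_r -> R[i]) t :
  egf (fun k => \sum_(i < r) al i * egf (shift k w) (p i)) t =
  \sum_(i < r) al i * phi (p i + t).
Proof.
have [C' [C'0 gU]] := geo_translates r p; have [A0 _] := gw.
rewrite (egf_sum _ al t C'0 A0 gU); apply: eq_bigr => i _; congr (_ * _).
by rewrite Ew [p i + t]addrC; exact: esym (egfD _ _ gw).
Qed.

Lemma translates_independent r p q (al : 'rV[R[i]]_r) : minor phi r p q != 0 ->
  (forall k, \sum_(i < r) al 0 i * egf (shift k w) (p i) = 0) -> al = 0.
Proof.
move=> M0 H; have U : node_mx phi r p q 0 \in unitmx by rewrite unitmxE unitfE.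
rewrite -[al](mulmxK U) (_ : al *m _ = 0) ?mul0mx //.
apply/rowP => j; rewrite !mxE.
transitivity (\sum_(i < r) al 0 i * phi (p i + q j)).
  by apply: eq_bigr => i _; rewrite mxE addr0.
rewrite -(translates_comb p (fun i => al 0 i)) -[RHS](egf0 (q j)).
by apply: eq_egf.
Qed.

(** If the recurrence could be shortened, r translates of phi would be
    dependent, and so would be the rows of the minor. *)
Lemma minor_hankel r p q (P : {poly R[i]}) : P \is monic -> size P = r.+1 ->
  annihilates P w -> minor phi r p q != 0 -> \det (hankel_mx r w) != 0.
Proof.
move=> mP sP aP M0; apply/eqP => /(hankel0_annihilator sP aP)[Q [Q0 sQ aQ]].
have [al al0 Hal] := annihilated_dependent (U := fun i : 'I_r => fun k => egf (shift k w) (p i))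
  Q0 sQ (fun i => annihilates_recenter (p i) gw aQ).
by move/eqP: al0; apply; exact: translates_independent M0 Hal.
Qed.

End Translates.

Section Direction.
Variables (R : realType) (V : normedModType R) (f : V -> R[i]).
Hypothesis cf : forall x, cont_at f x.
Variables (r : nat) (p q : nat -> R) (x0 u : V).
Hypothesis H0 : forall x h p q, minor (on_line f x h) r.+2 p q = 0.
Hypothesis p0 : p 0%N = 0.
Hypothesis M0 : minor (on_line f x0 u) r.+1 p q != 0.

Lemma line_expansion_in x h : exists (C A : R) (w : nat -> R[i]),
  [/\ geo C A w, forall t, on_line f x h t = egf w t &
     exists P : {poly R[i]}, [/\ P \is monic, size P = r.+2 & annihilates P w]].
Proof. by apply: line_expansion => [t|]; [exact: cont_at_on_line|exact: H0]. Qed.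

(** The second vector is e (u + e v): along it, as along all u + m e (u + e v)
    with m in [0, 1], the direction is close to a multiple of u, where the
    expansions are uniform. *)
Lemma plane_expansion v : exists (e C A : R) (a : nat -> nat -> R[i]),
  [/\ 0 < e, 0 < A, geo2 C A a & forall s t,
    f (x0 + s *: u + t *: (e *: (u + e *: v))) = egf (fun i => egf (a i) t) s].
Proof.
have [C [A [d [A0 d0 Hd]]]] := plane_uniform cf v H0 p0 M0.
pose e := Num.min 1 d.
have e0 : 0 < e by rewrite lt_min ltr01.
have e1 : e <= 1 by rewrite ge_min lexx.
have ed : e <= d by rewrite ge_min lexx orbT.
pose g s t := f (x0 + s *: u + t *: (e *: (u + e *: v))).
have strip s : `|s| <= e -> exists al, geo C A al /\ forall t, g s t = egf al t.
  move=> se; have [|||w [gw Ew]] := Hd s 0 e.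
  - exact: le_trans se ed.
  - by rewrite normr0 ltW.
  - by rewrite gtr0_norm.
  exists (fun k => w k * (e ^+ k)%:C); split.
    have [A0' Hw] := gw; split=> // k; rewrite cnM cn_real; apply: le_trans (Hw k).
    by rewrite ler_piMr ?cn_ge0 // ger0_norm ?exprn_ge0 ?exprn_ile1 // ltW.
  move=> t; rewrite egf_scale -Ew /on_line addr0 scale1r /g scalerA.
  by rewrite [e * t]mulrC.
have rays m : 0 <= m <= 1 -> exists be, geo C A be /\ forall s, g s (s * m) = egf be s.
  move=> /andP[m0 m1].
  have me : m * e <= d by apply: le_trans ed; rewrite ler_piMl // ltW.
  have me2 : m * e * e <= d.
    by apply: le_trans ed; rewrite ler_piMl ?(ltW e0) // mulr_ile1 // ltW.
  have [|||w [gw Ew]] := Hd 0 (m * e) (m * e * e).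
  - by rewrite normr0 ltW.
  - by rewrite ger0_norm // mulr_ge0 // ltW.
  - by rewrite ger0_norm // !mulr_ge0 // ltW.
  exists w; split=> // s; rewrite -Ew /on_line /g scale0r addr0 -addrA; congr f.
  congr (_ + _); rewrite !scalerDr !scalerA mulrDr mulr1 scalerDl -!mulrA.
  by rewrite addrA.
have [a [ga Ea]] := cone_expansion e0 (ltW A0) strip rays.
exists e, C, (16 * A), a; split=> //; first by rewrite mulr_gt0.
apply: (plane_extension (g := g) ga _ Ea) => s0 t0 s1 t1.
have [C1 [A1 [w [gw Ew _]]]] := line_expansion_in (x0 + s0 *: u + t0 *: (e *: (u + e *: v)))
  (s1 *: u + t1 *: (e *: (u + e *: v))).
by exists C1, A1, w; split=> // c; rewrite -Ew /on_line /g affine_comb.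
Qed.

(** The point y lies in the plane of plane_expansion for v = y - x0, on the line
    of direction u at height e^-2. *)
Theorem common_direction_annihilator : exists P : {poly R[i]},
  [/\ P \is monic, size P = r.+2 & forall y, exists C A w, [/\ geo C A w,
    forall t, on_line f y u t = egf w t & annihilates P w]].
Proof.
have [C0 [A0 [w0 [g0 E0 [P [mP sP aP]]]]]] := line_expansion_in x0 u.
exists P; split=> // y.
have [e [C [A [a [e0 Apos ga Ea]]]]] := plane_expansion (y - x0).
pose q' := e *: (u + e *: (y - x0)).
have line_ann s0 t0 m : exists P : {poly R[i]},
    [/\ P \is monic, size P = r.+2 & annihilates P (line_seq a s0 t0 m%:C)].
  have [C1 [A1 [w [gw Ew [P' [mP' sP' aP']]]]]] := line_expansion_in (x0 + s0 *: u + t0 *: q') (u + m *: q').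
  exists P'; split=> // k; rewrite -[RHS](aP' k); apply: eq_shift_act => l.
  have [C2 [A2 g2]] := geo_line_seq ga s0 t0 m%:C.
  apply: (egf_inj g2 gw ltr01) => c _ _.
  apply: etrans (egf_line_seq ga s0 t0 m c) _; rewrite -Ea -Ew /on_line.
  by rewrite -/q' -[X in s0 + X]mulr1 affine_comb scale1r.
have Ew0 : (fun k => egf (a k) 0) =1 w0.
  apply: (egf_inj (geo_egf2 0 ga) g0 ltr01) => s _ _.
  by rewrite -Ea -E0 /on_line scale0r addr0.
have aPa : annihilates P (fun k => egf (a k) 0).
  by move=> k; rewrite -[RHS](aP k); apply: eq_shift_act.
have nd : \det (hankel_mx r.+1 (fun k => egf (a k) 0)) != 0.
  rewrite (_ : hankel_mx r.+1 _ = hankel_mx r.+1 w0).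
    exact: (minor_hankel g0 E0 mP sP aP M0).
  by apply/matrixP => i j; rewrite !mxE Ew0.
have all_t := common_annihilator Apos ga line_ann mP sP aPa nd.
have gb := geo_egf2 (e ^- 2) ga.
do 2![eexists]; exists (fun k => egf (shift k (fun k => egf (a k) (e ^- 2))) (- e^-1)); split.
- exact: geo_recenter gb.
- move=> t; rewrite -(egfD _ _ gb) -Ea /on_line; congr f.
  have en0 : e != 0 by rewrite gt_eqF.
  (* so y = x0 + (- e^-1) u + e^-2 q', with dd = y - x0 *)
  have Hq (dd : V) : e ^- 2 *: (e *: (u + e *: dd)) = e^-1 *: u + dd.
    rewrite !scalerDr !scalerA -[in RHS](scale1r dd); congr (_ *: _ + _ *: _); by field.
  rewrite Hq scalerDl scaleNr addrA -[x0 + _ + _]addrA subrK.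
  by rewrite [RHS]addrC addrA subrK.
- exact: annihilates_recenter gb (all_t _).
Qed.

(** The coefficients that express a value on a line of direction u by the values
    at the nodes q j, read off from the line through x0. *)
Definition shift_coef (j : 'I_r.+1) (t : R) : R[i] :=
  \sum_(i < r.+1) invmx (node_mx (on_line f x0 u) r.+1 p q 0) j i * on_line f x0 u (p i + t).

(** On every line of direction u the function satisfies the same recurrence of
    order r + 1.  The translates by p i of its restriction to the line through x0
    are a basis of the solutions, since the minor is nonzero, and the same minor
    recovers the coordinates from the values at the q j. *)
Theorem finite_shift_rank : forall y t,
  f (y + t *: u) = \sum_(j < r.+1) shift_coef j t * f (y + q j *: u).
Proof.
have [P [mP sP HP]] := common_direction_annihilator.
have [C0 [A0 [w0 [g0 E0 aP0]]]] := HP x0.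
move=> y t; have [C [A [w [gw Ew aw]]]] := HP y.
have U : node_mx (on_line f x0 u) r.+1 p q 0 \in unitmx by rewrite unitmxE unitfE.
have [al Eal] := annihilated_span (U := fun i : 'I_r.+1 => fun k => egf (shift k w0) (p i))
  sP (fun i => annihilates_recenter (p i) g0 aP0)
  (fun al Hal => translates_independent g0 E0 M0 Hal) aw.
have Ey s : on_line f y u s = \sum_(i < r.+1) al 0 i * on_line f x0 u (p i + s).
  rewrite Ew -(translates_comb g0 E0 p (fun i => al 0 i)); exact: eq_egf.
pose Fy := \row_(j < r.+1) on_line f y u (q j).
have Ral : al = Fy *m invmx (node_mx (on_line f x0 u) r.+1 p q 0).
  rewrite (_ : Fy = al *m node_mx (on_line f x0 u) r.+1 p q 0) ?mulmxK //.
  by apply/rowP => j; rewrite !mxE Ey; apply: eq_bigr => i _; rewrite mxE addr0.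
rewrite -/(on_line f y u t) Ey Ral.
under eq_bigr do rewrite mxE mulr_suml.
rewrite exchange_big; apply: eq_bigr => j _ /=.
rewrite /shift_coef mulr_suml; apply: eq_bigr => i _.
by rewrite mxE /on_line -mulrA mulrC -mulrA.
Qed.

(** A combination of translates of one restriction, hence a solution of its
    recurrence. *)
Theorem shift_coef_jordan (j : 'I_r.+1) : exists s,
  forall t, shift_coef j t = egf (jordan_comb s) t.
Proof.
have [C0 [A0 [w0 [g0 E0 [P [mP sP aP]]]]]] := line_expansion_in x0 u.
pose c i := invmx (node_mx (on_line f x0 u) r.+1 p q 0) j i.
pose w k := \sum_(i < r.+1) c i * egf (shift k w0) (p i).
have aw : annihilates P w.
  move=> k; rewrite /w shift_act_sum big1 // => i _.
  by rewrite (annihilates_recenter (p i) g0 aP) mulr0.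
have Ew t : shift_coef j t = egf w t by rewrite (translates_comb g0 E0 p c).
have [rs EP] := closed_field_poly_normal P.
rewrite (monicP mP) scale1r in EP; rewrite EP in aw.
have [s Es] := annihilated_jordan aw.
by exists s => t; rewrite Ew; exact: eq_egf.
Qed.

End Direction.

(** * Exponential polynomials *)

Section ComplexExp.
Variable R : realType.
Implicit Types (l : R[i]) (t : R).

Lemma cexpD (x y : R[i]) : cexp (x + y) = cexp x * cexp y.
Proof.
case: x y => a b [c d]; rewrite /cexp /= expRD cosD sinD.
by apply/eqP; rewrite eq_complex /=; apply/andP; split; apply/eqP; ring.
Qed.

Lemma cexp0 : cexp 0 = 1 :> R[i].
Proof.
rewrite /cexp /= expR0 cos0 sin0; apply/eqP; rewrite eq_complex /=.
by apply/andP; split; apply/eqP; ring.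
Qed.

Lemma cexp_real l t : cexp (l * t%:C) =
  expR (complex.Re l * t) * cos (complex.Im l * t) +i*
  (expR (complex.Re l * t) * sin (complex.Im l * t)).
Proof.
case: l => a b; rewrite /cexp /= !mulr0 subr0 ?addr0 ?add0r.
by apply/eqP; rewrite eq_complex /=; apply/andP; split; apply/eqP; ring.
Qed.

Lemma cderiv_cexp l : cderiv (fun t => cexp (l * t%:C)) (fun t => l * cexp (l * t%:C)).
Proof.
move=> t; rewrite [X in complex.Re (l * X)]cexp_real [X in complex.Im (l * X)]cexp_real.
rewrite Re_mul Im_mul /=; set a := complex.Re l; set b := complex.Im l.
have Dlin (c : R) : is_derive t (1 : R) (fun x : R => c * x) c.
  by have := is_deriveZ c (is_derive_id t (1 : R)); rewrite /GRing.scale /= mulr1.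
have De : is_derive t (1 : R) (fun x => expR (a * x)) (expR (a * t) * a).
  exact: (is_derive1_comp (is_derive_expR (a * t)) (Dlin a)).
have Dc : is_derive t (1 : R) (fun x => cos (b * x)) (- sin (b * t) * b).
  exact: (is_derive1_comp (is_derive_cos (b * t)) (Dlin b)).
have Ds : is_derive t (1 : R) (fun x => sin (b * x)) (cos (b * t) * b).
  exact: (is_derive1_comp (is_derive_sin (b * t)) (Dlin b)).
split.
- have -> : (fun x => complex.Re (cexp (l * x%:C))) =
    (fun x => expR (a * x)) * (fun x => cos (b * x)).
    by apply/funext => x; rewrite cexp_real.
  by apply: is_derive_eq (is_deriveM De Dc) _; rewrite /GRing.scale /=; ring.
- have -> : (fun x => complex.Im (cexp (l * x%:C))) =
    (fun x => expR (a * x)) * (fun x => sin (b * x)).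
    by apply/funext => x; rewrite cexp_real.
  by apply: is_derive_eq (is_deriveM De Ds) _; rewrite /GRing.scale /=; ring.
Qed.

Lemma cderiv_continuous (F G : R -> R[i]) : cderiv F G -> ccontinuous F.
Proof.
move=> H; split=> t; apply: differentiable_continuous; apply/derivable1_diffP.
- by case: (H t).1.
- by case: (H t).2.
Qed.

(** Both sides have the derivatives l^k at 0, and the exponential satisfies the
    bounds of taylor_egf. *)
Lemma egf_exp l t : egf (fun k => l ^+ k) t = cexp (l * t%:C).
Proof.
pose psi k x := l ^+ k * cexp (l * x%:C).
have E0 : psi 0%N t = cexp (l * t%:C) by rewrite /psi mul1r.
rewrite -E0 (@taylor_egf _ psi (cn l)) ?cn_ge0 //.
- by apply: eq_egf => k; rewrite /psi mulr0 cexp0 mulr1.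
- move=> k; have := cderivZ (l ^+ k) (cderiv_cexp l).
  by apply: cderiv_ext => x //; rewrite /psi exprSr mulrA.
- move=> T; have [M HM] := ccontinuous_bounded T (cderiv_continuous (cderiv_cexp l)).
  exists M => k x xT; rewrite /psi cnM cnX mulrC ler_wpM2r ?exprn_ge0 ?cn_ge0 //.
  exact: HM.
Qed.

Lemma geo_jordan_seq l i : geo 1 (2 * (1 + cn l)) (jordan_seq l i).
Proof.
have h : 1 <= 1 + cn l by rewrite lerDl cn_ge0.
split=> [|k]; first by rewrite mulr_ge0 // addr_ge0 ?cn_ge0.
rewrite mul1r /jordan_seq cnM cn_nat cnX exprMn.
have [ik|ki] := leqP i k; last first.
  by rewrite bin_small // mul0r mulr_ge0 ?exprn_ge0 // addr_ge0 ?cn_ge0.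
apply: ler_pM; rewrite ?ler0n ?exprn_ge0 ?cn_ge0 //.
  rewrite -natrX ler_nat -[2%N]/(1 + 1)%N Pascal.
  have H : (i < k.+1)%N by [].
  by rewrite (bigD1 (Ordinal H)) //= !exp1n !muln1 leq_addr.
apply: (@le_trans _ _ ((1 + cn l) ^+ (k - i))).
  by apply: lerXn2r; rewrite ?nnegrE ?cn_ge0 ?(le_trans ler01 h) // lerDr.
by apply: ler_weXn2l => //; exact: leq_subr.
Qed.

Lemma egf_jordan_seq l i t :
  egf (jordan_seq l i) t = (t ^+ i / i`!%:R)%:C * cexp (l * t%:C).
Proof.
have gl : geo 1 (cn l) (fun k => l ^+ k).
  by split=> [|k]; rewrite ?cn_ge0 // mul1r cnX.
have g := geo_jordan_seq l i.
symmetry; apply: (egf_unique g) => e e0.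
pose c : R := `|t ^+ i / i`!%:R| + 1.
have c0 : 0 < c by rewrite ltr_wpDl.
have [N1 H1] := egf_rest_small (2 * (1 + cn l)) t e0 ler01.
have [N2 H2] := egf_rest_small (cn l) t (divr_gt0 e0 c0) ler01.
pose n := maxn N1 N2; exists (i + n)%N.
have {}H1 := ltW (H1 (i + n)%N (leq_trans (leq_maxl N1 N2) (leq_addl _ _))).
have {}H2 := ltW (H2 n (leq_maxr _ _)).
split=> //.
have -> : egf_psum (jordan_seq l i) t (i + n) = (t ^+ i / i`!%:R)%:C * egf_psum (fun k => l ^+ k) t n.
  rewrite /egf_psum big_split_ord /= big1 ?add0r => [|j _]; last first.
    by rewrite /jordan_seq bin_small // !mul0r.
  rewrite mulr_sumr; apply: eq_bigr => j _.
  rewrite /jordan_seq addKn -(rmorph_nat (real_complex R)).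
  transitivity (l ^+ j * ('C(i + j, i)%:R * (t ^+ (i + j) / (i + j)`!%:R))%:C).
    by rewrite rmorphM /=; ring.
  transitivity (l ^+ j * ((t ^+ i / i`!%:R) * (t ^+ j / j`!%:R))%:C); last first.
    by rewrite rmorphM /=; ring.
  congr (_ * _%:C).
  have := bin_fact (leq_addr j i); rewrite addKn => <-.
  rewrite !natrM exprD.
  have h1 : (0 : R) < i`!%:R by rewrite ltr0n fact_gt0.
  have h2 : (0 : R) < j`!%:R by rewrite ltr0n fact_gt0.
  have h3 : (0 : R) < 'C(i + j, i)%:R by rewrite ltr0n bin_gt0 leq_addr.
  by field; rewrite !gt_eqF.
rewrite -egf_exp -mulrBr cnM cn_real.
apply: (@le_trans _ _ (c * (e / c))); last by rewrite mulrC divfK // gt_eqF.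
apply: ler_pM; rewrite ?cn_ge0 //; first by rewrite /c lerDl.
exact: le_trans (egf_tail _ _ gl) H2.
Qed.

Lemma egf_jordan_comb s t : egf (jordan_comb s) t =
  \sum_(x <- s) (x.1.1 * ((t ^+ x.2 / x.2`!%:R)%:C * cexp (x.1.2 * t%:C))).
Proof.
pose M := \sum_(x <- s) cn x.1.2.
have M0 : 0 <= M by apply: sumr_ge0 => x _; exact: cn_ge0.
(* cut off outside s, for one geometric bound to hold for all triples *)
pose U (x : R[i] * R[i] * nat) := if cn x.1.2 <= M then jordan_seq x.1.2 x.2 else fun=> 0.
have gU x : geo 1 (2 * (1 + M)) (U x).
  rewrite /U; case: ifP => h; last first.
    split=> [|k]; first by rewrite mulr_ge0 // addr_ge0.
    by rewrite cn0 mul1r exprn_ge0 // mulr_ge0 // addr_ge0.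
  by apply: geo_weaken (geo_jordan_seq _ _) => //; rewrite ler_pM2l // lerD2l.
have sM x : x \in s -> cn x.1.2 <= M.
  move=> xs; rewrite /M (perm_big _ (perm_to_rem xs)) /= big_cons lerDl.
  by apply: sumr_ge0 => y _; exact: cn_ge0.
have -> : egf (jordan_comb s) t = \sum_(x <- s) x.1.1 * egf (U x) t.
  rewrite -(egf_sum s (fun x => x.1.1) t ler01 _ gU); last by rewrite mulr_ge0 // addr_ge0.
  apply: eq_egf => k; rewrite /jordan_comb !big_seq; apply: eq_bigr => x xs.
  by rewrite /U sM.
rewrite !big_seq; apply: eq_bigr => x xs; rewrite /U sM //.
by rewrite egf_jordan_seq.
Qed.

End ComplexExp.

Section ExpPoly.
Variables (R : realType) (d : nat).
Implicit Types (f g : 'rV[R]_d -> R[i]).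

Definition cvec (x : 'rV[R]_d) : 'I_d -> R[i] := fun j => (x 0 j)%:C.

(** Terms are listed rather than indexed by ordinals, so that sums are
    concatenations. *)
Definition exp_poly f := exists s : seq (mpoly.mpoly d R[i] * 'rV[R[i]]_d), forall x,
  f x = \sum_(k <- s) mpoly.meval (cvec x) k.1 * cexp (pairing k.2 x).

Lemma exponential_polynomial_of_exp_poly f : exp_poly f -> exponential_polynomial f.
Proof.
move=> [s Hs]; pose z0 : mpoly.mpoly d R[i] * 'rV[R[i]]_d :=
  (mpoly.mpolyC d (0 : R[i]), (0 : 'rV[R[i]]_d)).
exists (size s), (fun k => (nth z0 s k).1), (fun k => (nth z0 s k).2).
move=> x; rewrite Hs (big_nth z0) big_mkord.
by apply: eq_bigr.
Qed.

Lemma exp_poly_ext f g : f =1 g -> exp_poly f -> exp_poly g.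
Proof. by move=> E [s Hs]; exists s => x; rewrite -E. Qed.

Lemma exp_poly0 : exp_poly (fun=> 0).
Proof. by exists [::] => x; rewrite big_nil. Qed.

Lemma exp_polyD f g : exp_poly f -> exp_poly g -> exp_poly (fun x => f x + g x).
Proof. by move=> [s Hs] [s' Hs']; exists (s ++ s') => x; rewrite big_cat Hs Hs'. Qed.

Lemma exp_poly_sum (I : Type) (r : seq I) (F : I -> 'rV[R]_d -> R[i]) :
  (forall i, exp_poly (F i)) -> exp_poly (fun x => \sum_(i <- r) F i x).
Proof.
move=> H; elim: r => [|i r IH].
  by apply: exp_poly_ext exp_poly0 => x; rewrite big_nil.
by apply: exp_poly_ext (exp_polyD (H i) IH) => x; rewrite big_cons.
Qed.

Lemma pairingD (l1 l2 : 'rV[R[i]]_d) x : pairing (l1 + l2) x = pairing l1 x + pairing l2 x.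
Proof. by rewrite /pairing -big_split; apply: eq_bigr => j _; rewrite mxE mulrDl. Qed.

Lemma exp_polyM f g : exp_poly f -> exp_poly g -> exp_poly (fun x => f x * g x).
Proof.
move=> [s Hs] [s' Hs'].
exists [seq (k.1 * k'.1, k.2 + k'.2) | k <- s, k' <- s'] => x.
rewrite big_allpairs_dep /= Hs Hs' mulr_suml; apply: eq_bigr => k _.
rewrite mulr_sumr; apply: eq_bigr => k' _ /=.
by rewrite mpoly.mevalM pairingD cexpD mulrACA.
Qed.

Lemma pairing0 x : pairing (0 : 'rV[R[i]]_d) x = 0.
Proof. by rewrite /pairing big1 // => j _; rewrite mxE mul0r. Qed.

Lemma exp_poly_meval (P : mpoly.mpoly d R[i]) : exp_poly (fun x => mpoly.meval (cvec x) P).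
Proof. by exists [:: (P, 0)] => x; rewrite big_seq1 pairing0 cexp0 mulr1. Qed.

Lemma exp_poly_cst c : exp_poly (fun=> c).
Proof. by apply: exp_poly_ext (exp_poly_meval (mpoly.mpolyC d c)) => x; rewrite mpoly.mevalC. Qed.

Definition linform (a x : 'rV[R]_d) : R := \sum_(j < d) a 0 j * x 0 j.

Lemma exp_poly_linform a : exp_poly (fun x => (linform a x)%:C).
Proof.
have := @exp_poly_sum _ (index_enum 'I_d)
  (fun j x => mpoly.meval (cvec x) ((a 0 j)%:C *: mpoly.mpolyX R[i] (mpoly.mnm1 j)))
  (fun j => exp_poly_meval _).
apply: exp_poly_ext => x; rewrite /linform rmorph_sum /=; apply: eq_bigr => j _.
by rewrite mpoly.mevalZ mpoly.mevalXU /cvec rmorphM.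
Qed.

Lemma exp_poly_exp l a : exp_poly (fun x => cexp (l * (linform a x)%:C)).
Proof.
exists [:: (1, \row_j (l * (a 0 j)%:C))] => x; rewrite big_seq1 /= mpoly.meval1 mul1r.
congr cexp; rewrite /linform /pairing rmorph_sum mulr_sumr /=; apply: eq_bigr => j _.
by rewrite mxE rmorphM mulrA.
Qed.

Lemma exp_poly_pow f n : exp_poly f -> exp_poly (fun x => f x ^+ n).
Proof.
move=> H; elim: n => [|n IH]; first by apply: exp_poly_ext (exp_poly_cst 1) => x; rewrite expr0.
by apply: exp_poly_ext (exp_polyM H IH) => x; rewrite exprS.
Qed.

Lemma exp_poly_jordan s a : exp_poly (fun x => egf (jordan_comb s) (linform a x)).
Proof.
apply: (@exp_poly_ext (fun x => \sum_(y <- s) (y.1.1 * ((y.2`!%:R^-1)%:C * ((linform a x)%:C ^+ y.2 * cexp (y.1.2 * (linform a x)%:C)))))).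
  move=> x; rewrite egf_jordan_comb; apply: eq_bigr => y _.
  by rewrite -rmorphXn mulrA -rmorphM; congr (_ * (_%:C * _)); rewrite mulrC.
apply: exp_poly_sum => y; apply: exp_polyM; first exact: exp_poly_cst.
apply: exp_polyM; first exact: exp_poly_cst.
by apply: exp_polyM; [apply: exp_poly_pow; exact: exp_poly_linform|exact: exp_poly_exp].
Qed.

(** A pair in ws is a direction with the linear form giving the coordinate along
    it.  The identity for the first direction reduces the claim to finitely many
    base points and the remaining directions. *)
Lemma exp_poly_of_directions f (ws : seq ('rV[R]_d * 'rV[R]_d)) :
  (forall wa, wa \in ws -> exists (r : nat) (q : nat -> R) (b : 'I_r -> R -> R[i]),
     (forall j, exp_poly (fun x => b j (linform wa.2 x))) /\
     forall y t, f (y + t *: wa.1) = \sum_(j < r) b j t * f (y + q j *: wa.1)) ->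
  forall y, exp_poly (fun x => f (y + \sum_(wa <- ws) linform wa.2 x *: wa.1)).
Proof.
elim: ws => [|wa ws IH] H y.
  by apply: exp_poly_ext (exp_poly_cst (f y)) => x; rewrite big_nil addr0.
have [r [q [b [eb Hb]]]] := H wa (mem_head _ _).
have {}IH : forall z, exp_poly (fun x => f (z + \sum_(wa <- ws) linform wa.2 x *: wa.1)).
  by apply: IH => wa' h; apply: H; rewrite inE h orbT.
have := @exp_poly_sum _ (index_enum 'I_r) (fun j x => b j (linform wa.2 x) *
  f (y + q j *: wa.1 + \sum_(wa <- ws) linform wa.2 x *: wa.1))
  (fun j => exp_polyM (eb j) (IH _)).
apply: exp_poly_ext => x; rewrite big_cons.
rewrite [linform _ _ *: _ + _]addrC addrA Hb; apply: eq_bigr => j _.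
by rewrite addrAC.
Qed.

End ExpPoly.

Unset Implicit Arguments.

Theorem theorem3p5 (R : realType) (d n : nat) (hd : (0 < d)%N)
    (f : 'rV[R]_d -> R[i])
    (f_cont : continuous (f : 'rV[R]_d -> R[i]^o))
    (f_det : forall x h : 'rV[R]_d,
      \det (\matrix_(i < n.+1, j < n.+1) f (x + (i + j)%:R *: h)) = 0) :
  exponential_polynomial f.
Proof.
apply: exponential_polynomial_of_exp_poly.
have cf := cont_at_of_continuous f_cont.
have minors x h p q : minor (on_line f x h) n.+1 p q = 0.
  apply: minors_of_equispaced => [t|t s]; first exact: cont_at_on_line.
  rewrite -[RHS](f_det (x + t *: h) (s *: h)); congr (\det _).
  by apply/matrixP => i j; rewrite !mxE /on_line scalerDl scalerA addrA.
have [|r [rn H1 H2]] := @maximal_rank (fun r => forall x h p q, minor (on_line f x h) r p q = 0) n.+1 _ minors.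
  by move=> /(_ 0 0 (fun=> 0) (fun=> 0)); exact: minor0.
case: r rn H1 H2 => [|r] _ H1 H2.
  apply: exp_poly_ext (exp_poly0 R d) => x; have := H1 x 0 (fun=> 0) (fun=> 0).
  by rewrite /minor det_mx11 mxE /on_line scaler0 addr0.
have /existsNP[x0 /existsNP[h0 H3]] := H2.
have [p [q [p0 M0]]] := not_forall_minor H3.
(* maximal rank is an open condition on the direction *)
have [e [e0 He]] : exists e : R, e != 0 /\ forall j : 'I_d,
    minor (on_line f x0 (h0 + e *: delta_mx 0 j)) r.+1 p q != 0.
  have : \forall e \near (0 : R), forall j : 'I_d,
      minor (on_line f x0 (h0 + e *: delta_mx 0 j)) r.+1 p q != 0.
    apply: (@filter_forall _ _ (fun (j : 'I_d) (e : R) =>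
      minor (on_line f x0 (h0 + e *: delta_mx 0 j)) r.+1 p q != 0) (nbhs (0 : R))) => j.
    apply: (@cont_at_near_neq0 R R (fun e : R =>
      minor (on_line f x0 (h0 + e *: delta_mx 0 j)) r.+1 p q) 0); last by rewrite scale0r addr0.
    apply: cont_at_det => k l.
    pose F (e : R) := x0 + (p k + q l + 0) *: (h0 + e *: delta_mx 0 j).
    have -> : (fun e : R => node_mx (on_line f x0 (h0 + e *: delta_mx 0 j)) r.+1 p q 0 k l) =
      (fun e => f (F e)) by apply/funext => z; rewrite mxE.
    apply: (@cont_at_comp _ _ _ F f); last exact: cf.
    apply: cvgD; first exact: cvg_cst.
    apply: cvgZl_tmp; apply: cvgD; first exact: cvg_cst.
    by apply: cvgZr_tmp; exact: cvg_id.
  move=> [e /= e0 He]; exists (e / 2); split; first by rewrite gt_eqF // divr_gt0.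
  apply: He; rewrite /= sub0r normrN gtr0_norm ?divr_gt0 //.
  by rewrite ltr_pdivrMr // ltr_pMr // ltr1n.
(* x = sum_j (x_j / e) (h0 + e e_j) - (sum_j x_j / e) h0 *)
pose ws : seq ('rV[R]_d * 'rV[R]_d) :=
  (h0, \row_j (- e^-1)) :: [seq (h0 + e *: delta_mx 0 j, e^-1 *: delta_mx 0 j) | j <- enum 'I_d].
have good wa : wa \in ws -> minor (on_line f x0 wa.1) r.+1 p q != 0.
  by rewrite inE => /orP[/eqP->//|/mapP[j _ ->]]; exact: He.
have := @exp_poly_of_directions R d f ws _ 0.
have /[swap] /[apply] : forall wa, wa \in ws -> exists (r : nat) (q : nat -> R) (b : 'I_r -> R -> R[i]),
     (forall j, exp_poly (fun x => b j (linform wa.2 x))) /\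
     forall y t, f (y + t *: wa.1) = \sum_(j < r) b j t * f (y + q j *: wa.1).
  move=> wa /good Mwa.
  exists r.+1, q, (@shift_coef _ _ f r p q x0 wa.1); split=> [j|y t].
    have [s Es] := shift_coef_jordan cf p q x0 wa.1 H1 j.
    by apply: exp_poly_ext (exp_poly_jordan s _) => x; rewrite Es.
  exact: (finite_shift_rank cf H1 p0 Mwa).
apply: exp_poly_ext => x; rewrite add0r; congr f.
rewrite /ws big_cons big_map big_enum /=.
have lin1 (j : 'I_d) : linform (e^-1 *: delta_mx 0 j) x = e^-1 * x 0 j.
  rewrite /linform (bigD1 j) //= big1 => [|k kj].
    by rewrite !mxE !eqxx mulr1 addr0.
  by rewrite !mxE eqxx (negPf kj) mulr0 mul0r.
have lin0 : linform (\row_j (- e^-1)) x = - \sum_(j < d) e^-1 * x 0 j.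
  by rewrite /linform -sumrN; apply: eq_bigr => j _; rewrite mxE mulNr.
under eq_bigr do rewrite lin1 scalerDr scalerA.
rewrite big_split /= -scaler_suml lin0 scaleNr addKr.
rewrite [RHS]row_sum_delta; apply: eq_bigr => j _.
by rewrite mulrAC mulVf // mul1r.
Qed.
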